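(* Let $n\ge 1$ be an integer, let $0<\gamma<n$ and $1<p<\infty$, and let $p\le q<\infty$. Let $\alpha,\beta$ be real numbers such that $$\alpha<\frac{n}{p'},\qquad \beta<\frac{n}{q},\qquad \alpha+\beta\ge (n-1)\left(\frac1q-\frac1p\right),\qquad \frac1q=\frac1p+\frac{\gamma+\alpha+\beta}{n}-1 .$$ Then there is a constant $C$, independent of $v$, such that the inequality $$\big\||x|^{-\beta}T_\gamma v\big\|_{L^q(\mathbb{R}^n)}\le C\,\big\||x|^{\alpha}v\big\|_{L^p(\mathbb{R}^n)}$$ holds for all radially symmetric $v\in L^p(\mathbb{R}^n,|x|^{p\alpha}dx)$.
   Context: For $0<\gamma<n$, the fractional integral operator is $$(T_\gamma v)(x)=\int_{\mathbb{R}^n}\frac{v(y)}{|x-y|^\gamma}\,dy .$$ Here $p'$ denotes the conjugate exponent of $p$, i.e. $\frac1p+\frac1{p'}=1$. A function $v$ on $\mathbb{R}^n$ is radially symmetric if $v(x)=v_0(|x|)$ for some function $v_0$ on $(0,\infty)$ (for $n=1$ this means that $v$ is even). The space $L^p(\mathbb{R}^n,|x|^{p\alpha}dx)$ consists of the measurable $v$ with $|x|^\alpha v\in L^p(\mathbb{R}^n)$. *)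

(* Defs.v *)
From HB Require Import structures.
From mathcomp Require Import all_boot all_order all_algebra.
From mathcomp Require Import all_classical all_reals all_analysis.
From mathcomp Require Import measurable_realfun.
Import Order.TTheory GRing.Theory Num.Theory.
Import numFieldNormedType.Exports.

Set Implicit Arguments.
Unset Strict Implicit.
Unset Printing Implicit Defensive.

Local Open Scope classical_set_scope.
Local Open Scope ring_scope.

(* R^n with its Borel sigma-algebra. *)
Notation "''Rn[' R ]_ n" := (n.-tuple (measurableTypeR R))
  (at level 8, n at level 2, format "''Rn[' R ]_ n") : type_scope.

Definition consRn (R : realType) (n : nat)
    (xt : measurableTypeR R * 'Rn[R]_n) : 'Rn[R]_n.+1 :=
  [tuple of xt.1 :: xt.2].

(* n-dimensional Lebesgue measure, as the n-fold product of the
   one-dimensional one; R^0 is a single point of mass 1. *)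
Fixpoint lebesgueRn (R : realType) (n : nat) : set ('Rn[R]_n) -> \bar R :=
  match n with
  | 0 => dirac [tuple]
  | m.+1 => pushforward (@lebesgue_measure R \x @lebesgueRn R m)%E (@consRn R m)
  end.
Arguments lebesgueRn : clear implicits.

Section lebesgueRn_measure.
Variable R : realType.

Lemma measurable_consRn n : measurable_fun setT (@consRn R n).
Proof. exact: (measurable_cons measurable_fst measurable_snd). Qed.

Definition unconsRn n (t : 'Rn[R]_n.+1) : measurableTypeR R * 'Rn[R]_n :=
  (thead t, [tuple of behead t]).

Lemma consRnK n : cancel (@consRn R n) (@unconsRn n).
Proof. by move=> [x t]; congr pair; apply/val_inj. Qed.

Lemma unconsRnK n : cancel (@unconsRn n) (@consRn R n).
Proof. by move=> t; rewrite /consRn [RHS]tuple_eta. Qed.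

Lemma measurable_unconsRn n : measurable_fun setT (@unconsRn n).
Proof.
apply: measurable_fun_pair; first exact: measurable_tnth.
exact: measurable_behead.
Qed.

Section step.
Variables (n : nat) (mu : {sigma_finite_measure set ('Rn[R]_n) -> \bar R}).
Let nu := pushforward (@lebesgue_measure R \x mu)%E (@consRn R n).
Let nuM := measure_function_pushforward__canonical__measure_function_Measure
  (@lebesgue_measure R \x mu)%E (@measurable_consRn n).

Let nu0 : nu set0 = 0%E. Proof. exact: (measure0 nuM). Qed.
Let nu_ge0 A : (0 <= nu A)%E. Proof. exact: (measure_ge0 nuM). Qed.
Let nu_sigma_additive : semi_sigma_additive nu.
Proof. exact: (@measure_semi_sigma_additive _ _ _ nuM). Qed.

#[local] HB.instance Definition _ := isMeasure.Build _ _ _ nu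
  nu0 nu_ge0 nu_sigma_additive.

Let nu_sigma_finite : sigma_finite setT nu.
Proof.
have /sigma_finiteP[F [TF ndF Foo]] := sigma_finiteT (@lebesgue_measure R).
have /sigma_finiteP[G [TG ndG Goo]] := sigma_finiteT mu.
have FGT : [set: measurableTypeR R * 'Rn[R]_n] = \bigcup_i (F i `*` G i).
  apply/esym; rewrite -subTset => -[x t] _.
  have [i _ Fix] : (\bigcup_i F i) x by rewrite -TF.
  have [j _ Gjt] : (\bigcup_i G i) t by rewrite -TG.
  exists (maxn i j) => //; split.
  - by move: x Fix; exact/subsetPset/ndF/leq_maxl.
  - by move: t Gjt; exact/subsetPset/ndG/leq_maxr.
have FGoo i : measurable (F i `*` G i) /\
    ((@lebesgue_measure R \x mu) (F i `*` G i) < +oo)%E.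
  have [? ?] := Foo i; have [? ?] := Goo i.
  split; first exact: measurableX.
  by rewrite product_measure1E// lte_mul_pinfty// ge0_fin_numE.
exists (fun i => @unconsRn n @^-1` (F i `*` G i)).
  by rewrite -preimage_bigcup -FGT preimage_setT.
move=> i; have [mFG FGi] := FGoo i; split.
  by rewrite -[X in measurable X]setTI; exact: measurable_unconsRn.
rewrite /nu /pushforward -comp_preimage.
suff -> : @unconsRn n \o @consRn R n = id by [].
by apply/funext => t /=; rewrite consRnK.
Qed.

#[local] HB.instance Definition _ := Measure_isSigmaFinite.Build _ _ _ nu
  nu_sigma_finite.

Definition lebesgueRn_step : {sigma_finite_measure set ('Rn[R]_n.+1) -> \bar R} :=
  nu.
End step.

Lemma lebesgueRn_sigma_finite_measure n :
  {mu : {sigma_finite_measure set ('Rn[R]_n) -> \bar R} |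
    lebesgueRn R n = mu :> (set _ -> \bar R)}.
Proof.
elim: n => [|n [mu IH]]; first by exists (dirac [tuple]).
by exists (lebesgueRn_step mu); rewrite /= IH.
Qed.

Section instances.
Variable n : nat.

Let l0 : lebesgueRn R n set0 = 0%E.
Proof. by have [mu ->] := lebesgueRn_sigma_finite_measure n; exact: measure0. Qed.

Let l_ge0 A : (0 <= lebesgueRn R n A)%E.
Proof. by have [mu ->] := lebesgueRn_sigma_finite_measure n. Qed.

Let l_sigma_additive : semi_sigma_additive (lebesgueRn R n).
Proof.
have [mu ->] := lebesgueRn_sigma_finite_measure n.
exact: measure_semi_sigma_additive.
Qed.

HB.instance Definition _ := isMeasure.Build _ _ _ (lebesgueRn R n)
  l0 l_ge0 l_sigma_additive.

Let l_sigma_finite : sigma_finite setT (lebesgueRn R n).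
Proof. by have [mu ->] := lebesgueRn_sigma_finite_measure n; exact: sigma_finiteT. Qed.

HB.instance Definition _ := Measure_isSigmaFinite.Build _ _ _ (lebesgueRn R n)
  l_sigma_finite.
End instances.

Lemma lebesgueRn_box n (A : 'I_n -> set (measurableTypeR R)) :
  (forall i, measurable (A i)) ->
  lebesgueRn R n [set t | forall i, A i (tnth t i)] =
  (\prod_(i < n) lebesgue_measure (A i))%E.
Proof.
elim: n A => [|n IH] A mA.
  by rewrite big_ord0 /= diracE mem_set//= => -[].
rewrite big_ord_recl /= /pushforward.
rewrite -IH; last by move=> i; exact: mA.
rewrite -product_measure1E//; last first.
  rewrite (_ : [set _ | _] = \bigcap_(i in [set: 'I_n])
      ((fun t : 'Rn[R]_n => tnth t i) @^-1` A (lift ord0 i))).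
    apply: fin_bigcap_measurable => // i _.
    by rewrite -[X in measurable X]setTI; exact: measurable_tnth.
  by apply/seteqP; split => [t At i _|t At i]; [exact: At|exact: (At i)].
congr ((_ \x _)%E _); apply/seteqP; split => -[x t] /=.
  move=> At; split; first exact: (At ord0).
  by move=> i; have := At (lift ord0 i); rewrite tnthS.
by move=> [Ax At] i; have [j ->|->//] := unliftP ord0 i; rewrite tnthS.
Qed.

End lebesgueRn_measure.

Section radial.
Variables (R : realType) (n : nat).
Implicit Types (x y : 'Rn[R]_n) (v : 'Rn[R]_n -> R).

Definition enorm x : R := Num.sqrt (\sum_(i < n) tnth x i ^+ 2).

Definition subRn x y : 'Rn[R]_n := [tuple tnth x i - tnth y i | i < n].

(* Extended-real valued: where the integral of v^+ or of v^- against the kernel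
   diverges the value is infinite, so that a finite norm of
   [fractional_integral gamma v] entails almost everywhere absolute
   convergence.  The kernel takes the junk value 0 at the null set y = x. *)
Definition fractional_integral (gamma : R) v x : \bar R :=
  (\int[lebesgueRn R n]_y (v y / enorm (subRn x y) `^ gamma)%:E)%E.

(* v0 is only constrained on ]0, +oo[. *)
Definition radially_symmetric v :=
  exists v0 : R -> R, forall x, 0 < enorm x -> v x = v0 (enorm x).

(* Measurability with respect to the completed sigma-algebra, which is weaker
   than the Borel measurability [measurable_fun setT v]. *)
Definition lebesgue_measurable_fun v :=
  forall B : set (measurableTypeR R), measurable B ->
    completed_algebra_gen (lebesgueRn R n) (v @^-1` B).

(* L^p(R^n, |x|^(p a) dx) *)
Definition weighted_Lp (p a : R) : set ('Rn[R]_n -> R) :=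
  [set v | lebesgue_measurable_fun v /\
     finite_norm (lebesgueRn R n) p%:E (fun x => enorm x `^ a * v x)].

End radial.

(* Main.v *)
(** Only the radial variable matters, and no rotation is ever used.

    If [f >= 0] is radial, its mass on the ball [B(x, t)] is at most
    [C (t / |x|)^(n-1)] times its mass on the shell [| |y| - |x| | < t]: after
    slicing along a coordinate in which [x] is large this is a one-dimensional
    statement.  Integrating over [t] against a power of [t] (layer cake) replaces
    the kernel [|x - y|^-(delta + n - 1)] by [|x|^(1-n) | |x| - |y| |^-delta].

    Put [a = n/p' - alpha > 0] and [b = n/q - beta > 0]; the scaling relation says
    [gamma = a + b].  It follows that [|x|^b T_gamma f] is dominated by an integral
    operator with kernel [kappa(| ln |x| - ln |y| |)] with respect to the measure
    [|y|^-n dy], where [kappa(s)] is [s^-delta] for small [s] and [s^-2] for large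
    [s], and where balls of the logarithmic distance have linear growth.  The
    hypothesis [alpha + beta >= (n-1)(1/q - 1/p)] says that
    [delta = 1 + 1/q - 1/p] is admissible when [p < q]; when [p = q], any
    [delta < 1] close to [1] will do.

    What remains is the Hardy-Littlewood-Sobolev inequality ([p < q]) or Young's
    inequality ([p = q]) on a space of linear growth.  At the level [l] one cuts
    the kernel at a distance proportional to [l^-q] and the function at a height
    proportional to [l^(q/p)]; the far part and the low part contribute at most
    [l / 2], and Chebyshev's inequality for the rest can be integrated over [l]. *)
From HB Require Import structures.
Require Import Defs.
From mathcomp Require Import all_boot all_order all_algebra.
From mathcomp Require Import all_classical all_reals all_analysis.
From mathcomp Require Import measurable_realfun ring lra.
Import Order.TTheory GRing.Theory Num.Theory.
Import numFieldNormedType.Exports.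

Set Implicit Arguments.
Unset Strict Implicit.
Unset Printing Implicit Defensive.

Local Open Scope classical_set_scope.
Local Open Scope ring_scope.

(** * Nonnegative integrals on the line *)

(** Each hypothesis on the exponents has one task. Off the annulus [|x|/2 <= |y| <= 2|x|] the kernel
    is comparable to a power of the larger radius, and [a, b > 0] turn the ratio of the radii into
    exponential decay in the logarithmic distance. On the annulus the passage from balls to shells
    costs exactly the power [n - 1], whence [gamma <= delta + n - 1]; any surplus is absorbed
    because [|x - y| <= 3|x|] there. No interpolation theorem is invoked. The cuts depend on the
    level, so the weak type bound keeps the mass of [g] above a height, and Tonelli turns its
    integral over the levels into the integral of [g^p]. The price is that the cut presupposes a
    normalised [g]; homogeneity removes this. The second obstacle is measurability: [v] is
    measurable for the completed sigma-algebra only. The estimates are made for a Borel profile [h]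
    with [h(|y|^n) = |v y|] almost everywhere, and the comparison of integrals is arranged for
    functions that may fail to be Borel. The variable [|y|^n] is preferred to [|y|] because polar
    coordinates then have a constant Jacobian. *)

Section nonneg_integral.
Context d (T : measurableType d) (R : realType) (m : {measure set T -> \bar R}).
Local Open Scope ereal_scope.

(** The integral of a nonnegative function is a supremum over the simple functions below it, so
    monotonicity is immediate for arbitrary functions. This matters at the end, where the integrands
    built from [v] are not known to be Borel. *)
Lemma le_nonneg_integral (f g : T -> \bar R) : (forall x, 0 <= f x) ->
  (forall x, f x <= g x) -> \int[m]_x f x <= \int[m]_x g x.
Proof.
move=> f0 fg.
have g0 x : 0 <= g x by exact: le_trans (fg x).
rewrite !ge0_integralE//; apply: ge_ereal_sup => _ [h hf <-].
apply: ereal_sup_ubound; exists h => // x.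
by apply: le_trans (hf x) _; rewrite !patch_setT.
Qed.

End nonneg_integral.

Section pow.
Variable R : realType.
Notation mu := (@lebesgue_measure R).

Lemma powR_continuous_at (a x : R) : 0 < x -> {for x, continuous (fun t => t `^ a)}.
Proof.
move=> x0; apply: differentiable_continuous; apply/derivable1_diffP.
by apply: derivable_powR; rewrite in_itv/= andbT.
Qed.

Lemma powRN_cvg_pinfty (a : R) : 0 < a -> x `^ (- a) @[x --> +oo] --> 0.
Proof.
move=> a0; apply/cvgrPdist_lt => e e0; near=> x.
have x0 : e `^ (- a^-1) < x by near: x; exact: nbhs_pinfty_gt.
have ea : 0 < e `^ (- a^-1) by rewrite powR_gt0.
have xp : 0 < x by exact: lt_trans x0.
rewrite sub0r normrN ger0_norm ?powR_ge0// powRN.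
rewrite invf_plt ?posrE ?powR_gt0//.
have := gt0_ltr_powR a0 (ltW ea : _ \in Num.nneg) (ltW xp : _ \in Num.nneg) x0.
by rewrite -powRrM mulNr mulVf ?gt_eqF// powRN powRr1// ltW.
Unshelve. all: by end_near. Qed.

(** Writes a negative power as a superposition of the indicators of [z < t]; through it, integrals
    of kernels reduce to measures of sublevel sets. *)
Lemma integral_powR_tail (z a : R) : 0 < z -> 0 < a ->
  (\int[mu]_t (if (z < t)%R then a * t `^ (- a - 1) else 0)%R%:E = (z `^ (- a))%:E)%E.
Proof.
move=> z0 a0.
have dpow (t : R) : 0 < t -> is_derive t (1 : R) (fun t : R => - t `^ (- a)) (a * t `^ (- a - 1)).
  move=> t0; have -> : a * t `^ (- a - 1) = - (- a * t `^ (- a - 1)).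
    by rewrite mulNr opprK.
  by apply: is_deriveN; exact: is_derive1_powR.
transitivity (\int[mu]_(t in `[z, +oo[) (a * t `^ (- a - 1))%:E)%E.
  rewrite -integral_itv_obnd_cbnd; last first.
    apply/measurable_EFinP; apply: measurable_funM => //.
    exact: measurable_funTS (measurable_powR _).
  rewrite [RHS]integral_mkcond; apply: eq_integral => t _.
  rewrite patchE; case: ifPn => zt; case: ifPn => //.
    by rewrite notin_setE/= in_itv/= zt.
  by rewrite inE/= in_itv/= (negbTE zt).
rewrite (@ge0_continuous_FTC2y _ _ (fun t => - t `^ (- a)) _ 0).
- by rewrite -EFinB sub0r opprK.
- by move=> x zx; rewrite mulr_ge0 ?powR_ge0// ltW.
- apply: continuous_in_subspaceT => x.
  rewrite inE/= in_itv/= andbT => zx.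
  apply: cvgM; first exact: cvg_cst.
  by apply: powR_continuous_at; apply: lt_le_trans zx.
- by rewrite -oppr0; apply: cvgN; exact: powRN_cvg_pinfty.
- by move=> x zx; apply: ex_derive; apply: dpow; apply: lt_trans zx.
- apply: cvg_at_right_filter; apply: cvgN; exact: powR_continuous_at.
- move=> x; rewrite in_itv/= andbT => zx; rewrite derive1E.
  by apply: derive_val; apply: dpow; apply: lt_trans zx.
Qed.

Lemma measurable_powR_tail (z a : R) :
  measurable_fun setT (fun t => (if (z < t)%R then a * t `^ (- a - 1) else 0)%:E).
Proof.
apply/measurable_EFinP; apply: measurable_fun_ifT => //.
  exact: measurable_fun_ltr.
by apply: measurable_funM => //; exact: measurable_powR.
Qed.

(** The integrand is unbounded at 0, so the fundamental theorem of calculus is applied on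
    [[1/(i+1), r]] and the limit is taken by monotone convergence. *)
Lemma integral_powR_head_le (r a : R) : 0 < r -> 0 <= a -> a < 1 ->
  (\int[mu]_t (if (0 < t < r)%R then t `^ (- a) else 0)%R%:E
    <= (r `^ (1 - a) / (1 - a))%:E)%E.
Proof.
move=> r0 a0 a1.
have b0 : 0 < 1 - a by rewrite subr_gt0.
pose f (t : R) : R := if (0 < t < r)%R then t `^ (- a) else 0.
have mf : measurable_fun setT (fun t => (f t)%:E).
  apply/measurable_EFinP; apply: measurable_fun_ifT => //.
    by apply: measurable_and; exact: measurable_fun_ltr.
have f0 t : (0 <= (f t)%:E)%E by rewrite /f; case: ifP => // _; rewrite lee_fin powR_ge0.
pose F (i : nat) : set R := `[i.+1%:R^-1, r]%classic.
have nF : nondecreasing_seq F.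
  move=> i j ij; rewrite subsetEset => x; rewrite /F/= !in_itv/= => /andP[xi ->].
  by rewrite andbT; apply: le_trans xi; rewrite lef_pV2 ?posrE// ler_nat ltnS.
have cvF : (\int[mu]_(t in F i) (f t)%:E @[i --> \oo] -->
    \int[mu]_(t in \bigcup_i F i) (f t)%:E)%E.
  apply: ge0_nondecreasing_set_cvg_integral => //.
  - by move=> i; exact: measurable_itv.
  - by move=> i; exact: measurable_funTS.
have -> : (\int[mu]_t (f t)%:E = \int[mu]_(t in \bigcup_i F i) (f t)%:E)%E.
  rewrite [RHS]integral_mkcond.
  apply: eq_integral => t _; rewrite patchE; case: ifPn => //.
  rewrite notin_setE => nF'; rewrite /f; case: ifPn => // /andP[t0 tr].
  exfalso; apply: nF'; have [i ti] := ltr_add_invr t0.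
  by exists i => //; rewrite /F/= in_itv/= (ltW tr) -(add0r _^-1) ltW.
move/cvg_lim : (cvF) => <-//.
apply: lime_le; first by apply/cvg_ex; eexists; exact: cvF.
apply: nearW => i; pose c : R := i.+1%:R^-1.
have c0 : 0 < c by rewrite invr_gt0.
have rb0 : 0 <= r `^ (1 - a) / (1 - a) by rewrite divr_ge0 ?powR_ge0// ltW.
have [rc|cr] := leP r c.
  rewrite integral0_eq ?lee_fin// => t; rewrite /F/= in_itv/= => /andP[ct tr].
  by rewrite /f (ltNge t r) (le_trans rc ct) andbF.
have dpow (t : R) : 0 < t ->
    is_derive t (1 : R) (fun t : R => (1 - a)^-1 * t `^ (1 - a)) (t `^ (- a)).
  move=> t0; have -> : t `^ (- a) = (1 - a)^-1 *: ((1 - a) * t `^ (1 - a - 1)).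
    rewrite /GRing.scale/= mulrA mulVf ?gt_eqF// mul1r; congr (_ `^ _).
    by rewrite addrAC subrr add0r.
  by apply: is_deriveZ; exact: is_derive1_powR.
have Cpow (t : R) : 0 < t ->
    {for t, continuous (fun t : R => (1 - a)^-1 * t `^ (1 - a))}.
  by move=> t0; apply: cvgM; [exact: cvg_cst|exact: powR_continuous_at].
apply: (@le_trans _ _ (\int[mu]_(t in F i) (t `^ (- a))%:E)%E).
  apply: ge0_le_integral => //.
  - exact: measurable_itv.
  - exact: measurable_funTS.
  - by apply/measurable_EFinP; exact: measurable_funTS (measurable_powR _).
  - by move=> t _; rewrite /f lee_fin; case: ifP => // _; rewrite powR_ge0.
rewrite (@continuous_FTC2 _ _ (fun t => (1 - a)^-1 * t `^ (1 - a)))//.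
- rewrite -EFinB lee_fin [leRHS]mulrC lerBlDr lerDl.
  by rewrite mulr_ge0 ?powR_ge0// invr_ge0 ltW.
- apply: continuous_in_subspaceT => x; rewrite inE/= in_itv/= => /andP[cx _].
  by apply: powR_continuous_at; apply: lt_le_trans cx.
- split.
  + by move=> x; rewrite in_itv/= => /andP[cx _]; apply: ex_derive; apply: dpow; apply: lt_trans cx.
  + by apply: cvg_at_right_filter; exact: Cpow.
  + by apply: cvg_at_left_filter; exact: Cpow.
- move=> x; rewrite in_itv/= => /andP[cx _]; rewrite derive1E.
  by apply: derive_val; apply: dpow; apply: lt_trans cx.
Qed.

Lemma integral_inv (a b : R) : 0 < a -> a < b ->
  (\int[mu]_t (if (a < t < b)%R then t `^ (- 1) else 0)%R%:E = (ln b - ln a)%:E)%E.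
Proof.
move=> a0 ab.
transitivity (\int[mu]_(t in `[a, b]) (t `^ (- 1))%:E)%E.
  rewrite (@integral_itv_bndoo _ _ _ (fun t => (t `^ (- 1))%:E)); last first.
    by apply/measurable_EFinP; exact: measurable_funTS (measurable_powR _).
  rewrite [RHS]integral_mkcond; apply: eq_integral => t _.
  rewrite patchE; case: ifPn => zt; case: ifPn => //.
    by rewrite notin_setE/= in_itv/= zt.
  by rewrite inE/= in_itv/= (negbTE zt).
rewrite (@continuous_FTC2 _ _ (@ln R))//.
- apply: continuous_in_subspaceT => x; rewrite inE/= in_itv/= => /andP[cx _].
  by apply: powR_continuous_at; apply: lt_le_trans cx.
- split.
  + move=> x; rewrite in_itv/= => /andP[cx _]; apply: ex_derive.
    by apply: is_derive1_ln; apply: lt_trans cx.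
  + by apply: cvg_at_right_filter; apply: continuous_ln.
  + by apply: cvg_at_left_filter; apply: continuous_ln; apply: lt_trans ab.
- move=> x; rewrite in_itv/= => /andP[cx _]; rewrite derive1E.
  rewrite powR_inv1 ?ltW ?(lt_trans a0)//.
  by apply: derive_val; apply: is_derive1_ln; apply: lt_trans cx.
Qed.

Lemma integral_dilate (c : R) (f : R -> \bar R) : 0 < c ->
  measurable_fun setT f -> (forall x, 0 <= f x)%E ->
  (\int[mu]_x f (c * x)%R = c^-1%:E * \int[mu]_x f x)%E.
Proof.
move=> c0 mf f0.
pose phi (x : measurableTypeR R) : measurableTypeR R := c * x.
have mphi : measurable_fun setT phi by exact: measurable_funM.
have ci0 : 0 <= c^-1 by rewrite invr_ge0 ltW.
pose cn : {nonneg R} := NngNum (ltW c0).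
pose ci : {nonneg R} := NngNum ci0.
pose nu : {measure set (measurableTypeR R) -> \bar R} :=
  measure_function_pushforward__canonical__measure_function_Measure mu mphi.
have E (A : set (measurableTypeR R)) : measurable A ->
    pushforward mu phi A = mscale ci mu A.
  (* Uniqueness of Lebesgue measure is invoked for [c] times the push-forward, which gives every
     half-open interval its length. *)
  move=> mA; suff : (mu A = mscale cn nu A)%E.
    rewrite /mscale/= => ->.
    by rewrite muleA -EFinM mulVf ?gt_eqF// mul1e.
  apply: (@lebesgue_measure_unique R (mscale cn nu)) => //= X [[a b] _ <-].
  rewrite /mscale/= /pushforward.
  have -> : (phi @^-1` `]a, b]) = `]c^-1 * a, c^-1 * b]%classic.
    apply/seteqP; split => x /=; rewrite /phi !in_itv/=.
      by rewrite ltr_pdivrMl// ler_pdivlMl//.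
    by rewrite ltr_pdivrMl// ler_pdivlMl//.
  rewrite !lebesgue_measure_itv/= !lte_fin ltr_pM2l ?invr_gt0//.
  case: ifPn => ab; last by rewrite mule0.
  by rewrite -!EFinB -EFinM -mulrBr mulrA mulfV ?gt_eqF// mul1r.
have := @ge0_integral_pushforward _ _ (measurableTypeR R) (measurableTypeR R) R phi mphi mu setT f measurableT
  mf (fun x _ => f0 x).
rewrite preimage_setT => <-.
transitivity (\int[mscale ci mu]_x f x)%E; last by rewrite ge0_integral_mscale.
by apply: (@eq_measure_integral _ (measurableTypeR R) R setT (mscale ci mu) nu) => A mA _; exact: E.
Qed.

(* [lebesgue_measure] is the outer measure induced by the lengths of intervals,
   so covering by intervals transfers the hypothesis to Borel sets. *)
Lemma measure_le_lebesgue (nu : {measure set (measurableTypeR R) -> \bar R}) (C : R) :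
  0 < C ->
  (forall a b : R, a < b -> (nu `]a, b]%classic <= (C * (b - a))%:E)%E) ->
  forall A, measurable A -> (nu A <= C%:E * mu A)%E.
Proof.
move=> C0 nuC A mA; rewrite -lee_pdivrMl//.
apply: le_ereal_inf_tmp => _ [F [mF AF] <-].
rewrite lee_pdivrMl//.
have ocF k : ocitv (F k) by exact: mF.
have mFk k : measurable (F k : set (measurableTypeR R)).
  by have [[a b] _ <-] := ocF k; exact: measurable_itv.
apply: (@le_trans _ _ (\sum_(k <oo) nu (F k))%E).
  apply: (@measure_sigma_subadditive _ _ _ nu) => //.
rewrite -nneseriesZl//.
apply: lee_nneseries => // k _.
have [[a b] _ <-] := ocF k.
suff : (nu `]a, b]%classic <= C%:E * (if (a < b)%R then (b - a)%:E else 0))%E.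
  by have /= := wlength_itv idfun `]a, b]; rewrite lte_fin EFinB => <-.
have [ab|ba] := ltP a b; first by rewrite -EFinM; exact: nuC.
by rewrite set_itv_ge ?measure0 ?mule0//= -leNgt.
Qed.
End pow.

(** * Lebesgue measure on R^n: dilations, balls and radial functions *)

Section Rn.
Variable R : realType.
Notation mu := (@lebesgue_measure R).
Local Open Scope ereal_scope.

Section tonelli.
Variables (n : nat) (f : 'Rn[R]_n.+1 -> \bar R).
Hypotheses (mf : measurable_fun setT f) (f0 : forall y, 0 <= f y).

Let mfc : measurable_fun setT (fun z => f (@consRn R n z)).
Proof. by apply: measurableT_comp => //; exact: measurable_consRn. Qed.

Lemma integral_lebesgueRnS1 :
  \int[lebesgueRn R n.+1]_y f y =
  \int[mu]_x \int[lebesgueRn R n]_t f (@consRn R n (x, t)).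
Proof.
have := @ge0_integral_pushforward _ _ _ _ R _ (@measurable_consRn R n)
  (mu \x lebesgueRn R n) setT f measurableT mf (fun y _ => f0 y).
rewrite preimage_setT => E.
rewrite -(fubini_tonelli1 (fun z => f (consRn z)))// -E.
Qed.

Lemma integral_lebesgueRnS2 :
  \int[lebesgueRn R n.+1]_y f y =
  \int[lebesgueRn R n]_t \int[mu]_x f (@consRn R n (x, t)).
Proof.
by rewrite integral_lebesgueRnS1 (fubini_tonelli (fun z => f (consRn z))).
Qed.

Lemma measurable_int_consRn1 :
  measurable_fun setT (fun x : measurableTypeR R => \int[lebesgueRn R n]_t f (@consRn R n (x, t))).
Proof. exact: (measurable_fun_fubini_tonelli_F (fun z => f (consRn z))). Qed.
End tonelli.

Definition scaleRn n (c : R) (y : 'Rn[R]_n) : 'Rn[R]_n := [tuple (c * tnth y i)%R | i < n].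

Lemma measurable_tuple_fun d (T : measurableType d) n (F : 'I_n -> T -> measurableTypeR R) :
  (forall i, measurable_fun setT (F i)) ->
  measurable_fun setT (fun x => [tuple F i x | i < n] : 'Rn[R]_n).
Proof.
move=> mF; apply/measurable_fun_tnthP => i.
by apply: eq_measurable_fun (mF i) => x _; rewrite /= tnth_mktuple.
Qed.

Lemma measurable_scaleRn n (c : R) : measurable_fun setT (@scaleRn n c).
Proof.
apply: measurable_tuple_fun => i; apply: measurable_funM => //.
exact: measurable_tnth.
Qed.

Lemma consRn_scale n (c x : R) (t : 'Rn[R]_n) :
  scaleRn c (consRn (x, t)) = consRn ((c * x)%R : measurableTypeR R, scaleRn c t).
Proof.
apply: eq_from_tnth => i; rewrite tnth_mktuple.
by have [j ->|->] := unliftP ord0 i; rewrite ?tnthS ?tnth_mktuple// !tnth0.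
Qed.

Lemma integral_scaleRn n (c : R) (f : 'Rn[R]_n -> \bar R) : (0 < c)%R ->
  measurable_fun setT f -> (forall x, 0 <= f x) ->
  \int[lebesgueRn R n]_x f (scaleRn c x) = (c ^- n)%:E * \int[lebesgueRn R n]_x f x.
Proof.
move=> c0; elim: n f => [|n IH] f mf f0.
  rewrite expr0 invr1 mul1e; apply: eq_integral => x _; congr f.
  by apply: eq_from_tnth => -[].
rewrite !integral_lebesgueRnS1//; last first.
  by apply: measurableT_comp => //; exact: measurable_scaleRn.
under eq_integral => x _.
  under eq_integral => t _ do rewrite consRn_scale.
  rewrite (IH (fun t => f (consRn ((c * x)%R : measurableTypeR R, t))))//; last first.
    apply: measurableT_comp => //; apply: measurableT_comp; first exact: measurable_consRn.
    exact: measurable_pair1.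
  over.
have mF := measurable_int_consRn1 mf f0.
have F0 x : 0 <= \int[lebesgueRn R n]_t f (consRn (x, t)) by exact: integral_ge0.
rewrite ge0_integralZl; [|exact: measurableT| |by move=> x _; exact: F0|]; last 2 first.
- by apply: (measurableT_comp mF); exact: measurable_funM.
- by rewrite lee_fin invr_ge0 exprn_ge0// ltW.
rewrite (integral_dilate c0 mF F0) muleA -EFinM; congr (_%:E * _).
by rewrite exprSr invfM.
Qed.

Lemma enormE n (y : 'Rn[R]_n) : enorm y = ((\sum_(i < n) tnth y i ^+ 2) `^ 2^-1)%R.
Proof. by rewrite powR12_sqrt// sumr_ge0// => i _; exact: sqr_ge0. Qed.

Lemma measurable_enorm n : measurable_fun setT (@enorm R n).
Proof.
rewrite (funext (@enormE n)); apply: (measurableT_comp (measurable_powR _)).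
apply: measurable_sum => i; apply: measurable_funX; exact: measurable_tnth.
Qed.

Lemma enorm_ge0 n (y : 'Rn[R]_n) : (0 <= enorm y)%R.
Proof. exact: sqrtr_ge0. Qed.

Lemma sqr_enorm n (y : 'Rn[R]_n) : (enorm y ^+ 2 = \sum_(i < n) tnth y i ^+ 2)%R.
Proof. by rewrite sqr_sqrtr// sumr_ge0// => i _; exact: sqr_ge0. Qed.

Lemma sqr_enorm_cons n (x : R) (t : 'Rn[R]_n) :
  (enorm (consRn (x : measurableTypeR R, t)) ^+ 2 = x ^+ 2 + enorm t ^+ 2)%R.
Proof.
rewrite !sqr_enorm big_ord_recl tnth0; congr (_ + _)%R.
by apply: eq_bigr => i _; rewrite tnthS.
Qed.

Lemma enorm_scale n (c : R) (y : 'Rn[R]_n) : (0 <= c)%R ->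
  (enorm (scaleRn c y) = c * enorm y)%R.
Proof.
move=> c0; apply/eqP; rewrite -(@eqrXn2 _ 2) ?enorm_ge0 ?mulr_ge0 ?enorm_ge0//.
rewrite exprMn !sqr_enorm mulr_sumr; apply/eqP; apply: eq_bigr => i _.
by rewrite tnth_mktuple exprMn.
Qed.

Lemma ler_tnth_enorm n (y : 'Rn[R]_n) i : (`|tnth y i| <= enorm y)%R.
Proof.
rewrite -ler_sqr ?nnegrE ?enorm_ge0// sqr_enorm -normrX ger0_norm ?sqr_ge0//.
by rewrite (bigD1 i)//= lerDl sumr_ge0// => j _; exact: sqr_ge0.
Qed.

Lemma measurable_subRn n (x : 'Rn[R]_n) : measurable_fun setT (subRn x).
Proof.
apply: measurable_tuple_fun => i; apply: measurable_funB => //.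
exact: measurable_tnth.
Qed.

Lemma enorm_cauchy_schwarz n (x y : 'Rn[R]_n) :
  (\sum_(i < n) tnth x i * tnth y i <= enorm x * enorm y)%R.
Proof.
have [x0|x0] := eqVneq (enorm x) 0%R.
  rewrite x0 mul0r big1// => i _.
  have := ler_tnth_enorm x i; rewrite x0 normr_le0 => /eqP ->; exact: mul0r.
have [y0|y0] := eqVneq (enorm y) 0%R.
  rewrite y0 mulr0 big1// => i _.
  have := ler_tnth_enorm y i; rewrite y0 normr_le0 => /eqP ->; exact: mulr0.
have xp : (0 < enorm x)%R by rewrite lt_def x0 enorm_ge0.
have yp : (0 < enorm y)%R by rewrite lt_def y0 enorm_ge0.
(* Expanded, this sum is [2 |x| |y| (|x| |y| - x.y)]; the degenerate cases were removed so that one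
   can divide. *)
have : (0 <= \sum_(i < n) (enorm y * tnth x i - enorm x * tnth y i) ^+ 2)%R.
  by apply: sumr_ge0 => i _; exact: sqr_ge0.
under eq_bigr do rewrite sqrrB.
rewrite big_split sumrB/=.
under eq_bigr do rewrite exprMn.
rewrite -mulr_sumr -sqr_enorm.
under [X in (_ + X)%R]eq_bigr do rewrite exprMn.
rewrite -[X in (_ + X)%R]mulr_sumr -sqr_enorm.
under eq_bigr do rewrite -mulr_natl mulrACA.
rewrite -mulr_sumr -mulr_sumr => H.
rewrite -(@ler_pM2l _ (2 * (enorm y * enorm x))%R) ?mulr_gt0//.
by nra.
Qed.

Lemma enorm_sub_ge n (x y : 'Rn[R]_n) : (`|enorm x - enorm y| <= enorm (subRn x y))%R.
Proof.
rewrite -ler_sqr ?nnegrE ?enorm_ge0// -normrX ger0_norm ?sqr_ge0//.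
rewrite sqrrB [leRHS]sqr_enorm.
under eq_bigr do rewrite tnth_mktuple sqrrB.
rewrite big_split sumrB/= -!sqr_enorm lerD2r lerD2l lerN2.
by rewrite sumrMnl lerMn2r/= enorm_cauchy_schwarz.
Qed.

Lemma subRnK n (x y : 'Rn[R]_n) : subRn x (subRn x y) = y.
Proof. by apply: eq_from_tnth => i; rewrite !tnth_mktuple subKr. Qed.

(** The reverse triangle inequality for [x] and [x - y], whose difference is [y]. *)
Lemma enorm_sub_le n (x y : 'Rn[R]_n) : (enorm (subRn x y) <= enorm x + enorm y)%R.
Proof.
rewrite addrC -lerBlDr; apply: le_trans (ler_norm _) _.
by rewrite distrC -[in leRHS](subRnK x y); exact: enorm_sub_ge.
Qed.

Lemma measurable_ball_enorm n (x : 'Rn[R]_n) (t : R) :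
  measurable [set y : 'Rn[R]_n | (enorm (subRn x y) < t)%R].
Proof.
rewrite -[X in measurable X]setTI.
have : measurable_fun setT (fun y : 'Rn[R]_n => (enorm (subRn x y) < t)%R).
  apply: measurable_fun_ltr => //.
  by apply: (measurableT_comp (@measurable_enorm n)); exact: measurable_subRn.
by move=> /(_ measurableT [set true] Logic.I); congr (measurable (_ `&` _));
  apply/seteqP; split.
Qed.

Lemma lebesgueRn_ball_le n (x : 'Rn[R]_n) (t : R) : (0 < t)%R ->
  lebesgueRn R n [set y : 'Rn[R]_n | (enorm (subRn x y) < t)%R] <= ((2 * t) ^+ n)%:E.
Proof.
move=> t0.
pose A (i : 'I_n) : set (measurableTypeR R) := `]tnth x i - t, tnth x i + t[%classic%R.
have mA i : measurable (A i) by exact: measurable_itv.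
have mbox : measurable [set y : 'Rn[R]_n | forall i, A i (tnth y i)].
  rewrite (_ : [set _ | _] = \bigcap_(i in [set: 'I_n])
      ((fun t : 'Rn[R]_n => tnth t i) @^-1` A i)).
    apply: fin_bigcap_measurable => // i _.
    by rewrite -[X in measurable X]setTI; exact: measurable_tnth.
  by apply/seteqP; split => [y Ay i _|y Ay i]; [exact: Ay|exact: (Ay i)].
apply: (@le_trans _ _ (lebesgueRn R n [set y : 'Rn[R]_n | forall i, A i (tnth y i)])).
  apply: le_measure; rewrite ?inE//; first exact: measurable_ball_enorm.
  move=> y /= yt i; rewrite /A/= in_itv/=.
  have := le_lt_trans (ler_tnth_enorm (subRn x y) i) yt.
  by rewrite tnth_mktuple ltr_norml => /andP[h1 h2]; apply/andP; split; lra.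
rewrite lebesgueRn_box//.
under eq_bigr => i _.
  rewrite lebesgue_measure_itv/= lte_fin ifT; last by lra.
  rewrite -EFinB (_ : _ - _ = 2 * t)%R; last by lra.
  over.
by rewrite prodEFin prodr_const card_ord.
Qed.

Lemma lebesgueRn_scale n (c : R) (A : set ('Rn[R]_n)) : (0 < c)%R -> measurable A ->
  lebesgueRn R n (@scaleRn n c @^-1` A) = (c ^- n)%:E * lebesgueRn R n A.
Proof.
move=> c0 mA.
have mcA : measurable (@scaleRn n c @^-1` A).
  by rewrite -[X in measurable X]setTI; exact: measurable_scaleRn.
transitivity (\int[lebesgueRn R n]_x (\1_A (scaleRn c x))%:E).
  by rewrite -[LHS]/(lebesgueRn R n _) -[X in lebesgueRn R n X]setIT -integral_indic.
rewrite (integral_scaleRn (f := fun x => (\1_A x)%:E))//.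
  by rewrite integral_indic// setIT.
by apply/measurable_EFinP; exact: measurable_indic.
Qed.

Lemma measurable_enormX n m : measurable_fun setT (fun y : 'Rn[R]_n => (enorm y ^+ m)%R).
Proof. by apply: measurable_funX; exact: measurable_enorm. Qed.

Lemma measurable_le_enormX n m s : measurable [set y : 'Rn[R]_n | (enorm y ^+ m <= s)%R].
Proof.
rewrite -[X in measurable X]setTI.
have : measurable_fun setT (fun y : 'Rn[R]_n => (enorm y ^+ m <= s)%R).
  by apply: measurable_fun_ler => //; exact: measurable_enormX.
by move=> /(_ measurableT [set true] Logic.I); congr (measurable (_ `&` _));
  apply/seteqP; split.
Qed.

(** For [n > 0] this is the closed unit ball, described through [|y|^n] because the volume of
    [|y|^n <= s] is linear in [s]. *)
Definition unit_ball_volume n : R := fine (lebesgueRn R n [set y : 'Rn[R]_n | (enorm y ^+ n <= 1)%R]).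

Lemma unit_ball_volume_ge0 n : (0 <= unit_ball_volume n)%R.
Proof. by rewrite fine_ge0. Qed.

Lemma lebesgueRn_enorm_le n (s : R) : (0 < n)%N -> (0 <= s)%R ->
  lebesgueRn R n [set y : 'Rn[R]_n | (enorm y ^+ n <= s)%R] = (unit_ball_volume n * s)%:E.
Proof.
move=> n0.
have nR0 : (n%:R != 0 :> R)%R by rewrite pnatr_eq0 -lt0n.
have H1 : lebesgueRn R n [set y : 'Rn[R]_n | (enorm y ^+ n <= 1)%R] = (unit_ball_volume n)%:E.
  rewrite fineK// ge0_fin_numE//.
  apply: (@le_lt_trans _ _ ((2 * 2) ^+ n)%R%:E); last exact: ltry.
  apply: le_trans (@lebesgueRn_ball_le n [tuple 0%R | i < n] 2 _); last by lra.
  apply: le_measure; rewrite ?inE; [exact: measurable_le_enormX|exact: measurable_ball_enorm|].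
  move=> y /= y1; rewrite (_ : enorm _ = enorm y).
    have : (enorm y <= 1)%R by rewrite -(@ler_pXn2r _ n) ?nnegrE ?enorm_ge0// expr1n.
    lra.
  rewrite /enorm; congr Num.sqrt; apply: eq_bigr => i _.
  by rewrite !tnth_mktuple sub0r sqrrN.
have Hp t : (0 < t)%R -> lebesgueRn R n [set y : 'Rn[R]_n | (enorm y ^+ n <= t)%R] = (unit_ball_volume n * t)%:E.
  move=> t0; pose c := (t `^ (- n%:R^-1))%R.
  have c0 : (0 < c)%R by rewrite powR_gt0.
  have cn : (c ^+ n = t^-1)%R.
    by rewrite /c -powR_mulrn ?powR_ge0// -powRrM mulNr mulVf// powR_inv1// ltW.
  have -> : [set y : 'Rn[R]_n | (enorm y ^+ n <= t)%R] =
      @scaleRn n c @^-1` [set y : 'Rn[R]_n | (enorm y ^+ n <= 1)%R].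
    apply/seteqP; split => y /=; rewrite enorm_scale ?(ltW c0)// exprMn cn.
      by rewrite ler_pdivrMl// mulr1.
    by rewrite ler_pdivrMl// mulr1.
  rewrite lebesgueRn_scale//; last exact: measurable_le_enormX.
  by rewrite H1 cn invrK -EFinM mulrC.
rewrite le_eqVlt => /predU1P[<-|]; last exact: Hp.
rewrite mulr0; apply/eqP; rewrite eq_le measure_ge0 andbT.
apply/lee_addgt0Pr => e e0; rewrite add0e.
(* The null sublevel set is squeezed between sublevel sets of volume at most [e]. Adding 1 guards
   against a zero volume: positivity is proved afterwards, from this lemma. *)
pose s' := (e / (unit_ball_volume n + 1))%R.
have o1 : (0 < unit_ball_volume n + 1)%R by rewrite ltr_wpDl ?unit_ball_volume_ge0.
have s'0 : (0 < s')%R by rewrite divr_gt0.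
apply: (@le_trans _ _ (lebesgueRn R n [set y : 'Rn[R]_n | (enorm y ^+ n <= s')%R])).
  apply: le_measure; rewrite ?inE; [exact: measurable_le_enormX|exact: measurable_le_enormX|].
  by move=> y /= y0; apply: le_trans y0 _; exact: ltW.
rewrite Hp// lee_fin /s' mulrCA ler_piMr ?(ltW e0)// ler_pdivrMr// mul1r lerDl.
by [].
Qed.

(** If it were 0, the ball of radius [n] would be null; but it contains the unit cube, whose points
    have norm at most [sqrt n]. *)
Lemma unit_ball_volume_gt0 n : (0 < n)%N -> (0 < unit_ball_volume n)%R.
Proof.
move=> n0; rewrite lt_neqAle unit_ball_volume_ge0 andbT; apply/eqP => o0.
have := lebesgueRn_enorm_le n0 (ler0n R (n ^ n)).
rewrite -o0 mul0r => H.
pose A (i : 'I_n) : set (measurableTypeR R) := `[0%R, 1%R]%classic.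
have mA i : measurable (A i) by exact: measurable_itv.
have := lebesgueRn_box mA.
rewrite big1; last by move=> i _; rewrite lebesgue_measure_itv/= lte01 sube0.
suff -> : lebesgueRn R n [set t | forall i, A i (tnth t i)] = 0 by apply/eqP; rewrite lt_eqF.
apply/eqP; rewrite eq_le measure_ge0 andbT -[leRHS]H.
apply: le_measure; rewrite ?inE; last 2 first.
- exact: measurable_le_enormX.
- move=> y /= Ay; rewrite natrX ler_pXn2r// ?nnegrE ?enorm_ge0//.
  rewrite -ler_sqr ?nnegrE ?enorm_ge0// sqr_enorm.
  apply: (@le_trans _ _ (\sum_(i < n) 1)%R).
    apply: ler_sum => i _; have := Ay i; rewrite /A/= in_itv/= => /andP[h0 h1].
    by rewrite exprn_ile1.
  by rewrite sumr_const card_ord -natrX ler_nat -[leqLHS]expn1 leq_pexp2l.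
- rewrite (_ : [set _ | _] = \bigcap_(i in [set: 'I_n])
      ((fun t : 'Rn[R]_n => tnth t i) @^-1` A i)).
    apply: fin_bigcap_measurable => // i _.
    by rewrite -[X in measurable X]setTI; exact: measurable_tnth.
  by apply/seteqP; split => [y Ay i _|y Ay i]; [exact: Ay|exact: (Ay i)].
Qed.
End Rn.

(** * Polar coordinates in the variable [|y|^n] *)

Section polar.
Variables (R : realType) (n : nat).
Hypothesis n0 : (0 < n)%N.
Notation mu := (@lebesgue_measure R).
Notation mun := (lebesgueRn R n).
Local Open Scope ereal_scope.

(** This variable absorbs the factor [r^(n-1)] of polar coordinates: the push-forward of Lebesgue
    measure is a multiple of Lebesgue measure on the half-line. *)
Let N (y : 'Rn[R]_n) : measurableTypeR R := (enorm y ^+ n)%R.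

Let mN : measurable_fun setT N. Proof. exact: measurable_enormX. Qed.

Let nu : {measure set (measurableTypeR R) -> \bar R} :=
  measure_function_pushforward__canonical__measure_function_Measure mun mN.

Let N0 y : (0 <= N y)%R. Proof. by rewrite exprn_ge0// enorm_ge0. Qed.

Let nu_itv (a b : R) : (a <= b)%R ->
  nu `]a, b]%classic = (unit_ball_volume R n * (Num.max b 0 - Num.max a 0))%:E.
Proof.
move=> ab; rewrite /nu/= /pushforward.
have [a0|a0] := leP 0%R a.
  have b0 : (0 <= b)%R by exact: le_trans ab.
  have -> : N @^-1` `]a, b] = [set y | (enorm y ^+ n <= b)%R] `\`
      [set y | (enorm y ^+ n <= a)%R].
    apply/seteqP; split => y /=; rewrite in_itv/=.
      by move=> /andP[ay yb]; split => //; apply/negP; rewrite -ltNge.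
    by move=> [yb /negP]; rewrite -ltNge => ->.
  rewrite measureD//=; [|exact: measurable_le_enormX|exact: measurable_le_enormX|]; last first.
    by rewrite lebesgueRn_enorm_le// ltry.
  rewrite setIidr; last by move=> y /= /le_trans; exact.
  rewrite !lebesgueRn_enorm_le// -EFinB -mulrBr.
  by rewrite (max_l b0).
have [b0|b0] := ltP b 0%R.
  rewrite subrr mulr0.
  rewrite (_ : N @^-1` _ = set0) ?measure0//.
  apply/seteqP; split => y //=; rewrite in_itv/= => /andP[_].
  by move=> /(le_trans (N0 y)); rewrite leNgt b0.
rewrite subr0 -lebesgueRn_enorm_le//; congr (mun _).
apply/seteqP; split => y /=; rewrite in_itv/=.
  by move=> /andP[].
by move=> ->; rewrite (lt_le_trans a0 (N0 y)).
Qed.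

Let D : set (measurableTypeR R) := `]0%R, +oo[%classic.

Let mD : measurable D. Proof. exact: measurable_itv. Qed.

Let omn : {nonneg R} := NngNum (unit_ball_volume_ge0 R n).

Let nuE (A : set (measurableTypeR R)) : measurable A ->
  nu A = mscale omn (mrestr mu mD) A.
Proof.
apply: (@measure_unique _ R (measurableTypeR R) (@ocitv R)
  (fun k => `](- k%:R)%R, k%:R]%classic) _ _ _ _ nu (mscale omn (mrestr mu mD))) => //.
- by move=> X Y; exact: ocitvI.
- by move=> i; exists (- i%:R, i%:R)%R.
- by rewrite bigcup_itvT.
- move=> X [[a b] _ <-].
  change (nu `]a, b]%classic = mscale omn (mrestr mu mD) `]a, b]%classic).
  have [ab|ba] := leP b a; first by rewrite set_itv_ge ?measure0// -leNgt.
  rewrite nu_itv ?(ltW ba)// /mscale/= /mrestr.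
  rewrite EFinM; congr (_ * _).
  rewrite (_ : _ `&` _ = `]Num.max a 0%R, b]%classic); last first.
    apply/seteqP; split => x; rewrite /D/= !in_itv/= gt_max andbT.
      by move=> [/andP[-> ->] ->].
    by move=> /andP[/andP[-> ->] ->].
  rewrite lebesgue_measure_itv/= lte_fin gt_max ba andTb.
  have [b0|b0] := ltP 0%R b; first by rewrite EFinB.
  by rewrite (max_r (le_trans (ltW ba) b0)) subrr.
- move=> k; rewrite nu_itv ?ltry//.
  by rewrite (@le_trans _ _ 0%R)// oppr_le0.
Qed.

Lemma integral_radial (h : R -> \bar R) : measurable_fun setT h -> (forall t, 0 <= h t) ->
  \int[mun]_y (if (0 < enorm y)%R then h (enorm y ^+ n)%R else 0) =
  (unit_ball_volume R n)%:E * \int[mu]_t (if (0 < t)%R then h t else 0).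
Proof.
move=> mh h0.
transitivity (\int[nu]_(t in D) h t).
  have := @ge0_integral_pushforward _ _ _ _ R N mN mun D h mD (measurable_funTS mh)
    (fun x _ => h0 x).
  move=> ->.
  rewrite [RHS]integral_mkcond; apply: eq_integral => y _.
  have E : (0 < enorm y ^+ n)%R = (0 < enorm y)%R.
    by rewrite !lt_def expf_eq0 n0 exprn_ge0 ?enorm_ge0.
  rewrite patchE; case: ifPn => y0; case: ifPn => //.
    by rewrite notin_setE/= /D/= in_itv/= andbT E y0.
  by rewrite inE/= /D/= in_itv/= andbT E (negbTE y0).
rewrite (eq_measure_integral (mscale omn mu)).
  rewrite ge0_integral_mscale//; last exact: measurable_funTS.
  congr (_ * _); rewrite integral_mkcond; apply: eq_integral => y _.
  rewrite patchE; case: ifPn => y0; case: ifPn => //.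
    by move: y0; rewrite inE/= /D/= in_itv/= andbT => ->.
  by move: y0; rewrite notin_setE/= /D/= in_itv/= andbT => /negP/negbTE ->.
by move=> A mA AD; rewrite nuE// /mscale/= /mrestr setIidl.
Qed.
End polar.

(** * Balls against shells *)

Section set_tools.
Context d (T : measurableType d) (R : realType).
Local Open Scope ereal_scope.

Lemma measurable_bool_set (P : T -> bool) :
  measurable_fun setT P -> measurable [set x | P x].
Proof.
move=> /(_ measurableT [set true] Logic.I); rewrite setTI.
by congr measurable; apply/seteqP; split.
Qed.

Lemma measure_integral_if (m : {measure set T -> \bar R}) (P : T -> bool) :
  measurable_fun setT P -> m [set x | P x] = \int[m]_x (if P x then 1 else 0).
Proof.
move=> mP; rewrite -[X in m X]setIT -(integral_indic m measurableT (measurable_bool_set mP)).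
apply: eq_integral => x _; rewrite indicE; case: ifPn => Px.
  by rewrite mem_set.
by rewrite memNset//; exact/negP.
Qed.

Lemma ge0_integral_mrestr (m : {measure set T -> \bar R}) (S : set T) (mS : measurable S)
  (f : T -> \bar R) : measurable_fun setT f -> (forall x, 0 <= f x) ->
  \int[mrestr m mS]_x f x = \int[m]_(x in S) f x.
Proof.
move=> mf f0.
have mSC : measurable (~` S) by exact: measurableC.
rewrite (@ge0_negligible_integral _ _ _ (mrestr m mS) setT (~` S))//; last first.
  by rewrite /= /mrestr setICl measure0.
rewrite setTD setCK; apply: eq_measure_integral => A mA AS.
by rewrite /= /mrestr setIidl.
Qed.

Lemma integral_if (m : {measure set T -> \bar R}) (P : T -> bool) (f : T -> \bar R) :
  \int[m]_(x in [set x | P x]) f x = \int[m]_x (if P x then f x else 0).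
Proof.
rewrite integral_mkcond; apply: eq_integral => x _; rewrite patchE.
case: ifPn; first by rewrite inE/= => ->.
by rewrite notin_setE/= => /negP/negbTE ->.
Qed.
End set_tools.

Section ball_shell_measure_le.
Variable R : realType.
Notation mu := (@lebesgue_measure R).
Local Open Scope ereal_scope.

Lemma ler_div_double (c u z : R) : (0 <= c)%R -> (0 < u)%R -> (0 < z)%R ->
  (z <= 2 * u)%R -> (c / u <= 2 * (c / z))%R.
Proof.
move=> c0 u0 z0 zu; rewrite ler_pdivrMr//.
have -> : (2 * (c / z) * u = c * ((2 * u) / z))%R by ring.
by rewrite ler_peMr// ler_pdivlMr// mul1r.
Qed.

Lemma subRn_cons n (x0 s : R) (x u : 'Rn[R]_n) :
  subRn (consRn (x0 : measurableTypeR R, x)) (consRn (s : measurableTypeR R, u)) =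
  consRn ((x0 - s)%R : measurableTypeR R, subRn x u).
Proof.
apply: eq_from_tnth => i; rewrite tnth_mktuple.
by have [j ->|->] := unliftP ord0 i; rewrite ?tnthS ?tnth_mktuple// !tnth0.
Qed.

Lemma enorm_cons_ge n (x0 : R) (x : 'Rn[R]_n) :
  (`|x0| <= enorm (consRn (x0 : measurableTypeR R, x)))%R /\
  (enorm x <= enorm (consRn (x0 : measurableTypeR R, x)))%R.
Proof.
split; rewrite -ler_sqr ?nnegrE ?enorm_ge0// sqr_enorm_cons.
  by rewrite -normrX ger0_norm ?sqr_ge0// lerDl sqr_ge0.
by rewrite lerDr sqr_ge0.
Qed.

(** Two points [s], [s1] of the slice satisfy [|s + s1| >= 2 |x0| - 2 t >= |x0|], while their
    squares differ by at most [b - a]. So the slice lies within [(b - a) / |x0|] of any of its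
    points. *)
Lemma sqr_slice_measure_le (x0 t a b : R) : (0 < t)%R -> (2 * t <= `|x0|)%R -> (a <= b)%R ->
  \int[mu]_s (if (`|x0 - s| < t) && (a < s ^+ 2 <= b) then 1 else 0)%R%:E
   <= (2 * ((b - a) / `|x0|))%:E.
Proof.
move=> t0 tx ab.
have x00 : (0 < `|x0|)%R by lra.
have L0 : (0 <= (b - a) / `|x0|)%R by rewrite divr_ge0 ?subr_ge0.
have LL0 : (0 <= 2 * ((b - a) / `|x0|))%R by lra.
pose P s := ((`|x0 - s| < t) && (a < s ^+ 2 <= b))%R.
have [[s1 Ps1]|noP] := pselect (exists s, P s); last first.
  rewrite integral0_eq ?lee_fin// => s _; case: ifPn => // Ps.
  by exfalso; apply: noP; exists s.
pose L := ((b - a) / `|x0|)%R.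
apply: (@le_trans _ _ (\int[mu]_s (if (s1 - L <= s <= s1 + L)%R then 1 else 0))).
  apply: le_nonneg_integral => s; first by case: ifP.
  case: ifPn => [Ps|_]; last by case: ifP.
  rewrite ifT//.
  have : (`|s - s1| * `|x0| <= b - a)%R.
    move: Ps Ps1 => /andP[h1 /andP[h2 h3]] /andP[k1 /andP[k2 k3]].
    have h : (`|x0| <= `|s + s1|)%R.
      have : (`|x0 + x0| <= `|x0 - s| + `|x0 - s1| + `|s + s1|)%R.
        have -> : (x0 + x0 = (x0 - s) + (x0 - s1) + (s + s1))%R by ring.
        by apply: le_trans (ler_normD _ _) _; rewrite lerD2r ler_normD.
      rewrite -mulr2n normrMn mulr2n; lra.
    apply: le_trans (_ : (`|s - s1| * `|s + s1| <= _)%R); first by rewrite ler_wpM2l.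
    by rewrite -normrM -subr_sqr ler_norml; apply/andP; split; lra.
  rewrite -ler_pdivlMr// -/L ler_norml => /andP[? ?]; apply/andP; split; lra.
rewrite -measure_integral_if; last by apply: measurable_and; apply: measurable_fun_ler.
have -> : [set s | (s1 - L <= s <= s1 + L)%R] = `[(s1 - L)%R, (s1 + L)%R]%classic.
  by apply/seteqP; split => s /=; rewrite in_itv.
rewrite /= lebesgue_measure_itv/=; case: ifPn => _; last by rewrite lee_fin.
by rewrite -EFinB lee_fin -/L; lra.
Qed.

Let E n (x : 'Rn[R]_n) (t a b : R) (y : 'Rn[R]_n) : bool :=
  ((enorm (subRn x y) < t) && (a < enorm y ^+ 2 <= b))%R.

Lemma measurable_ball_shell n x t a b : measurable_fun setT (@E n x t a b).
Proof.
apply: measurable_and.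
  apply: measurable_fun_ltr => //.
  by apply: (measurableT_comp (@measurable_enorm R n)); exact: measurable_subRn.
apply: measurable_and.
  by apply: measurable_fun_ltr => //; exact: measurable_enormX.
by apply: measurable_fun_ler => //; exact: measurable_enormX.
Qed.

(* Stated with squared norms so that fixing one coordinate [s] merely translates
   the interval by [s^2]; one slices along a coordinate in which [x] is large. *)
Lemma ball_shell_measure_le n : exists2 C : R, (0 < C)%R & forall (x : 'Rn[R]_n) (t a b : R),
  (0 < t)%R -> (t * 2 ^+ n.+1 <= enorm x)%R -> (a <= b)%R ->
  \int[lebesgueRn R n]_y (if @E n x t a b y then 1 else 0) <=
    (C * t ^+ n.-1 * ((b - a) / enorm x))%:E.
Proof.
elim: n => [|n [C C0 IH]].
  exists 1%R => // x t a b t0 tx.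
  exfalso; move: tx; rewrite /enorm big_ord0 sqrtr0 expr1; lra.
exists (2 ^+ n * 4 + C * 4)%R; first by rewrite addr_gt0 ?mulr_gt0 ?exprn_gt0.
move=> x; rewrite -(unconsRnK x); case: (unconsRn x) => x0 x' t a b t0 tx ab.
set z := consRn _ in tx *.
have z0 : (0 < enorm z)%R.
  by apply: lt_le_trans tx; rewrite mulr_gt0 ?exprn_gt0.
have mE : measurable_fun setT (fun y => if @E n.+1 z t a b y then 1 else 0 : \bar R).
  by apply: measurable_fun_ifT => //; exact: measurable_ball_shell.
have E0 y : 0 <= (if @E n.+1 z t a b y then 1 else 0 : \bar R) by case: ifP.
have bal : (0 <= (b - a) / enorm z)%R by rewrite divr_ge0 ?subr_ge0 ?enorm_ge0.
(* Either the first coordinate carries half of the norm, and one slices along it over a ball of the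
   remaining coordinates; or [x'] does, and the induction hypothesis bounds each slice while the
   first coordinate runs over an interval of length [2 t]. The two summands of the constant
   correspond to these cases. *)
have [xx|xx] := leP (enorm z) (2 * `|x0|)%R.
- rewrite integral_lebesgueRnS2//.
  apply: (@le_trans _ _ (\int[lebesgueRn R n]_u
     ((4 * ((b - a) / enorm z))%:E * (if (enorm (subRn x' u) < t)%R then 1 else 0)))).
    apply: le_nonneg_integral => u; first exact: integral_ge0.
    case: ifPn => ut; rewrite ?mule1 ?mule0; last first.
      rewrite integral0_eq// => s _; rewrite /E subRn_cons ifF//.
      apply/negP => /andP[h _]; move/negP: ut; apply.
      exact: le_lt_trans (enorm_cons_ge _ _).2 h.
    apply: (@le_trans _ _ (\int[mu]_s (if (`|x0 - s| < t) &&
      (a - enorm u ^+ 2 < s ^+ 2 <= b - enorm u ^+ 2) then 1 else 0)%R%:E)).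
      apply: le_nonneg_integral => // s; rewrite /E subRn_cons sqr_enorm_cons.
      case: ifPn => [/andP[h1 /andP[h2 h3]]|_]; last by case: ifP.
      rewrite (le_lt_trans (enorm_cons_ge _ _).1 h1)/= ifT//.
      by apply/andP; split; lra.
    have x00 : (0 < `|x0|)%R by lra.
    apply: le_trans (sqr_slice_measure_le t0 _ _) _.
    - have : (t * 4 <= t * 2 ^+ n.+2)%R.
        rewrite ler_wpM2l ?(ltW t0)// (_ : 4%R = 2 ^+ 2 :> R)%R; last by ring.
        by rewrite ler_eXn2l// ltr1n.
      by lra.
    - by rewrite lerD2r.
    - rewrite lee_fin opprB addrA subrK.
      have : ((b - a) / `|x0| <= 2 * ((b - a) / enorm z))%R.
        by apply: ler_div_double; rewrite ?subr_ge0.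
      by lra.
  have mb : measurable_fun setT (fun u : 'Rn[R]_n => (enorm (subRn x' u) < t)%R).
    apply: measurable_fun_ltr => //.
    by apply: (measurableT_comp (@measurable_enorm R n)); exact: measurable_subRn.
  rewrite ge0_integralZl//; last 3 first.
  - by apply: measurable_fun_ifT.
  - by move=> u _; case: ifP.
  - by rewrite lee_fin mulr_ge0.
  rewrite -measure_integral_if//.
  apply: le_trans (lee_wpmul2l _ (lebesgueRn_ball_le x' t0)) _; first by rewrite lee_fin mulr_ge0.
  rewrite -EFinM lee_fin exprMn.
  have : (0 <= C * 4 * t ^+ n * ((b - a) / enorm z))%R.
    by apply: mulr_ge0 => //; apply: mulr_ge0; [lra|rewrite exprn_ge0// ltW].
  by rewrite succnK; nra.
have xx' : (enorm z <= 2 * enorm x')%R.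
  have := sqr_enorm_cons x0 x'; rewrite -/z => H.
  rewrite -ler_sqr ?nnegrE ?enorm_ge0 ?mulr_ge0 ?enorm_ge0// exprMn.
  have : (`|x0| ^+ 2 * 4 <= enorm z ^+ 2)%R.
    rewrite (_ : _ * 4 = (2 * `|x0|) ^+ 2)%R; last by ring.
    by rewrite ler_sqr ?nnegrE ?enorm_ge0 ?mulr_ge0// ltW.
  rewrite -normrX ger0_norm ?sqr_ge0// H.
  by have := sqr_ge0 (enorm x'); lra.
have x'0 : (0 < enorm x')%R by lra.
have n0 : (0 < n)%N.
  rewrite lt0n; apply/eqP => n0; move: x'0; rewrite /enorm big1 ?sqrtr0 ?ltxx//.
  by case=> i i_lt; exfalso; move: i_lt; rewrite n0.
have tn : (t ^+ n = t * t ^+ n.-1)%R by rewrite -exprS prednK.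
rewrite integral_lebesgueRnS1//.
have K0 : (0 <= C * t ^+ n.-1 * ((b - a) / enorm x'))%R.
  by rewrite !mulr_ge0 ?subr_ge0 ?invr_ge0 ?enorm_ge0 ?exprn_ge0// ltW.
apply: (@le_trans _ _ (\int[mu]_s
   ((C * t ^+ n.-1 * ((b - a) / enorm x'))%:E * (if (`|x0 - s| < t)%R then 1 else 0)))).
  apply: le_nonneg_integral => s; first exact: integral_ge0.
  case: ifPn => st; rewrite ?mule1 ?mule0; last first.
    rewrite integral0_eq// => u _; rewrite /E subRn_cons ifF//.
    apply/negP => /andP[h _]; move/negP: st; apply.
    exact: le_lt_trans (enorm_cons_ge _ _).1 h.
  (* Dropping the first coordinate at most halves the norm of the centre; the power of 2 in the
     smallness hypothesis pays for it. *)
  have /IH : (a - s ^+ 2 <= b - s ^+ 2)%R by rewrite lerD2r.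
  move=> /(_ x' t t0); rewrite opprB addrA subrK => H; apply: le_trans (H _); last first.
    by move: tx; rewrite exprSr; nra.
  apply: le_nonneg_integral => u; first by case: ifP.
  rewrite /E subRn_cons sqr_enorm_cons.
  case: ifPn => [/andP[h1 /andP[h2 h3]]|_]; last by case: ifP.
  rewrite (le_lt_trans (enorm_cons_ge _ _).2 h1)/= ifT//.
  by apply/andP; split; lra.
have mb : measurable_fun setT (fun s : measurableTypeR R => (`|x0 - s| < t)%R).
  apply: measurable_fun_ltr => //; apply: measurableT_comp => //.
  exact: measurable_funB.
rewrite ge0_integralZl//; last 2 first.
- exact: measurable_fun_ifT.
- by move=> u _; case: ifP.
rewrite -measure_integral_if//.
have -> : [set s | (`|x0 - s| < t)%R] = `](x0 - t)%R, (x0 + t)%R[%classic.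
  apply/seteqP; split => s /=; rewrite in_itv/= ltr_norml => /andP[? ?]; apply/andP; split; lra.
rewrite /= lebesgue_measure_itv/= lte_fin ifT; last by lra.
rewrite -EFinB -EFinM lee_fin.
have h : ((b - a) / enorm x' <= 2 * ((b - a) / enorm z))%R.
  by apply: ler_div_double; rewrite ?subr_ge0.
have -> : (x0 + t - (x0 - t) = 2 * t)%R by ring.
apply: (@le_trans _ _ (C * t ^+ n.-1 * (2 * ((b - a) / enorm z)) * (2 * t)))%R.
  rewrite ler_wpM2r//; first by rewrite mulr_ge0// ltW.
  by rewrite ler_wpM2l// mulr_ge0 ?exprn_ge0// ltW.
have -> : (C * t ^+ n.-1 * (2 * ((b - a) / enorm z)) * (2 * t) =
   C * 4 * t ^+ n * ((b - a) / enorm z))%R by rewrite tn; ring.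
rewrite ler_wpM2r// ler_wpM2r ?exprn_ge0 ?(ltW t0)//.
by rewrite lerDr mulr_ge0// exprn_ge0.
Qed.
End ball_shell_measure_le.

(** * Balls against shells for arbitrary radial functions *)

Section ball_radial.
Variables (R : realType) (n : nat).
Hypothesis n0 : (0 < n)%N.
Notation mu := (@lebesgue_measure R).
Notation mun := (lebesgueRn R n).
Local Open Scope ereal_scope.

Lemma measurable_dist_lt (x : 'Rn[R]_n) (t : R) :
  measurable_fun setT (fun y : 'Rn[R]_n => (enorm (subRn x y) < t)%R).
Proof.
apply: measurable_fun_ltr => //.
by apply: (measurableT_comp (@measurable_enorm R n)); exact: measurable_subRn.
Qed.

Lemma measurable_radial (h : R -> \bar R) : measurable_fun setT h ->
  measurable_fun setT (fun y : 'Rn[R]_n => h (enorm y ^+ n)%R).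
Proof. by move=> mh; apply: (measurableT_comp mh); exact: measurable_enormX. Qed.

Lemma nth_rootK (a : R) : (0 <= a)%R -> ((a `^ n%:R^-1) ^+ n = a)%R.
Proof.
move=> a0; rewrite -powR_mulrn ?powR_ge0// -powRrM mulVf ?powRr1//.
by rewrite pnatr_eq0 -lt0n.
Qed.

Lemma nth_rootE (a : R) : (0 <= a)%R -> ((a ^+ n) `^ n%:R^-1 = a)%R.
Proof.
move=> a0; rewrite -powR_mulrn// -powRrM mulfV ?powRr1//.
by rewrite pnatr_eq0 -lt0n.
Qed.

(** Converts thickness in [|y|^2] into thickness in [|y|^n]: the left side is at most [4 r (B - A)],
    and [B^n - A^n >= (B - A) B^(n-1)] with [B >= r / 2]. *)
Lemma subr_sqr_le_subrX (r A B : R) : (0 < r)%R -> (0 <= A)%R -> (A <= B)%R ->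
  (r / 2 <= B)%R -> (B <= 2 * r)%R ->
  (B ^+ 2 - A ^+ 2 <= 4 * r * (2 / r) ^+ n.-1 * (B ^+ n - A ^+ n))%R.
Proof.
move=> r0 A0 AB rB Br.
have B0 : (0 < B)%R by lra.
have h1 : ((B - A) * B ^+ n.-1 <= B ^+ n - A ^+ n)%R.
  rewrite mulrBl -exprS prednK// lerD2l lerN2.
  by rewrite -{1}(prednK n0) exprS ler_wpM2l// lerXn2r ?nnegrE// ltW.
have h2 : (1 <= (2 / r) ^+ n.-1 * B ^+ n.-1)%R.
  rewrite -exprMn exprn_ege1// mulrAC ler_pdivlMr//; lra.
apply: (@le_trans _ _ (4 * r * ((2 / r) ^+ n.-1 * ((B - A) * B ^+ n.-1)))%R); last first.
  rewrite -[leRHS]mulrA ler_wpM2l//; first by lra.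
  by rewrite ler_wpM2l// exprn_ge0// divr_ge0// ltW.
rewrite subr_sqr (_ : _ * _ = (4 * r * (B - A)) * ((2 / r) ^+ n.-1 * B ^+ n.-1))%R; last by ring.
apply: (@le_trans _ _ (4 * r * (B - A))%R); first by nra.
by rewrite ler_peMr//; nra.
Qed.

(* In the variable [enorm y ^+ n] the volume of shells is a multiple of Lebesgue
   measure, so the comparison only has to be checked on intervals. *)
Lemma ball_radial_le : exists2 C : R, (0 < C)%R &
  forall (x : 'Rn[R]_n) (t : R) (h : R -> \bar R),
  (0 < enorm x)%R -> (0 < t)%R -> measurable_fun setT h -> (forall s, 0 <= h s) ->
  \int[mun]_y (if (enorm (subRn x y) < t)%R then h (enorm y ^+ n)%R else 0) <=
  (C * (t / enorm x) ^+ n.-1)%:E *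
  \int[mun]_y (if (`|enorm x - enorm y| < t)%R then h (enorm y ^+ n)%R else 0).
Proof.
have [C1 C10 Hslice] := ball_shell_measure_le R n.
(* For [t < c r] the slicing bound applies. For [t >= c r] the factor [(t / r)^(n-1)] is at least
   [c^(n-1)], and the inclusion of the ball in the shell is enough. The two summands of [C] serve
   these two cases. *)
pose c : R := (2 ^- n.+1)%R.
have c0 : (0 < c)%R by rewrite invr_gt0 exprn_gt0.
have c14 : (c <= 1 / 4)%R.
  rewrite /c ler_pdivlMr// -(_ : 2 ^+ 2 = 4 :> R)%R; last by ring.
  rewrite ler_pdivrMl ?exprn_gt0// mulr1 ler_eXn2l ?ltr1n//.
have o0 := unit_ball_volume_gt0 R n0.
pose C : R := (c ^- n.-1 + C1 * 4 * 2 ^+ n.-1 / unit_ball_volume R n)%R.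
have ca0 : (0 < c ^- n.-1)%R by rewrite invr_gt0 exprn_gt0.
have cb0 : (0 < C1 * 4 * 2 ^+ n.-1 / unit_ball_volume R n)%R.
  by rewrite divr_gt0// mulr_gt0 ?exprn_gt0// mulr_gt0.
exists C; first exact: addr_gt0.
move=> x t h; set r := enorm x => r0 t0 mh h0.
have I0 : 0 <= \int[mun]_y (if (`|r - enorm y| < t)%R then h (enorm y ^+ n)%R else 0).
  by apply: integral_ge0 => y _; case: ifP.
have [ct|tc] := leP (c * r)%R t.
  have CC : (1 <= C * (t / r) ^+ n.-1)%R.
    apply: (@le_trans _ _ (c ^- n.-1 * (t / r) ^+ n.-1)%R); last first.
      by rewrite ler_wpM2r ?exprn_ge0 ?divr_ge0 ?ltW// ltrDl.
    rewrite -exprVn -exprMn exprn_ege1// mulrA ler_pdivlMr// mul1r.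
    by rewrite mulrC ler_pdivlMr// mulrC.
  apply: (@le_trans _ _ (1%:E * \int[mun]_y (if (`|r - enorm y| < t)%R then h (enorm y ^+ n)%R else 0))).
    rewrite mul1e; apply: le_nonneg_integral => y; first by case: ifP.
    case: ifPn => yt; last by case: ifP.
    by rewrite ifT// (le_lt_trans (enorm_sub_ge x y)).
  by rewrite lee_wpmul2r// lee_fin.
pose K : R := (C1 * t ^+ n.-1 * 4 * (2 / r) ^+ n.-1)%R.
have K0 : (0 < K)%R.
  have ? : (0 < t ^+ n.-1)%R by rewrite exprn_gt0.
  have ? : (0 < (2 / r) ^+ n.-1)%R by rewrite exprn_gt0// divr_gt0.
  by rewrite /K mulr_gt0// mulr_gt0// mulr_gt0.
pose N (y : 'Rn[R]_n) : measurableTypeR R := (enorm y ^+ n)%R.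
have mN : measurable_fun setT N by exact: measurable_enormX.
have mS : measurable [set y : 'Rn[R]_n | (enorm (subRn x y) < t)%R].
  exact: (measurable_bool_set (measurable_dist_lt x t)).
(* The volume restricted to the ball, transported by [|y|^n]; [nuK] bounds its density with respect
   to Lebesgue measure by [K]. *)
pose nu : {measure set (measurableTypeR R) -> \bar R} :=
  measure_function_pushforward__canonical__measure_function_Measure (mrestr mun mS) mN.
have nuK (X : set (measurableTypeR R)) : measurable X -> nu X <= K%:E * mu X.
  apply: measure_le_lebesgue => // a b ab.
  (* Points of the ball have norm between [r / 2] and [2 r], since [t < r / 4]. Truncating the
     interval to this range loses nothing and makes [subr_sqr_le_subrX] applicable. *)
  pose a' := Num.max a ((r / 2) ^+ n)%R.
  pose b' := Num.min b ((2 * r) ^+ n)%R.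
  have rn0 : (0 < (r / 2) ^+ n)%R by rewrite exprn_gt0// divr_gt0.
  have in_range y : (enorm (subRn x y) < t)%R -> (a < N y <= b)%R ->
      (a' < N y <= b')%R.
    move=> yt /andP[ay yb]; have := le_lt_trans (enorm_sub_ge x y) yt.
    rewrite -/r ltr_norml => /andP[h1 h2].
    have cr : (c * r <= r / 4)%R by nra.
    rewrite gt_max ay le_min yb/=; apply/andP; split.
      by rewrite ltrXn2r -?lt0n//; lra.
    by rewrite ler_pXn2r ?nnegrE ?enorm_ge0//; lra.
  rewrite /nu/= /pushforward /mrestr.
  have [ba|ab'] := ltP b' a'.
    rewrite (_ : _ `&` _ = set0).
      by rewrite measure0 lee_fin; apply: mulr_ge0; [exact: ltW|rewrite subr_ge0 ltW].
    apply/seteqP; split => y //= [yab yt].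
    have /andP[h1 h2] := in_range y yt yab.
    by move: ba; rewrite ltNge (ltW (lt_le_trans h1 h2)).
  have a'0 : (0 <= a')%R by rewrite le_max (ltW rn0) orbT.
  have b'0 : (0 <= b')%R by exact: le_trans ab'.
  pose A := (a' `^ n%:R^-1)%R; pose B := (b' `^ n%:R^-1)%R.
  have An : (A ^+ n = a')%R by exact: nth_rootK.
  have Bn : (B ^+ n = b')%R by exact: nth_rootK.
  have A0 : (0 <= A)%R by exact: powR_ge0.
  have B0 : (0 <= B)%R by exact: powR_ge0.
  have AB : (A <= B)%R by rewrite -(@ler_pXn2r _ n) ?nnegrE// An Bn.
  have tr : (t * 2 ^+ n.+1 <= enorm x)%R.
    by rewrite -ler_pdivlMr ?exprn_gt0// mulrC ltW.
  have AB2 : (A ^+ 2 <= B ^+ 2)%R by rewrite ler_sqr ?nnegrE.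
  have := Hslice x t (A ^+ 2)%R (B ^+ 2)%R t0 tr AB2.
  rewrite -measure_integral_if; last exact: measurable_ball_shell.
  move=> H; apply: le_trans (le_trans _ H) _.
    apply: le_measure; rewrite ?inE.
    - by apply: measurableI => //; rewrite -[X in measurable X]setTI; apply: (@measurable_enormX R n n).
    - exact: (measurable_bool_set (measurable_ball_shell _ _ _ _)).
    - move=> y /= []; rewrite in_itv/= => yab yt.
      have /andP[h1 h2] := in_range y yt yab.
      rewrite yt/=; apply/andP; split.
        rewrite ltr_sqr ?nnegrE ?enorm_ge0//.
        by rewrite -(@ltr_pXn2r _ n) ?nnegrE ?enorm_ge0// An.
      rewrite ler_sqr ?nnegrE ?enorm_ge0//.
      by rewrite -(@ler_pXn2r _ n) ?nnegrE ?enorm_ge0// Bn.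
  rewrite lee_fin -/r.
  have rB : (r / 2 <= B)%R.
    rewrite -(@ler_pXn2r _ n) ?nnegrE ?divr_ge0 ?(ltW r0)// Bn.
    by apply: le_trans ab'; rewrite le_max lexx orbT.
  have Br : (B <= 2 * r)%R.
    rewrite -(@ler_pXn2r _ n) ?nnegrE ?mulr_ge0 ?(ltW r0)// Bn.
    by rewrite ge_min lexx orbT.
  have hsq := subr_sqr_le_subrX r0 A0 AB rB Br.
  have tn0 : (0 <= t ^+ n.-1)%R by rewrite exprn_ge0// ltW.
  have h' : ((B ^+ 2 - A ^+ 2) / r <= 4 * (2 / r) ^+ n.-1 * (b - a))%R.
    rewrite ler_pdivrMr//; apply: (le_trans hsq).
    rewrite An Bn (_ : 4 * (2 / r) ^+ n.-1 * (b - a) * r = 4 * r * (2 / r) ^+ n.-1 * (b - a))%R; last by ring.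
    apply: ler_wpM2l.
      by rewrite mulr_ge0 ?mulr_ge0 ?exprn_ge0 ?divr_ge0 ?(ltW r0).
    by rewrite lerB// ?ge_min ?le_max lexx.
  rewrite (_ : K * (b - a) = C1 * t ^+ n.-1 * (4 * (2 / r) ^+ n.-1 * (b - a)))%R; last by rewrite /K; ring.
  by apply: ler_wpM2l => //; exact: mulr_ge0 (ltW C10) tn0.
pose J s := (`|r - s `^ n%:R^-1| < t)%R.
have mJ : measurable_fun setT J.
  apply: measurable_fun_ltr => //; apply: measurableT_comp => //.
  by apply: measurable_funB => //; exact: measurable_powR.
pose hJ s := if J s then h s else 0.
have mhJ : measurable_fun setT hJ by exact: measurable_fun_ifT.
have hJ0 s : 0 <= hJ s by rewrite /hJ; case: ifP.
apply: (@le_trans _ _ (\int[nu]_s (if (0 < s)%R then hJ s else 0))).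
  have mif : measurable_fun setT (fun s : R => if (0 < s)%R then hJ s else 0).
    by apply: measurable_fun_ifT => //; exact: measurable_fun_ltr.
  have := @ge0_integral_pushforward _ _ _ _ R N mN (mrestr mun mS) setT
    (fun s : R => if (0 < s)%R then hJ s else 0) measurableT mif.
  rewrite preimage_setT => -> //; last by move=> s _; case: ifP.
  rewrite (ge0_integral_mrestr mun mS)/=; [|by apply: measurableT_comp mif mN|by move=> y /=; case: ifP].
  rewrite integral_if; apply: le_nonneg_integral => y; first by case: ifP.
  case: ifPn => // yt.
  have := le_lt_trans (enorm_sub_ge x y) yt.
  rewrite -/r /N => yrt; rewrite /hJ /J nth_rootE ?enorm_ge0// yrt ifT//.
  by rewrite exprn_gt0//; move: yrt; rewrite ltr_norml => /andP[]; nra.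
apply: (@le_trans _ _ (K%:E * \int[mu]_s (if (0 < s)%R then hJ s else 0))).
  pose Kn : {nonneg R} := NngNum (ltW K0).
  have mif : measurable_fun setT (fun s : R => if (0 < s)%R then hJ s else 0).
    by apply: measurable_fun_ifT => //; exact: measurable_fun_ltr.
  have if0 s : 0 <= (if (0 < s)%R then hJ s else 0) by case: ifP.
  rewrite -(_ : \int[mscale Kn mu]_s (if (0 < s)%R then hJ s else 0) = K%:E * _).
    by apply: ge0_le_measure_integral => // A mA; exact: nuK.
  by rewrite ge0_integral_mscale.
have -> : \int[mu]_s (if (0 < s)%R then hJ s else 0) = (unit_ball_volume R n)^-1%:E *
    \int[mun]_y (if (0 < enorm y)%R then hJ (enorm y ^+ n)%R else 0).
  rewrite integral_radial// muleA -EFinM mulVf ?mul1e//.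
  by rewrite gt_eqF.
rewrite muleA -EFinM; apply: lee_pmul.
- by rewrite lee_fin mulr_ge0 ?invr_ge0 ?ltW.
- by apply: integral_ge0 => y _; case: ifP.
- rewrite lee_fin.
  apply: (@le_trans _ _ (C1 * 4 * 2 ^+ n.-1 / unit_ball_volume R n * (t / r) ^+ n.-1)%R); last first.
    by rewrite ler_wpM2r ?exprn_ge0 ?divr_ge0 ?ltW// ltrDr.
  by rewrite /K !exprMn exprVn; lra.
- apply: le_nonneg_integral => y; first by case: ifP.
  case: ifPn => y0; last by case: ifP.
  by rewrite /hJ /J nth_rootE ?enorm_ge0.
Qed.
End ball_radial.

(** * Layer cake formula for negative powers *)

Section layer_cake.
Context d (T : measurableType d) (R : realType).
Variable m : {sigma_finite_measure set T -> \bar R}.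
Notation mu := (@lebesgue_measure R).
Local Open Scope ereal_scope.
Variables (z : T -> R) (G : T -> \bar R) (a : R).
Hypotheses (mz : measurable_fun setT z) (z0 : forall x, (0 <= z x)%R).
Hypotheses (mG : measurable_fun setT G) (G0 : forall x, 0 <= G x) (a0 : (0 < a)%R).

Let k (x : T) (t : R) : R := if (z x < t)%R then (a * t `^ (- a - 1))%R else 0%R.

Let k0 x t : 0 <= (k x t)%:E.
Proof. by rewrite lee_fin /k; case: ifP => // _; rewrite mulr_ge0 ?powR_ge0// ltW. Qed.

Let mk : measurable_fun setT (fun u : T * measurableTypeR R => (k u.1 u.2)%:E).
Proof.
apply/measurable_EFinP; apply: measurable_fun_ifT => //.
  by apply: measurable_fun_ltr => //; apply: (measurableT_comp mz).
by apply: measurable_funM => //; apply: (measurableT_comp (measurable_powR _)).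
Qed.

Lemma layer_cake_tonelli :
  \int[mu]_t ((if (0 < t)%R then a * t `^ (- a - 1) else 0)%R%:E *
      \int[m]_x (if (z x < t)%R then G x else 0)) =
  \int[m]_x ((\int[mu]_t (k x t)%:E) * G x).
Proof.
transitivity (\int[mu]_t \int[m]_x ((k x t)%:E * G x)).
  apply: eq_integral => t _; have [t0|t0] := ltP 0%R t.
    rewrite -ge0_integralZl//; last 3 first.
    - apply: measurable_fun_ifT => //; exact: measurable_fun_ltr.
    - by move=> x _; case: ifP.
    - by rewrite lee_fin mulr_ge0 ?powR_ge0// ltW.
    by apply: eq_integral => x _; rewrite /k; case: ifP; rewrite ?mule0 ?mul0e.
  rewrite mul0e integral0_eq// => x _; rewrite /k ifF ?mul0e//.
  by rewrite ltNge (le_trans t0 (z0 x)).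
rewrite -(fubini_tonelli (fun u : T * measurableTypeR R => (k u.1 u.2)%:E * G u.1))/=.
- apply: eq_integral => x _; rewrite ge0_integralZr//.
  exact: (measurableT_comp mk (measurable_pair1 x)).
- by apply: emeasurable_funM => //; exact: (measurableT_comp mG).
- by move=> u; rewrite mule_ge0.
Qed.

(** The two integrands agree where [z > 0]; where [z = 0] the left one vanishes by the convention on
    [powR], which is harmless in this direction. *)
Lemma layer_cake_le : \int[m]_x ((z x `^ (- a))%:E * G x) <=
  \int[mu]_t ((if (0 < t)%R then a * t `^ (- a - 1) else 0)%R%:E *
      \int[m]_x (if (z x < t)%R then G x else 0)).
Proof.
rewrite layer_cake_tonelli; apply: le_nonneg_integral => x.
  by rewrite mule_ge0// lee_fin powR_ge0.
rewrite lee_wpmul2r//; have := z0 x; rewrite le_eqVlt => /predU1P[<-|zx0].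
  by rewrite powR0 ?oppr_eq0 ?gt_eqF// integral_ge0.
by rewrite -integral_powR_tail.
Qed.

(* The nullity of [z = 0] is needed because the junk value of [0 `^ (- a)] is 0. *)
Lemma layer_cake_ge : m [set x | (z x <= 0)%R] = 0 ->
  \int[mu]_t ((if (0 < t)%R then a * t `^ (- a - 1) else 0)%R%:E *
      \int[m]_x (if (z x < t)%R then G x else 0)) <=
  \int[m]_x ((z x `^ (- a))%:E * G x).
Proof.
have mset : measurable [set x | (z x <= 0)%R].
  by apply: measurable_bool_set; exact: measurable_fun_ler.
move=> mz0; rewrite layer_cake_tonelli; apply: ae_ge0_le_integral => //.
- by move=> x _; rewrite mule_ge0// integral_ge0.
- apply: emeasurable_funM => //.
  exact: (measurable_fun_fubini_tonelli_F (fun u : T * measurableTypeR R => (k u.1 u.2)%:E)).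
- by move=> x _; rewrite mule_ge0// lee_fin powR_ge0.
- apply: emeasurable_funM => //; apply/measurable_EFinP.
  exact: (measurableT_comp (measurable_powR _)).
exists [set x | (z x <= 0)%R]; split => // x /= /not_implyP[_] H.
rewrite leNgt; apply/negP => zx; apply: H.
by rewrite lee_wpmul2r// -integral_powR_tail.
Qed.
End layer_cake.

(** * From a kernel in [|x - y|] to a kernel in the difference of the norms *)

Section radial_kernel.
Variables (R : realType) (n : nat).
Hypothesis n0 : (0 < n)%N.
Notation mu := (@lebesgue_measure R).
Notation mun := (lebesgueRn R n).
Local Open Scope ereal_scope.

Lemma measurable_enorm_eq0 : measurable [set y : 'Rn[R]_n | enorm y = 0%R].
Proof.
rewrite (_ : [set _ | _] = [set y : 'Rn[R]_n | enorm y == 0%R]).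
  apply: measurable_bool_set; apply: measurable_fun_eqr => //; exact: measurable_enorm.
by apply/seteqP; split => y /=; [move=> ->|move/eqP].
Qed.

Lemma lebesgueRn_enorm_eq0 : mun [set y | enorm y = 0%R] = 0.
Proof.
have := lebesgueRn_enorm_le n0 (lexx (0%R : R)); rewrite mulr0.
congr (_ = _); congr (mun _); apply/seteqP; split => y /=.
  move=> H; have : (enorm y ^+ n == 0)%R by rewrite eq_le H exprn_ge0 ?enorm_ge0.
  by rewrite expf_eq0 n0 => /eqP.
by move=> ->; rewrite expr0n gtn_eqF.
Qed.

(** A sphere is a single point in the variable [|y|^n]. It is the zero set of [||x| - |y||], whose
    nullity [layer_cake_ge] requires. *)
Lemma lebesgueRn_sphere (c : R) : (0 < c)%R -> mun [set y | enorm y = c] = 0.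
Proof.
move=> c0; pose h (t : R) : \bar R := if t == (c ^+ n)%R then 1 else 0.
have mh : measurable_fun setT h by apply: measurable_fun_ifT => //; exact: measurable_fun_eqr.
have h0 t : 0 <= h t by rewrite /h; case: ifP.
have := integral_radial n0 mh h0.
have -> : \int[mu]_t (if (0 < t)%R then h t else 0) = 0.
  apply/eqP; rewrite eq_le; apply/andP; split; last first.
    by apply: integral_ge0 => t _; case: ifP.
  apply: (@le_trans _ _ (\int[mu]_t (if t == (c ^+ n)%R then 1 else 0))).
    apply: le_nonneg_integral => t; first by case: ifP.
    by case: ifP => // _; rewrite /h; case: ifP.
  rewrite -measure_integral_if; last exact: measurable_fun_eqr.
  rewrite (_ : [set _ | _] = [set (c ^+ n)%R]) ?/= ?lebesgue_measure_set1//.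
  by apply/seteqP; split => t /=; [move/eqP|move=> ->].
rewrite mule0 => <-.
have -> : [set y : 'Rn[R]_n | enorm y = c] = [set y | enorm y == c].
  by apply/seteqP; split => y /=; [move=> ->|move/eqP].
rewrite measure_integral_if; last by apply: measurable_fun_eqr => //; exact: measurable_enorm.
apply: eq_integral => y _; rewrite /h eqrXn2 ?enorm_ge0 ?ltW//.
by have [->|_] := eqVneq (enorm y) c; [rewrite c0|case: ifP].
Qed.

Lemma radial_kernel_le (delta : R) : (0 < delta)%R -> exists2 C : R, (0 < C)%R &
  forall (x : 'Rn[R]_n) (h : R -> \bar R),
  (0 < enorm x)%R -> measurable_fun setT h -> (forall s, 0 <= h s) ->
  \int[mun]_y ((enorm (subRn x y) `^ (- (delta + n.-1%:R)))%:E * h (enorm y ^+ n)%R) <=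
  (C * enorm x ^- n.-1)%:E *
  \int[mun]_y ((`|enorm x - enorm y| `^ (- delta))%:E * h (enorm y ^+ n)%R).
Proof.
move=> d0; have [C C0 HC] := ball_radial_le R n0.
pose a := (delta + n.-1%:R)%R.
have a0 : (0 < a)%R by rewrite ltr_wpDr.
(* The factor [t^(n-1)] gained from the shells turns the weight [a t^(-a-1)] into a multiple of
   [t^(-delta-1)]; [a / delta] is the ratio of the two normalisations. *)
exists (C * (a / delta))%R; first by rewrite mulr_gt0// divr_gt0.
move=> x h; set r := enorm x => r0 mh h0.
have mhN := @measurable_radial R n h mh.
have mdist : measurable_fun setT (fun y : 'Rn[R]_n => enorm (subRn x y)).
  by apply: (measurableT_comp (@measurable_enorm R n)); exact: measurable_subRn.
have mrad : measurable_fun setT (fun y : 'Rn[R]_n => `|r - enorm y|%R).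
  by apply: measurableT_comp => //; apply: measurable_funB => //; exact: measurable_enorm.
have := @layer_cake_le _ _ R mun _ _ a mdist (fun y => enorm_ge0 _) mhN (fun y => h0 _) a0.
move=> /le_trans; apply.
pose I t := \int[mun]_y (if (`|r - enorm y| < t)%R then h (enorm y ^+ n)%R else 0).
have I0 t : 0 <= I t by apply: integral_ge0 => y _; case: ifP.
have mI : measurable_fun setT (fun t : measurableTypeR R => I t).
  apply: (measurable_fun_fubini_tonelli_F (fun u : measurableTypeR R * 'Rn[R]_n =>
    if (`|r - enorm u.2| < u.1)%R then h (enorm u.2 ^+ n)%R else 0)).
    apply: measurable_fun_ifT => //.
      by apply: measurable_fun_ltr => //; exact: (measurableT_comp mrad).
    exact: (measurableT_comp mhN).
  by move=> u; case: ifP.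
have mp : measurable_fun setT (fun t : R => (if (0 < t)%R then delta * t `^ (- delta - 1) else 0)%R%:E).
  exact: measurable_powR_tail.
have p0 t : 0 <= (if (0 < t)%R then delta * t `^ (- delta - 1) else 0)%R%:E.
  by rewrite lee_fin; case: ifP => // _; rewrite mulr_ge0 ?powR_ge0// ltW.
apply: (@le_trans _ _ (\int[mu]_t ((C * (a / delta) * r ^- n.-1)%:E *
    ((if (0 < t)%R then delta * t `^ (- delta - 1) else 0)%R%:E * I t)))).
  apply: le_nonneg_integral => t.
    apply: mule_ge0; first by rewrite lee_fin; case: ifP => // _; rewrite mulr_ge0 ?powR_ge0// ltW.
    by apply: integral_ge0 => y _; case: ifP.
  case: ifPn => t0; last by rewrite !mul0e mule0.
  apply: le_trans (lee_wpmul2l _ (HC x t h r0 t0 mh h0)) _.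
    by rewrite lee_fin mulr_ge0 ?powR_ge0// ltW.
  rewrite -/r -/(I t) muleA -EFinM muleA -EFinM lee_wpmul2r// lee_fin.
  have -> : (t `^ (- a - 1) = t `^ (- delta - 1) * t ^- n.-1)%R.
    rewrite -powR_invn ?(ltW t0)// -powRD; last by rewrite (gt_eqF t0) implybT.
    by congr (_ `^ _)%R; rewrite /a; lra.
  rewrite exprMn exprVn le_eqVlt; apply/orP; left; apply/eqP.
  have tn : (t ^+ n.-1 != 0)%R by rewrite expf_neq0// gt_eqF.
  by field; rewrite tn (gt_eqF d0) expf_neq0 ?gt_eqF.
rewrite ge0_integralZl//; last 3 first.
- exact: emeasurable_funM.
- by move=> t _; rewrite mule_ge0.
- by rewrite lee_fin mulr_ge0 ?invr_ge0 ?exprn_ge0 ?(ltW r0)// mulr_ge0 ?divr_ge0 ?ltW.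
apply: lee_wpmul2l.
  by rewrite lee_fin mulr_ge0 ?invr_ge0 ?exprn_ge0 ?(ltW r0)// mulr_ge0 ?divr_ge0 ?ltW.
apply: layer_cake_ge => //.
rewrite -[RHS](lebesgueRn_sphere r0); congr (mun _).
apply/seteqP; split => y /=; first by rewrite normr_le0 subr_eq0 => /eqP.
by move=> ->; rewrite subrr normr0.
Qed.
End radial_kernel.

(** * Borel profiles of radial functions *)

Section borel_version.
Variables (R : realType) (n : nat).
Notation mu := (@lebesgue_measure R).
Notation mun := (lebesgueRn R n).
Local Open Scope ereal_scope.

(** Each set [v > r] with [r] rational is a Borel set up to a subset of a Borel null set. Setting
    [v] to 0 on the union [Z] of these countably many null sets makes every superlevel set Borel, as
    a union over rational levels. *)
Lemma lebesgue_measurable_borel (v : 'Rn[R]_n -> R) : lebesgue_measurable_fun v ->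
  exists (w : 'Rn[R]_n -> measurableTypeR R) (Z : set ('Rn[R]_n)),
    [/\ measurable_fun setT w, measurable Z, mun Z = 0 & forall y, ~ Z y -> w y = v y].
Proof.
move=> mv.
(* An enumeration of the rationals; indices that encode no rational repeat the value 0. *)
pose q (k : nat) : R := ratr (odflt 0%R (unpickle k : option rat)).
have H k : exists AB : set ('Rn[R]_n) * set ('Rn[R]_n),
    [/\ measurable AB.1, measurable AB.2, mun AB.2 = 0,
     AB.1 `<=` v @^-1` `]q k, +oo[ & v @^-1` `]q k, +oo[ `<=` AB.1 `|` AB.2].
  have [A mA [N [B [mB B0 NB]] ANE]] := mv `]q k, +oo[%classic (measurable_itv _).
  exists (A, B); split => //=.
    by rewrite -ANE; exact: subsetUl.
  by rewrite -ANE; apply: setUS.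
have [AB HAB] := choice H.
pose Z := \bigcup_k (AB k).2.
have mZ : measurable Z by apply: bigcupT_measurable => k; have [] := HAB k.
have Z0 : mun Z = 0.
  apply: (measure_negligible mZ); apply: negligible_bigcup => k.
  by exists (AB k).2; have [] := HAB k; split.
pose w y : measurableTypeR R := if y \in Z then 0%R else v y.
exists w, Z; split => //; last by move=> y; rewrite /w => ?; rewrite memNset.
apply: (measurability _ (RGenOInfty.measurableE R)) => //.
move=> _ [_ [a ->] <-]; rewrite setTI.
have -> : w @^-1` `]a, +oo[ =
    (\bigcup_k (if (a < q k)%R then (AB k).1 `\` Z else set0)) `|`
    (if (a < 0)%R then Z else set0).
  apply/seteqP; split => y /=; rewrite in_itv/= andbT /w.
    have [yZ|yZ] := boolP (y \in Z); first by move=> a0; right; rewrite a0; exact: set_mem.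
    move=> avy; left; have [r] := rat_in_itvoo avy.
    rewrite in_itv/= => /andP[ar rv]; exists (pickle r) => //.
    have qr : q (pickle r) = ratr r by rewrite /q pickleK.
    rewrite qr ar; split; last by move: yZ; rewrite notin_setE.
    have [_ _ _ _ H2] := HAB (pickle r).
    have [//|Bz] : ((AB (pickle r)).1 `|` (AB (pickle r)).2) y.
      by apply: H2; rewrite /= in_itv/= andbT qr.
    by move: yZ; rewrite notin_setE => -[]; exists (pickle r).
  move=> [[k _]|].
    case: ifPn => // aq [Ay Zy]; rewrite memNset//.
    have [_ _ _ H1 _] := HAB k.
    have := H1 _ Ay; rewrite /= in_itv/= andbT; exact: lt_trans.
  by case: ifPn => // a0 Zy; rewrite mem_set.
apply: measurableU; last by case: ifP.
apply: bigcupT_measurable => k; case: ifP => // _; apply: measurableD => //.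
by have [] := HAB k.
Qed.

Hypothesis n0 : (0 < n)%N.

(** Dilation by [s ^ e] multiplies [|y|^n] by [s]. *)
Let e : R := (n%:R^-1)%R.

Lemma measurable_dilate : measurable_fun setT
  (fun u : measurableTypeR R * 'Rn[R]_n => scaleRn (u.1 `^ e)%R u.2).
Proof.
apply: measurable_tuple_fun => i; apply: measurable_funM.
  exact: (measurableT_comp (measurable_powR _)).
exact: (measurableT_comp (measurable_tnth i)).
Qed.

(* A radial function that agrees almost everywhere with a Borel function [w] may
   still have a non-Borel profile; restricting [w] to a ray that meets the
   exceptional set in a null set provides a Borel one. *)
Lemma exists_generic_ray (Z : set ('Rn[R]_n)) : measurable Z -> mun Z = 0 ->
  exists2 y : 'Rn[R]_n, (0 < enorm y)%R &
    \int[mu]_s (if (0 < s)%R then (\1_Z (scaleRn (s `^ e)%R y))%:E else 0) = 0.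
Proof.
move=> mZ Z0.
pose g (u : measurableTypeR R * 'Rn[R]_n) : \bar R :=
  if (0 < u.1)%R then (\1_Z (scaleRn (u.1 `^ e)%R u.2))%:E else 0.
have mg : measurable_fun setT g.
  apply: measurable_fun_ifT => //; first exact: measurable_fun_ltr.
  apply/measurable_EFinP; apply: (measurableT_comp (measurable_indic mZ)).
  exact: measurable_dilate.
have g0 u : 0 <= g u by rewrite /g; case: ifP => // _; rewrite lee_fin.
pose F y := \int[mu]_s g (s, y).
have F0 y : 0 <= F y by exact: integral_ge0.
have mF : measurable_fun setT F by exact: (measurable_fun_fubini_tonelli_G g mg g0).
(* For every fixed [s > 0] the dilated copy of [Z] is null; by Tonelli almost every ray meets [Z] in
   a null set of parameters. *)
have : \int[mun]_y F y = 0.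
  rewrite /F -(fubini_tonelli g)// integral0_eq// => s _.
  rewrite /g/=; have [s0|s0] := ltP 0%R s; last by rewrite integral0.
  rewrite (integral_scaleRn (f := fun x => (\1_Z x)%:E)) ?powR_gt0//.
    by rewrite integral_indic// setIT [X in _ * X]Z0 mule0.
  by apply/measurable_EFinP; exact: measurable_indic.
move=> F00.
have : \int[mun]_y `|F y| = 0 by under eq_integral do rewrite gee0_abs//.
move/(ae_eq_integral_abs mun measurableT mF) => [N [mN N0 FN]].
(* Were there no such [y] off the origin, the whole unit ball would be covered by a null set and the
   origin. *)
apply: contrapT => /forall2NP noy.
suff : mun [set y | (enorm y ^+ n <= 1)%R] = 0.
  rewrite lebesgueRn_enorm_le// mulr1; case=> o0.
  by have := unit_ball_volume_gt0 R n0; rewrite o0 ltxx.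
have mE0 := @measurable_enorm_eq0 R n.
apply: (subset_measure0 (B := N `|` [set y | enorm y = 0%R])).
- exact: measurable_le_enormX.
- exact: measurableU.
- move=> y _; have [y0|y0] := eqVneq (enorm y) 0%R; first by right.
  left; apply: FN => /= /(_ Logic.I) Fy0.
  by case: (noy y) => //; rewrite lt_def y0 enorm_ge0.
- exact: etrans (measureU0 mN mE0 (lebesgueRn_enorm_eq0 R n0)) N0.
Qed.

(** [pt t] is the point of a generic ray at which [|y|^n] equals [t]. Reading the Borel version [w]
    along this ray gives a Borel profile, and radial symmetry carries its values to the other points
    of each sphere. *)
Lemma radial_borel (v : 'Rn[R]_n -> R) : lebesgue_measurable_fun v -> radially_symmetric v ->
  exists (h : R -> R) (Z : set ('Rn[R]_n)),
    [/\ measurable_fun setT h, forall t, (0 <= h t)%R, measurable Z, mun Z = 0 &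
     forall y, ~ Z y -> h (enorm y ^+ n)%R = `|v y|%R].
Proof.
move=> mv [v0 vv0].
have [w [Z [mw mZ Z0 wv]]] := lebesgue_measurable_borel mv.
have [y y0 Hy] := exists_generic_ray mZ Z0.
pose c := (enorm y ^+ n)%R.
have c0 : (0 < c)%R by rewrite exprn_gt0.
have e_neq0 : (e != 0)%R by rewrite invr_neq0// pnatr_eq0 -lt0n.
pose pt (t : R) : 'Rn[R]_n := scaleRn ((c^-1 * t) `^ e)%R y.
have mpt : measurable_fun setT pt.
  have mt : measurable_fun setT (fun t : measurableTypeR R => (((c^-1 * t)%R : measurableTypeR R), y)).
    by apply: measurable_fun_pair => //; exact: measurable_funM.
  exact: (measurableT_comp measurable_dilate mt).
pose E (t : R) : \bar R := (\1_Z (pt t))%:E.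
have mE : measurable_fun setT E.
  by apply/measurable_EFinP; exact: (measurableT_comp (measurable_indic mZ) mpt).
have E0 t : 0 <= E t by rewrite lee_fin.
have intE : \int[mu]_t (if (0 < t)%R then E t else 0) = 0.
  pose f (s : R) : \bar R := if (0 < s)%R then (\1_Z (scaleRn (s `^ e)%R y))%:E else 0.
  have mf : measurable_fun setT f.
    apply: measurable_fun_ifT => //; first exact: measurable_fun_ltr.
    apply/measurable_EFinP; apply: (measurableT_comp (measurable_indic mZ)).
    exact: (measurableT_comp measurable_dilate (measurable_pair2 y)).
  have f0 s : 0 <= f s by rewrite /f; case: ifP => // _; rewrite lee_fin.
  have ci0 : (0 < c^-1)%R by rewrite invr_gt0.
  have I0 : \int[mu]_x f (c^-1 * x)%R = 0 by rewrite (integral_dilate ci0 mf f0) [\int[mu]_x f x]Hy mule0.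
  rewrite -[RHS]I0; by apply: eq_integral => t _; rewrite /f pmulr_rgt0.
exists (fun t => `|w (pt t)|%R).
(* The origin is discarded because symmetry constrains positive norms only. The second part is a
   union of spheres whose radii form a null set on the ray, hence null by polar coordinates. *)
exists ([set x | enorm x = 0%R] `|`
  ([set x | Z (pt (enorm x ^+ n)%R)] `\` [set x | enorm x = 0%R])).
have mE0 := @measurable_enorm_eq0 R n.
have mZN : measurable [set x : 'Rn[R]_n | Z (pt (enorm x ^+ n)%R)].
  rewrite -[X in measurable X]setTI.
  exact: (measurableT_comp mpt (@measurable_enormX R n n)).
have mW := measurableD mZN mE0.
split => //.
- exact: measurableT_comp (measurableT_comp mw mpt).
- exact: measurableU.
- rewrite setUC; apply: etrans (measureU0 mW mE0 (lebesgueRn_enorm_eq0 R n0)) _.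
  transitivity (\int[mun]_x (if (0 < enorm x)%R then E (enorm x ^+ n)%R else 0)).
    rewrite -[LHS]/(mun _) -[X in mun X]setIT -integral_indic//.
    apply: eq_integral => x _; have [x0|x0] := ltP 0%R (enorm x).
      rewrite /E !indicE; congr ((nat_of_bool _)%:R%:E); apply/idP/idP.
        by move=> /set_mem[/= Zx _]; apply/mem_set.
      by move=> /set_mem Zx; apply/mem_set; split => //= x00; rewrite x00 ltxx in x0.
    rewrite indicE memNset// => -[_]; apply; apply/eqP.
    by rewrite eq_le x0 enorm_ge0.
  by rewrite integral_radial// intE mule0.
move=> x /not_orP[/= /eqP x0 Zx].
have xp : (0 < enorm x)%R by rewrite lt_def x0 enorm_ge0.
have ptx : enorm (pt (enorm x ^+ n)%R) = enorm x.
  rewrite enorm_scale ?powR_ge0// /c -exprVn -exprMn.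
  by rewrite nth_rootE ?mulr_ge0 ?invr_ge0 ?enorm_ge0// mulrAC mulVf ?mul1r// gt_eqF.
rewrite wv; last by move=> H; apply: Zx; split => //; exact/eqP.
by rewrite (vv0 x xp) vv0 ptx.
Qed.
End borel_version.

(** * The Hardy-Littlewood-Sobolev inequality under linear growth *)

Section poweR_layer.
Variable R : realType.
Notation mu := (@lebesgue_measure R).
Local Open Scope ereal_scope.

(** The usual integral of [q l^(q-1)] over levels [l < F] after the substitution [l = 1 / u], which
    makes [integral_powR_tail] applicable. An infinite [F] is handled by letting a real lower bound
    grow. *)
Lemma poweR_layer_le (F : \bar R) (q : R) : 0 <= F -> (0 < q)%R ->
  F `^ q <= \int[mu]_u (if (0 < u)%R && ((u `^ (- 1))%:E < F)%E then (q * u `^ (- q - 1))%R else 0%R)%:E.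
Proof.
move=> F0 q0.
have nn u : 0 <= (if (0 < u)%R && ((u `^ (- 1))%:E < F)%E then (q * u `^ (- q - 1))%R else 0%R)%:E :> \bar R.
  by case: ifP => _//; rewrite lee_fin mulr_ge0 ?powR_ge0// ltW.
have tail (r : R) : (0 < r)%R -> r%:E <= F ->
    (r `^ q)%:E <= \int[mu]_u (if (0 < u)%R && ((u `^ (- 1))%:E < F)%E then (q * u `^ (- q - 1))%R else 0%R)%:E.
  move=> r0 rF; have ri0 : (0 < r^-1)%R by rewrite invr_gt0.
  have -> : (r `^ q = (r^-1) `^ (- q))%R.
    by rewrite -{1}(invrK r) -powR_inv1 ?invr_ge0 ?ltW// -powRrM mulN1r.
  rewrite -integral_powR_tail//; apply: le_nonneg_integral => u.
    by case: ifP => _//; rewrite lee_fin mulr_ge0 ?powR_ge0// ltW.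
  case: ifPn => ru; last exact: nn.
  have u0 : (0 < u)%R by exact: lt_trans ru.
  rewrite u0 ifT//; apply: lt_le_trans rF.
  by rewrite lte_fin powR_inv1 ?(ltW u0)// invf_plt ?posrE.
move: F F0 nn tail => [r| |]// F0 nn tail.
  rewrite poweR_EFin; move: (F0); rewrite lee_fin le_eqVlt => /predU1P[r0|r0]; last exact: tail.
  have -> : (r `^ q = 0)%R by rewrite -r0 powR0 ?gt_eqF.
  exact: integral_ge0.
rewrite poweRyr ?gt_eqF// leye_eq; apply/eqP/eqyP => M M0.
have MM : (M = (M `^ q^-1) `^ q)%R by rewrite -powRrM mulVf ?gt_eqF// powRr1 ?ltW.
by rewrite MM; apply: tail; rewrite ?powR_gt0// leey.
Qed.
End poweR_layer.

(** * Weak type bounds with level-dependent cuts, and their integration *)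

Section interpolation.
Context d (T : measurableType d) (R : realType).
Variable m : {sigma_finite_measure set T -> \bar R}.
Notation mu := (@lebesgue_measure R).
Local Open Scope ereal_scope.
Variables (w g : T -> R) (k : T * T -> R) (p q A : R).
Hypotheses (mw : measurable_fun setT w) (w0 : forall x, (0 <= w x)%R).
Hypotheses (mg : measurable_fun setT g) (g0 : forall x, (0 <= g x)%R).
Hypotheses (mk : measurable_fun setT k) (k0 : forall x, (0 <= k x)%R).
Hypotheses (p1 : (1 < p)%R) (pq : (p <= q)%R) (A0 : (0 < A)%R).
(** Abstracts the cut of the kernel at the level [l]: [k1] is the near part, controlled in both
    variables, and [k2] the far part, which consumes a quarter of the level. For [p = q] the power
    of [l] is constant, so the Young and Hardy-Littlewood-Sobolev cases share one argument. *)
Hypothesis split_k : forall l : R, (0 < l)%R -> exists k1 k2 : T * T -> R,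
  [/\ measurable_fun setT k1 /\ measurable_fun setT k2,
   forall u, (0 <= k1 u)%R /\ (0 <= k2 u)%R, forall u, (k u <= k1 u + k2 u)%R,
   (forall x, \int[m]_y (k1 (x, y) * w y)%:E <= (A * l `^ (1 - q / p))%:E) /\
   (forall y, \int[m]_x (k1 (x, y) * w x)%:E <= (A * l `^ (1 - q / p))%:E) &
   forall x, \int[m]_y (k2 (x, y) * g y * w y)%:E <= (l / 4)%:E].

Let F x := \int[m]_y (k (x, y) * g y * w y)%:E.

Let F0 x : 0 <= F x.
Proof. by apply: integral_ge0 => y _; rewrite lee_fin !mulr_ge0. Qed.

Let msec (k' : T * T -> R) : measurable_fun setT k' -> forall x, measurable_fun setT (fun y => k' (x, y)).
Proof. by move=> mk' x; exact: (measurableT_comp mk' (measurable_pair1 x)). Qed.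

(* [g] is cut at the height where the integral of [k1] against its low part is
   [l / 4]; the remaining mass is estimated by Chebyshev's inequality. *)
Lemma weak_type_bound (l : R) : (0 < l)%R ->
  \int[m]_x (if l%:E < F x then (w x)%:E else 0) <=
  (2 * A * l `^ (- (q / p)))%:E *
  \int[m]_y (if (l `^ (q / p) / (4 * A) < g y)%R then (g y * w y)%:E else 0).
Proof.
move=> l0; have [k1 [k2 [[mk1 mk2] k12 kk [H1 H2] H3]]] := split_k l0.
pose h := (l `^ (q / p) / (4 * A))%R.
have h0 : (0 < h)%R by rewrite divr_gt0 ?powR_gt0// mulr_gt0.
pose g' y := if (h < g y)%R then g y else 0%R.
have g'0 y : (0 <= g' y)%R by rewrite /g'; case: ifP.
have mg' : measurable_fun setT g' by apply: measurable_fun_ifT => //; exact: measurable_fun_ltr.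
have hA : (h * (A * l `^ (1 - q / p)) = l / 4)%R.
  rewrite /h powRD; last by rewrite (gt_eqF l0) implybT.
  rewrite powRr1 ?ltW// powRN.
  have lq : (l `^ (q / p) != 0)%R by rewrite gt_eqF ?powR_gt0.
  by field; rewrite lq gt_eqF.
pose I x := \int[m]_y (k1 (x, y) * g' y * w y)%:E.
have I0 x : 0 <= I x.
  by apply: integral_ge0 => y _; rewrite lee_fin !mulr_ge0//; have [] := k12 (x, y).
have Fle x : F x <= I x + (l / 2)%:E.
  have -> : (l / 2 = l / 4 + l / 4)%R by field.
  rewrite EFinD addeA.
  have m1 : measurable_fun setT (fun y => (k1 (x, y) * g' y * w y)%:E).
    by apply/measurable_EFinP; apply: measurable_funM => //; apply: measurable_funM => //; exact: msec.
  have m2 : measurable_fun setT (fun y => (h * (k1 (x, y) * w y))%:E).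
    by apply/measurable_EFinP; apply: measurable_funM => //; apply: measurable_funM => //; exact: msec.
  have m3 : measurable_fun setT (fun y => (k2 (x, y) * g y * w y)%:E).
    by apply/measurable_EFinP; apply: measurable_funM => //; apply: measurable_funM => //; exact: msec.
  have n1 y : 0 <= (k1 (x, y) * g' y * w y)%:E by rewrite lee_fin !mulr_ge0//; have [] := k12 (x, y).
  have n2 y : 0 <= (h * (k1 (x, y) * w y))%:E.
    by rewrite lee_fin mulr_ge0 ?(ltW h0)// mulr_ge0//; have [] := k12 (x, y).
  have n3 y : 0 <= (k2 (x, y) * g y * w y)%:E by rewrite lee_fin !mulr_ge0//; have [] := k12 (x, y).
  apply: (@le_trans _ _ (\int[m]_y ((k1 (x, y) * g' y * w y)%:E +
     (h * (k1 (x, y) * w y))%:E + (k2 (x, y) * g y * w y)%:E))).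
    apply: le_nonneg_integral => y; first by rewrite lee_fin !mulr_ge0.
    have [ka kb] := k12 (x, y); have := kk (x, y).
    rewrite -!EFinD lee_fin => kxy.
    have e1 : (k (x, y) * g y * w y <= (k1 (x, y) + k2 (x, y)) * g y * w y)%R.
      by rewrite ler_wpM2r// ler_wpM2r.
    apply: (le_trans e1).
    have e2 : (k1 (x, y) * g y * w y <= k1 (x, y) * g' y * w y + h * (k1 (x, y) * w y))%R.
      rewrite (_ : _ + _ = k1 (x, y) * (g' y + h) * w y)%R; last by ring.
      rewrite ler_wpM2r// ler_wpM2l// /g'; case: ltP => // hg; rewrite ?add0r ?lerDl//.
      exact: ltW.
    by rewrite !mulrDl lerD2r.
  rewrite ge0_integralD//; [|by move=> y _; rewrite adde_ge0|exact: emeasurable_funD].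
  rewrite ge0_integralD//.
  apply: leeD => //; apply: leeD => //.
  under eq_integral do rewrite EFinM.
  rewrite ge0_integralZl//; last 3 first.
  - by apply/measurable_EFinP; apply: measurable_funM => //; exact: msec.
  - by move=> y _; rewrite lee_fin mulr_ge0//; have [] := k12 (x, y).
  - by rewrite lee_fin ltW.
  by rewrite -hA [leRHS]EFinM; apply: lee_wpmul2l => //; rewrite lee_fin ltW.
have mI : measurable_fun setT I.
  apply: (measurable_fun_fubini_tonelli_F (fun u : T * T => (k1 u * g' u.2 * w u.2)%:E)).
    apply/measurable_EFinP; apply: measurable_funM; last exact: (measurableT_comp mw).
    by apply: measurable_funM => //; exact: (measurableT_comp mg').
  by move=> u; rewrite lee_fin !mulr_ge0//; have [] := k12 u.
apply: (@le_trans _ _ (\int[m]_x ((2 / l)%:E * (I x * (w x)%:E)))).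
  apply: le_nonneg_integral => x; first by case: ifP; rewrite ?lee_fin.
  case: ifPn => [lF|_]; last by rewrite !mule_ge0// lee_fin ?divr_ge0// ltW.
  (* The low part of [g] and the far part of the kernel use up at most [l / 2], so the remaining
     integral is at least [l / 2] here; this yields the factor [2 / l]. *)
  have lI : (l / 2)%:E <= I x.
    have := lt_le_trans lF (Fle x).
    case: (I x) (I0 x) => [r| |]// _; rewrite ?leey// lee_fin -EFinD lte_fin; lra.
  rewrite muleA -[leLHS]mul1e lee_wpmul2r ?lee_fin//.
  apply: le_trans (lee_wpmul2l _ lI); last by rewrite lee_fin divr_ge0// ltW.
  by rewrite -EFinM lee_fin le_eqVlt; apply/orP; left; apply/eqP; field; rewrite gt_eqF.
rewrite ge0_integralZl//; last 3 first.
- by apply: emeasurable_funM => //; exact/measurable_EFinP.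
- by move=> x _; rewrite mule_ge0// lee_fin.
- by rewrite lee_fin divr_ge0// ltW.
pose G (u : T * T) : \bar R := (k1 u * g' u.2 * w u.2 * w u.1)%:E.
have mG : measurable_fun setT G.
  apply/measurable_EFinP; apply: measurable_funM; last exact: (measurableT_comp mw).
  apply: measurable_funM; last exact: (measurableT_comp mw).
  by apply: measurable_funM => //; exact: (measurableT_comp mg').
have G0 u : 0 <= G u by rewrite lee_fin !mulr_ge0//; have [] := k12 u.
have -> : \int[m]_x (I x * (w x)%:E) = \int[m]_x \int[m]_y G (x, y).
  apply: eq_integral => x _; rewrite -ge0_integralZr//.
  - by apply/measurable_EFinP; apply: measurable_funM => //; apply: measurable_funM => //; exact: msec.
  - by move=> y _; rewrite lee_fin !mulr_ge0//; have [] := k12 (x, y).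
  - by rewrite lee_fin.
rewrite (fubini_tonelli G)//.
apply: (@le_trans _ _ ((2 / l)%:E * \int[m]_y ((A * l `^ (1 - q / p))%:E * (g' y * w y)%:E))).
  apply: lee_wpmul2l; first by rewrite lee_fin divr_ge0// ltW.
  apply: le_nonneg_integral => y; first exact: integral_ge0.
  have -> : \int[m]_x G (x, y) = \int[m]_x ((g' y * w y)%:E * (k1 (x, y) * w x)%:E).
    by apply: eq_integral => x _; rewrite -EFinM /G; congr (_%:E); ring.
  rewrite ge0_integralZl//; last 3 first.
  - apply/measurable_EFinP; apply: measurable_funM => //.
    exact: (measurableT_comp mk1 (measurable_pair2 y)).
  - by move=> x _; rewrite lee_fin mulr_ge0//; have [] := k12 (x, y).
  - by rewrite lee_fin mulr_ge0.
  by rewrite muleC; apply: lee_wpmul2r => //; rewrite lee_fin mulr_ge0.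
have Al0 : (0 <= A * l `^ (1 - q / p))%R by rewrite mulr_ge0 ?powR_ge0// ltW.
rewrite ge0_integralZl//; last 2 first.
- by apply/measurable_EFinP; exact: measurable_funM.
- by move=> y _; rewrite lee_fin mulr_ge0.
rewrite muleA -EFinM.
have -> : (2 / l * (A * l `^ (1 - q / p)) = 2 * A * l `^ (- (q / p)))%R.
  rewrite powRD; last by rewrite (gt_eqF l0) implybT.
  by rewrite powRr1 ?ltW//; field; rewrite gt_eqF.
apply: lee_wpmul2l; first by rewrite lee_fin !mulr_ge0 ?powR_ge0// ltW.
by apply: le_nonneg_integral => y; rewrite /g'; case: ifP; rewrite ?mul0r// lee_fin mulr_ge0.
Qed.

Let mF : measurable_fun setT F.
Proof.
apply: (measurable_fun_fubini_tonelli_F (fun u : T * T => (k u * g u.2 * w u.2)%:E)).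
  apply/measurable_EFinP; apply: measurable_funM; last exact: (measurableT_comp mw).
  by apply: measurable_funM => //; exact: (measurableT_comp mg).
by move=> u; rewrite lee_fin !mulr_ge0.
Qed.

(** Integrating the weak bound against [q l^(q-1)] and exchanging the integrals, each [y] receives
    the power [l^(q-1-q/p)] over the levels with [l^(q/p) < 4 A g(y)]. The result is a multiple of
    [(4 A g(y))^(p-1)], and the remaining factor [g(y)] completes [g^p]. Convergence at [l = 0] uses
    [b > 0], that is, [p > 1]. *)
Lemma strong_type_bound : \int[m]_x (F x `^ q * (w x)%:E) <=
  (2 * A * q / (q - q / p) * (4 * A) `^ (p - 1))%:E * \int[m]_y (g y `^ p * w y)%:E.
Proof.
have p0 : (0 < p)%R by exact: lt_trans ltr01 p1.
have q0 : (0 < q)%R by exact: lt_le_trans p0 pq.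
pose b := (q - q / p)%R.
have b0 : (0 < b)%R by rewrite subr_gt0 ltr_pdivrMr// ltr_pMr.
pose c (u : R) : R := if (0 < u)%R then (q * u `^ (- q - 1))%R else 0%R.
have c0 u : (0 <= c u)%R by rewrite /c; case: ifP => // _; rewrite mulr_ge0 ?powR_ge0// ltW.
have mc : measurable_fun setT c.
  by apply: measurable_fun_ifT => //; [exact: measurable_fun_ltr|
     apply: measurable_funM => //; exact: measurable_powR].
pose K (x : T) (u : R) : R :=
  if (0 < u)%R && ((u `^ (- 1))%:E < F x)%E then (q * u `^ (- q - 1))%R else 0%R.
have K0 x u : (0 <= K x u)%R by rewrite /K; case: ifP => // _; rewrite mulr_ge0 ?powR_ge0// ltW.
have mK : measurable_fun setT (fun v : T * measurableTypeR R => K v.1 v.2).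
  apply: measurable_fun_ifT => //.
    apply: measurable_and; first exact: measurable_fun_ltr.
    apply: measurable_fun_lte; last exact: (measurableT_comp mF).
    by apply/measurable_EFinP; exact: (measurableT_comp (measurable_powR _)).
  by apply: measurable_funM => //; exact: (measurableT_comp (measurable_powR _)).
have mW : measurable_fun setT (fun v : T * measurableTypeR R => (K v.1 v.2 * w v.1)%:E).
  by apply/measurable_EFinP; apply: measurable_funM => //; exact: (measurableT_comp mw).
apply: (@le_trans _ _ (\int[m]_x \int[mu]_u (K x u * w x)%:E)).
  apply: le_nonneg_integral => x; first by rewrite mule_ge0 ?poweR_ge0 ?lee_fin.
  under eq_integral do rewrite EFinM.
  rewrite ge0_integralZr//; last 3 first.
  - by apply/measurable_EFinP; exact: (measurableT_comp mK (measurable_pair1 x)).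
  - by move=> u _; rewrite lee_fin.
  - by rewrite lee_fin.
  by apply: lee_wpmul2r; [rewrite lee_fin|exact: poweR_layer_le].
rewrite (fubini_tonelli (fun v : T * measurableTypeR R => (K v.1 v.2 * w v.1)%:E))//=; last first.
  by move=> v; rewrite lee_fin mulr_ge0.
(* With [u = 1 / l], the condition that [g y] exceeds the cutting height implies [z y < u]. *)
pose z y := ((4 * A * g y) `^ (- (p / q)))%R.
have mz : measurable_fun setT z.
  by apply: (measurableT_comp (measurable_powR _)); exact: measurable_funM.
have z0 y : (0 <= z y)%R by exact: powR_ge0.
pose G y := (g y * w y)%:E.
have mG : measurable_fun setT G by apply/measurable_EFinP; exact: measurable_funM.
have G0 y : 0 <= G y by rewrite lee_fin mulr_ge0.
pose cb (u : R) : R := if (0 < u)%R then (b * u `^ (- b - 1))%R else 0%R.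
have cb0 u : (0 <= cb u)%R by rewrite /cb; case: ifP => // _; rewrite mulr_ge0 ?powR_ge0// ltW.
have mcb : measurable_fun setT (fun u : measurableTypeR R => (cb u)%:E).
  by apply/measurable_EFinP; apply: measurable_fun_ifT => //; [exact: measurable_fun_ltr|
     apply: measurable_funM => //; exact: measurable_powR].
pose I u := \int[m]_y (if (z y < u)%R then G y else 0).
have I0 u : 0 <= I u by apply: integral_ge0 => y _; case: ifP.
have mI : measurable_fun setT (fun u : measurableTypeR R => I u).
  apply: (measurable_fun_fubini_tonelli_F (fun v : measurableTypeR R * T =>
    if (z v.2 < v.1)%R then G v.2 else 0)).
    apply: measurable_fun_ifT => //.
      by apply: measurable_fun_ltr => //; exact: (measurableT_comp mz).
    exact: (measurableT_comp mG).
  by move=> v; case: ifP.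
have D0 : (0 <= 2 * A * q / b)%R by rewrite divr_ge0 ?(ltW b0)// !mulr_ge0// ltW.
apply: (@le_trans _ _ (\int[mu]_u ((2 * A * q / b)%:E * ((cb u)%:E * I u)))).
  apply: le_nonneg_integral => u; first by apply: integral_ge0 => x _; rewrite lee_fin mulr_ge0.
  have [u0|u0] := ltP 0%R u; last first.
    rewrite integral0_eq; first by rewrite !mule_ge0// lee_fin.
    by move=> x _; rewrite /K ltNge u0 mul0r.
  have l0 : (0 < u `^ (- 1))%R by rewrite powR_gt0.
  have -> : \int[m]_x (K x u * w x)%:E =
      (q * u `^ (- q - 1))%:E * \int[m]_x (if (u `^ (- 1))%:E < F x then (w x)%:E else 0).
    rewrite -ge0_integralZl//; last 3 first.
    - apply: measurable_fun_ifT => //; last exact/measurable_EFinP.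
      exact: measurable_fun_lte.
    - by move=> x _; case: ifP; rewrite ?lee_fin.
    - by rewrite lee_fin mulr_ge0 ?powR_ge0// ltW.
    apply: eq_integral => x _; rewrite /K u0/=; case: ifP => _; last by rewrite mul0r mule0.
    by rewrite EFinM.
  have qu0 : 0 <= (q * u `^ (- q - 1))%:E by rewrite lee_fin mulr_ge0 ?powR_ge0// ltW.
  apply: le_trans (lee_wpmul2l qu0 (weak_type_bound l0)) _.
  rewrite !muleA -!EFinM; apply: lee_pmul.
  - by rewrite lee_fin !mulr_ge0 ?powR_ge0// ltW.
  - by apply: integral_ge0 => y _; case: ifP => // _; rewrite lee_fin mulr_ge0.
  - rewrite lee_fin -powRrM mulN1r opprK /cb u0 le_eqVlt; apply/orP; left; apply/eqP.
    have -> : (u `^ (- b - 1) = u `^ (- q - 1) * u `^ (q / p))%R.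
      rewrite -powRD; last by rewrite (gt_eqF u0) implybT.
      by congr (_ `^ _)%R; rewrite /b; ring.
    by field; rewrite gt_eqF.
  apply: le_nonneg_integral => y; first by case: ifP => // _; rewrite lee_fin mulr_ge0.
  case: ifPn => h; last by case: ifP.
  rewrite ifT// /z; move: h; rewrite ltr_pdivrMr ?mulr_gt0// (mulrC (g y)) -powRrM mulN1r => h.
  have G1 : (0 < 4 * A * g y)%R by apply: lt_trans h; rewrite powR_gt0.
  have := @gt0_ltr_powR _ (p / q)%R (divr_gt0 p0 q0) _ _ (powR_ge0 _ _ : _ \in Num.nneg)
    (ltW G1 : _ \in Num.nneg) h.
  have -> : ((u `^ (- (q / p))) `^ (p / q) = u^-1)%R.
    rewrite -powRrM -(powR_inv1 (ltW u0)); congr (_ `^ _)%R.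
    by field; rewrite !gt_eqF.
  by rewrite powRN invf_plt ?posrE ?powR_gt0.
rewrite ge0_integralZl//; last 2 first.
- exact: emeasurable_funM.
- by move=> u _; rewrite mule_ge0 ?lee_fin.
rewrite [X in _ <= X * _]EFinM -[leRHS]muleA; apply: lee_wpmul2l; first by rewrite lee_fin.
rewrite [X in X <= _](layer_cake_tonelli m mz z0 mG G0 b0).
rewrite -ge0_integralZl//; last 3 first.
- apply/measurable_EFinP; apply: measurable_funM => //.
  exact: (measurableT_comp (measurable_powR _)).
- by move=> y _; rewrite lee_fin mulr_ge0 ?powR_ge0.
- by rewrite lee_fin powR_ge0.
apply: le_nonneg_integral => y.
  rewrite mule_ge0// integral_ge0// => u _; rewrite lee_fin; case: ifP => // _.
  by rewrite mulr_ge0 ?powR_ge0// ltW.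
(* Where [g] vanishes, [z] is 0 by convention and the integral in [u] is infinite, but it is
   multiplied by [G y = 0]. *)
have := g0 y; rewrite le_eqVlt => /predU1P[gy|gy].
  by rewrite /G -gy mul0r mule0 -EFinM lee_fin !mulr_ge0 ?powR_ge0.
have Gy : (0 < 4 * A * g y)%R by rewrite !mulr_gt0.
rewrite integral_powR_tail ?powR_gt0// -!EFinM lee_fin /z -powRrM.
have -> : (- (p / q) * - b = p - 1)%R by rewrite /b; field; rewrite !gt_eqF.
rewrite powRM ?(ltW gy) ?mulr_ge0 ?(ltW A0)//.
rewrite -(mulr_powRB1 (ltW gy) p0) le_eqVlt; apply/orP; left; apply/eqP; ring.
Qed.
End interpolation.

(** * Power integrals of a distance whose balls grow linearly *)

Section linear_growth.
Context d (T : measurableType d) (R : realType).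
Variable m : {sigma_finite_measure set T -> \bar R}.
Notation mu := (@lebesgue_measure R).
Local Open Scope ereal_scope.
Variables (w z : T -> R) (M : R).
Hypotheses (mw : measurable_fun setT w) (w0 : forall x, (0 <= w x)%R).
Hypotheses (mz : measurable_fun setT z) (z0 : forall x, (0 <= z x)%R).
Hypotheses (M0 : (0 < M)%R).
Hypothesis growth : forall s : R, (0 < s)%R ->
  \int[m]_x (if (z x < s)%R then w x else 0%R)%:E <= (M * s)%:E.

(** In the layer cake only [t > r] matters, and the mass at distance less than [t] is at most [M t];
    one power of [t] is lost, hence [b > 1]. *)
Lemma far_integral (r b : R) : (0 < r)%R -> (1 < b)%R ->
  \int[m]_x (if (r <= z x)%R then z x `^ (- b) * w x else 0)%R%:E <=
  (M * b / (b - 1) * r `^ (1 - b))%:E.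
Proof.
move=> r0 b1; have b0 : (0 < b)%R by lra.
have b10 : (0 < b - 1)%R by lra.
pose G x : \bar R := if (r <= z x)%R then (w x)%:E else 0.
have mG : measurable_fun setT G.
  by apply: measurable_fun_ifT => //; [exact: measurable_fun_ler|exact/measurable_EFinP].
have G0 x : 0 <= G x by rewrite /G; case: ifP => // _; rewrite lee_fin.
rewrite (_ : \int[m]_x _ = \int[m]_x ((z x `^ (- b))%:E * G x)); last first.
  by apply: eq_integral => x _; rewrite /G; case: ifP; rewrite ?mule0// EFinM.
apply: le_trans (layer_cake_le m mz z0 mG G0 b0) _.
apply: (@le_trans _ _ (\int[mu]_t ((M * b / (b - 1))%:E *
   (if (r < t)%R then (b - 1) * t `^ (- (b - 1) - 1) else 0)%R%:E))).
  apply: le_nonneg_integral => t.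
    apply: mule_ge0; first by rewrite lee_fin; case: ifP => // _; rewrite mulr_ge0 ?powR_ge0// ltW.
    by apply: integral_ge0 => x _; case: ifP.
  have [t0|t0] := ltP 0%R t; last first.
    by rewrite mul0e ltNge (le_trans t0 (ltW r0)) mule0.
  case: ifPn => rt; last first.
    rewrite mule0 integral0_eq ?mule0// => x _; case: ifPn => // zt.
    by rewrite /G leNgt (lt_le_trans zt)// leNgt.
  apply: (@le_trans _ _ ((b * t `^ (- b - 1))%:E * (M * t)%:E)).
    apply: lee_wpmul2l; first by rewrite lee_fin mulr_ge0 ?powR_ge0// ltW.
    apply: le_trans (growth t0); apply: le_nonneg_integral => x; first by case: ifP.
    by case: ifP => // _; rewrite /G; case: ifP => _; rewrite lee_fin.
  rewrite -!EFinM lee_fin le_eqVlt; apply/orP; left; apply/eqP.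
  have -> : (t `^ (- (b - 1) - 1) = t `^ (- b - 1) * t)%R.
    transitivity (t `^ (- b - 1) * t `^ 1)%R; last by rewrite powRr1// ltW.
    rewrite -powRD; last by rewrite (gt_eqF t0) implybT.
    by congr (_ `^ _)%R; ring.
  by field; rewrite gt_eqF.
rewrite ge0_integralZl//; last 3 first.
- exact: measurable_powR_tail.
- by move=> t _; rewrite lee_fin; case: ifP => // _; rewrite mulr_ge0 ?powR_ge0// ltW.
- by rewrite lee_fin divr_ge0 ?(ltW b10)// mulr_ge0// ltW.
by rewrite integral_powR_tail// -EFinM opprB.
Qed.

Lemma near_integral (r a : R) : (0 < r)%R -> (0 < a)%R -> (a < 1)%R ->
  \int[m]_x (if (z x < r)%R then z x `^ (- a) * w x else 0)%R%:E <=
  ((a * M * (2 `^ (1 - a) / (1 - a)) + M) * r `^ (1 - a))%:E.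
Proof.
move=> r0 a0 a1; have b0 : (0 < 1 - a)%R by lra.
pose G x : \bar R := if (z x < r)%R then (w x)%:E else 0.
have mG : measurable_fun setT G.
  by apply: measurable_fun_ifT => //; [exact: measurable_fun_ltr|exact/measurable_EFinP].
have G0 x : 0 <= G x by rewrite /G; case: ifP => // _; rewrite lee_fin.
rewrite (_ : \int[m]_x _ = \int[m]_x ((z x `^ (- a))%:E * G x)); last first.
  by apply: eq_integral => x _; rewrite /G; case: ifP; rewrite ?mule0// EFinM.
apply: le_trans (layer_cake_le m mz z0 mG G0 a0) _.
(* The mass is at most [M t] and at most [M r]. The two ranges of [t] overlap so that every [t > 0],
   including [t = r], satisfies one of the strict conditions; hence the factor [2 ^ (1 - a)]. *)
pose f1 (t : R) : R := if (0 < t < 2 * r)%R then (t `^ (- a))%R else 0%R.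
pose f2 (t : R) : R := if (r < t)%R then (a * t `^ (- a - 1))%R else 0%R.
have f10 t : (0 <= f1 t)%R by rewrite /f1; case: ifP => // _; exact: powR_ge0.
have f20 t : (0 <= f2 t)%R by rewrite /f2; case: ifP => // _; rewrite mulr_ge0 ?powR_ge0// ltW.
have mf1 : measurable_fun setT f1.
  apply: measurable_fun_ifT => //.
  by apply: measurable_and; exact: measurable_fun_ltr.
have mf2 : measurable_fun setT f2 by apply/measurable_EFinP; exact: measurable_powR_tail.
have aM0 : (0 <= a * M)%R by rewrite mulr_ge0// ltW.
have Mr0 : (0 <= M * r)%R by rewrite mulr_ge0// ltW.
apply: (@le_trans _ _ (\int[mu]_t ((a * M)%:E * (f1 t)%:E + (M * r)%:E * (f2 t)%:E))).
  apply: le_nonneg_integral => t.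
    apply: mule_ge0; first by rewrite lee_fin; case: ifP => // _; rewrite mulr_ge0 ?powR_ge0// ltW.
    by apply: integral_ge0 => x _; case: ifP.
  have [t0|t0] := ltP 0%R t; last by rewrite mul0e adde_ge0// mule_ge0// lee_fin.
  have at0 : (0 <= a * t `^ (- a - 1))%R by rewrite mulr_ge0 ?powR_ge0// ltW.
  have [tr|rt] := ltP t (2 * r)%R.
    apply: (@le_trans _ _ ((a * t `^ (- a - 1))%:E * (M * t)%:E)).
      apply: lee_wpmul2l; first by rewrite lee_fin.
      apply: le_trans (growth t0); apply: le_nonneg_integral => x; first by case: ifP.
      by case: ifP => // _; rewrite /G; case: ifP => _; rewrite lee_fin.
    apply: (@le_trans _ _ ((a * M)%:E * (f1 t)%:E)); last first.
      by rewrite leeDl// mule_ge0// lee_fin.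
    rewrite -!EFinM lee_fin /f1 t0 tr/= le_eqVlt; apply/orP; left; apply/eqP.
    have -> : (t `^ (- a) = t `^ (- a - 1) * t)%R.
      transitivity (t `^ (- a - 1) * t `^ 1)%R; last by rewrite powRr1// ltW.
      rewrite -powRD; last by rewrite (gt_eqF t0) implybT.
      by congr (_ `^ _)%R; ring.
    by ring.
  apply: (@le_trans _ _ ((M * r)%:E * (f2 t)%:E)); last first.
    by rewrite leeDr// mule_ge0// lee_fin.
  rewrite /f2 ifT; last by lra.
  rewrite muleC; apply: lee_wpmul2r; first by rewrite lee_fin.
  apply: le_trans (growth r0); apply: le_nonneg_integral => x; first by case: ifP.
  by case: ifP => // _; rewrite /G; case: ifP => _; rewrite lee_fin.
rewrite ge0_integralD//; last 4 first.
- by move=> t _; rewrite mule_ge0// lee_fin.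
- by apply: emeasurable_funM => //; exact/measurable_EFinP.
- by move=> t _; rewrite mule_ge0// lee_fin.
- by apply: emeasurable_funM => //; exact/measurable_EFinP.
rewrite !ge0_integralZl//; [|exact/measurable_EFinP|by move=> t _; rewrite lee_fin|exact/measurable_EFinP|by move=> t _; rewrite lee_fin].
rewrite (integral_powR_tail r0 a0) mulrDl EFinD; apply: leeD.
  apply: (@le_trans _ _ ((a * M)%:E * ((2 * r) `^ (1 - a) / (1 - a))%:E)).
    apply: lee_wpmul2l; first by rewrite lee_fin.
    by apply: integral_powR_head_le => //; [rewrite mulr_gt0|exact: ltW].
  rewrite -EFinM lee_fin powRM ?(ltW r0)// le_eqVlt; apply/orP; left; apply/eqP; ring.
rewrite -EFinM lee_fin powRD; last by rewrite (gt_eqF r0) implybT.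
by rewrite powRr1 ?(ltW r0)// mulrA.
Qed.
End linear_growth.

(** * Young and Hardy-Littlewood-Sobolev inequalities for the profile kernel *)

Section young_hls.
Context d (T : measurableType d) (R : realType).
Variable m : {sigma_finite_measure set T -> \bar R}.
Local Open Scope ereal_scope.
Variables (w : T -> R) (D : T * T -> R) (M : R).
Hypotheses (mw : measurable_fun setT w) (w0 : forall x, (0 <= w x)%R).
Hypotheses (mD : measurable_fun setT D) (D0 : forall u, (0 <= D u)%R).
Hypotheses (M0 : (0 < M)%R).
Hypothesis growthl : forall x (s : R), (0 < s)%R ->
  \int[m]_y (if (D (x, y) < s)%R then w y else 0%R)%:E <= (M * s)%:E.
Hypothesis growthr : forall y (s : R), (0 < s)%R ->
  \int[m]_x (if (D (x, y) < s)%R then w x else 0%R)%:E <= (M * s)%:E.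
Variables (p p' q delta : R).
Hypotheses (p1 : (1 < p)%R) (conj_p : (p^-1 + p'^-1 = 1)%R) (pq : (p <= q)%R).
Hypotheses (delta0 : (0 < delta)%R) (delta1 : (delta < 1)%R).
Hypothesis deltaE : (p < q)%R -> (delta = 1 + q^-1 - p^-1)%R.

(* The [s^-2] tail makes the profile integrable at infinity; near [0] only
   [delta < 1] matters. *)
Definition kernel_profile (delta s : R) : R := if (s < 1)%R then (s `^ (- delta))%R else (s `^ (- 2))%R.

Lemma kernel_profile_ge0 dlt s : (0 <= kernel_profile dlt s)%R.
Proof. by rewrite /kernel_profile; case: ifP => _; exact: powR_ge0. Qed.

Lemma measurable_kernel_profile dlt : measurable_fun setT (kernel_profile dlt).
Proof.
apply: measurable_fun_ifT; [exact: measurable_fun_ltr|exact: measurable_powR|exact: measurable_powR].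
Qed.

Lemma kernel_profile_le s : (kernel_profile delta s <= s `^ (- delta))%R.
Proof.
rewrite /kernel_profile; case: ltP => // s1; apply: ler_powR => //; have := delta1; lra.
Qed.

Let k (u : T * T) : R := kernel_profile delta (D u).

Let k0 u : (0 <= k u)%R. Proof. exact: kernel_profile_ge0. Qed.

Let mk : measurable_fun setT k.
Proof. exact: (measurableT_comp (measurable_kernel_profile delta) mD). Qed.

Let nearC : R := (delta * M * (2 `^ (1 - delta) / (1 - delta)) + M)%R.

Let nearC0 : (0 < nearC)%R.
Proof.
have d1 : (0 < 1 - delta)%R by rewrite subr_gt0.
by rewrite /nearC addr_gt0// mulr_gt0 ?divr_gt0 ?powR_gt0 ?mulr_gt0.
Qed.

Let mDl x : measurable_fun setT (fun y => D (x, y)).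
Proof. exact: (measurableT_comp mD (measurable_pair1 x)). Qed.

Let mDr y : measurable_fun setT (fun x => D (x, y)).
Proof. exact: (measurableT_comp mD (measurable_pair2 y)). Qed.

(** The uniform integrability that Young's inequality needs when [p = q]: [nearC] comes from
    distances below 1, and [M * 2] from the tail with exponent 2. *)
Lemma kernel_profile_integral (z : T -> R) : measurable_fun setT z -> (forall x, (0 <= z x)%R) ->
  (forall s : R, (0 < s)%R ->
    \int[m]_x (if (z x < s)%R then w x else 0%R)%:E <= (M * s)%:E) ->
  \int[m]_x (kernel_profile delta (z x) * w x)%:E <= (nearC + M * 2)%:E.
Proof.
move=> mz z0 growth.
have := near_integral mw w0 mz z0 M0 growth ltr01 delta0 delta1.
rewrite powR1 mulr1 -/nearC => H1.
have := far_integral mw w0 mz z0 M0 growth ltr01 (ltr1n R 2 : (1 < 2)%R).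
rewrite powR1 mulr1 (_ : M * 2 / (2 - 1) = M * 2)%R; last by field.
move=> H2; rewrite EFinD; apply: le_trans (leeD H1 H2).
rewrite -ge0_integralD//.
- apply: le_nonneg_integral => x; first by rewrite lee_fin mulr_ge0// kernel_profile_ge0.
  rewrite -EFinD lee_fin /kernel_profile.
  by case: (ltP (z x) 1%R) => _; rewrite ?addr0 ?add0r.
- by move=> x _; rewrite lee_fin; case: ifP => // _; rewrite mulr_ge0 ?powR_ge0.
- apply/measurable_EFinP; apply: measurable_fun_ifT => //; first exact: measurable_fun_ltr.
  by apply: measurable_funM => //; exact: (measurableT_comp (measurable_powR _)).
- by move=> x _; rewrite lee_fin; case: ifP => // _; rewrite mulr_ge0 ?powR_ge0.
- apply/measurable_EFinP; apply: measurable_fun_ifT => //; first exact: measurable_fun_ler.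
  by apply: measurable_funM => //; exact: (measurableT_comp (measurable_powR _)).
Qed.

Let p0 : (0 < p)%R. Proof. exact: lt_trans ltr01 p1. Qed.
Let q0 : (0 < q)%R. Proof. exact: lt_le_trans p0 pq. Qed.
Let ip1 : (p^-1 < 1)%R. Proof. by rewrite invf_lt1. Qed.
Let p'1 : (1 < p')%R.
Proof.
have ip' : (0 < p'^-1)%R by have := ip1; have := conj_p; lra.
have ip'1 : (p'^-1 < 1)%R.
  have : (0 < p^-1)%R by rewrite invr_gt0.
  have := conj_p; lra.
by rewrite -(invrK p') invf_gt1// invr_gt0 -invr_gt0.
Qed.

(** The weight is distributed as [w = w^(1/p') w^(1/p)] between the two factors. *)
Lemma weighted_hoelder (f g : T -> R) : measurable_fun setT f -> measurable_fun setT g ->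
  (forall x, (0 <= f x)%R) -> (forall x, (0 <= g x)%R) ->
  \int[m]_x (f x * g x * w x)%:E <=
  (\int[m]_x (f x `^ p' * w x)%:E) `^ p'^-1 * (\int[m]_x (g x `^ p * w x)%:E) `^ p^-1.
Proof.
move=> mf mg f0 g0; have p'0 : (0 < p')%R by exact: lt_trans ltr01 p'1.
pose f' x := (f x * w x `^ p'^-1)%R; pose g' x := (g x * w x `^ p^-1)%R.
have mf' : measurable_fun setT f'.
  by apply: measurable_funM => //; exact: (measurableT_comp (measurable_powR _)).
have mg' : measurable_fun setT g'.
  by apply: measurable_funM => //; exact: (measurableT_comp (measurable_powR _)).
have pq' : (p'^-1 + p^-1 = 1)%R by rewrite addrC.
have := hoelder m mf' mg' p'0 p0 pq'.
rewrite Lnorm1 unlock => H.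
have E1 : \int[m]_x `|((f' \* g')%R x)%:E| = \int[m]_x (f x * g x * w x)%:E.
  apply: eq_integral => x _; rewrite abse_EFin ger0_norm; last by rewrite !mulr_ge0// ?powR_ge0.
  congr (_%:E); rewrite /f' /g' /= mulrACA; congr (_ * _)%R.
  by rewrite -powRD ?pq' ?powRr1// oner_eq0.
have E2 : \int[m]_x (`|(f' x)%:E| `^ p') = \int[m]_x (f x `^ p' * w x)%:E.
  apply: eq_integral => x _; rewrite abse_EFin ger0_norm; last by rewrite !mulr_ge0// ?powR_ge0.
  by rewrite poweR_EFin powRM ?powR_ge0// -powRrM mulVf ?gt_eqF// powRr1.
have E3 : \int[m]_x (`|(g' x)%:E| `^ p) = \int[m]_x (g x `^ p * w x)%:E.
  apply: eq_integral => x _; rewrite abse_EFin ger0_norm; last by rewrite !mulr_ge0// ?powR_ge0.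
  by rewrite poweR_EFin powRM ?powR_ge0// -powRrM mulVf ?gt_eqF// powRr1.
by rewrite -E1 -E2 -E3.
Qed.

Let F (g : T -> R) x := \int[m]_y (kernel_profile delta (D (x, y)) * g y * w y)%:E.

(* For [p < q] the kernel is cut at the distance [r] proportional to [l^-q],
   chosen so that Hoelder's inequality bounds the far part by [l / 4]; for
   [p = q] no cut is needed. *)
Lemma young_hls_unit : exists2 C : R, (0 < C)%R & forall g : T -> R,
  measurable_fun setT g -> (forall x, (0 <= g x)%R) ->
  \int[m]_y (g y `^ p * w y)%:E <= 1 ->
  \int[m]_x (F g x `^ q * (w x)%:E) <= C%:E * \int[m]_y (g y `^ p * w y)%:E.
Proof.
have qp0 : (0 < q - q / p)%R.
  by rewrite subr_gt0 ltr_pdivrMr// ltr_pMr.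
have Cpos A : (0 < A)%R -> (0 < 2 * A * q / (q - q / p) * (4 * A) `^ (p - 1))%R.
  by move=> A0; rewrite mulr_gt0 ?powR_gt0 ?divr_gt0 ?mulr_gt0.
have [peq|pneq] := eqVneq p q.
  have A0 : (0 < nearC + M * 2)%R by rewrite addr_gt0// mulr_gt0.
  exists (2 * (nearC + M * 2) * q / (q - q / p) * (4 * (nearC + M * 2)) `^ (p - 1))%R; first exact: Cpos.
  move=> g mg g0 _; apply: (strong_type_bound (k := k)) => // l l0.
  exists k, (fun=> 0%R); split => //.
  - by move=> u; rewrite addr0.
  - rewrite -{1 2}peq divff ?gt_eqF// subrr powRr0 mulr1.
    by split => [x|y]; apply: kernel_profile_integral => //; [exact: growthl|exact: growthr].
  - move=> x; rewrite integral0_eq ?lee_fin ?divr_ge0 ?(ltW l0)// => y _.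
    by rewrite !mul0r.
have pltq : (p < q)%R by rewrite lt_neqAle pneq.
have dE := deltaE pltq.
have p'0 : (0 < p')%R by exact: lt_trans ltr01 p'1.
have iq0 : (0 < q^-1)%R by rewrite invr_gt0.
have dE' : (delta = p'^-1 + q^-1)%R by have := conj_p; lra.
(* [delta p' = 1 + p'/q], so the far part of the kernel has a finite [p']-th power integral. *)
have dp1 : (1 < delta * p')%R.
  by rewrite dE' mulrDl mulVf ?gt_eqF// ltrDl mulr_gt0.
pose FC := (M * (delta * p') / (delta * p' - 1))%R.
have FC0 : (0 < FC)%R.
  by rewrite divr_gt0 ?subr_gt0// mulr_gt0// mulr_gt0.
pose B := (FC `^ p'^-1)%R.
have B0 : (0 < B)%R by rewrite powR_gt0.
have B40 : (0 < 4 * B)%R by rewrite mulr_gt0.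
(* With [r = (4 B)^q l^(-q)] the near part is [nearC r^(1 - delta)], and [q (1 - delta) = q/p - 1]
   gives the power of [l] demanded by [split_k]. The far part is [B r^(-1/q) = l / 4]. *)
pose A := (nearC * (4 * B) `^ (q * (1 - delta)))%R.
have A0 : (0 < A)%R by rewrite mulr_gt0 ?powR_gt0.
exists (2 * A * q / (q - q / p) * (4 * A) `^ (p - 1))%R; first exact: Cpos.
move=> g mg g0 g1; apply: (strong_type_bound (k := k)) => // l l0.
pose r := ((4 * B) `^ q * l `^ (- q))%R.
have r0 : (0 < r)%R by rewrite mulr_gt0 ?powR_gt0.
pose k1 u := if (D u < r)%R then k u else 0%R.
pose k2 u := if (r <= D u)%R then k u else 0%R.
have k10 u : (0 <= k1 u)%R by rewrite /k1; case: ifP.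
have k20 u : (0 <= k2 u)%R by rewrite /k2; case: ifP.
have mk1 : measurable_fun setT k1.
  by apply: measurable_fun_ifT => //; exact: measurable_fun_ltr.
have mk2 : measurable_fun setT k2.
  by apply: measurable_fun_ifT => //; exact: measurable_fun_ler.
have nearA : (nearC * r `^ (1 - delta) = A * l `^ (1 - q / p))%R.
  rewrite /r powRM ?powR_ge0// -!powRrM /A mulrA; congr (_ * _ `^ _)%R.
  rewrite dE; field; rewrite !gt_eqF//.
exists k1, k2; split => //.
- by move=> u; rewrite /k1 /k2; case: ltP => _; rewrite ?addr0 ?add0r.
- have near (z : T -> R) : measurable_fun setT z -> (forall x, (0 <= z x)%R) ->
      (forall s : R, (0 < s)%R ->
        \int[m]_x (if (z x < s)%R then w x else 0%R)%:E <= (M * s)%:E) ->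
      \int[m]_x ((if (z x < r)%R then kernel_profile delta (z x) else 0%R) * w x)%:E <=
      (A * l `^ (1 - q / p))%:E.
    move=> mz z0 growth.
    have := near_integral mw w0 mz z0 M0 growth r0 delta0 delta1.
    rewrite -/nearC nearA; apply: le_trans; apply: le_nonneg_integral => x.
      by rewrite lee_fin mulr_ge0//; case: ifP => // _; exact: kernel_profile_ge0.
    by rewrite lee_fin; case: ifP => _; rewrite ?mul0r// ler_wpM2r// kernel_profile_le.
  by split => [x|y]; apply: near => //; [exact: growthl|exact: growthr].
- move=> x.
  have mk2x : measurable_fun setT (fun y => k2 (x, y)).
    exact: (measurableT_comp mk2 (measurable_pair1 x)).
  have := weighted_hoelder mk2x mg (fun y => k20 (x, y)) g0.
  move=> /le_trans; apply.
  have far : \int[m]_y (k2 (x, y) `^ p' * w y)%:E <= (FC * r `^ (1 - delta * p'))%:E.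
    have := far_integral mw w0 (mDl x) (fun y => D0 (x, y)) M0 (growthl x) r0 dp1.
    apply: le_trans; apply: le_nonneg_integral => y; first by rewrite lee_fin mulr_ge0 ?powR_ge0.
    rewrite lee_fin /k2; case: ifP => _; last by rewrite powR0 ?gt_eqF// mul0r.
    rewrite ler_wpM2r// -mulNr powRrM ge0_ler_powR ?nnegrE ?powR_ge0 ?(ltW p'0) ?kernel_profile_ge0//.
    exact: kernel_profile_le.
  apply: (@le_trans _ _ ((l / 4)%:E * 1)); last by rewrite mule1.
  apply: lee_pmul; rewrite ?poweR_ge0//.
  + apply: (@le_trans _ _ (((FC * r `^ (1 - delta * p'))%:E) `^ p'^-1)).
      apply: gt0_ler_poweR => //; rewrite ?invr_ge0 ?(ltW p'0)// in_itv/= ?leey andbT.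
        by apply: integral_ge0 => y _; rewrite lee_fin mulr_ge0 ?powR_ge0.
      by rewrite lee_fin mulr_ge0 ?powR_ge0 ?(ltW FC0).
    rewrite poweR_EFin lee_fin powRM ?powR_ge0 ?(ltW FC0)// -/B -powRrM.
    have -> : ((1 - delta * p') / p' = - q^-1)%R.
      by rewrite dE'; field; rewrite !gt_eqF.
    rewrite /r powRM ?powR_ge0// -!powRrM mulrNN mulrN mulfV ?gt_eqF// powRr1 ?(ltW l0)//.
    rewrite powRN powRr1 ?(ltW B40)// le_eqVlt; apply/orP; left; apply/eqP.
    by field; rewrite gt_eqF.
  + rewrite -(poweR1r p^-1); apply: gt0_ler_poweR => //; rewrite ?invr_ge0 ?(ltW p0)// in_itv/= ?leey andbT//.
    by apply: integral_ge0 => y _; rewrite lee_fin mulr_ge0 ?powR_ge0.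
Qed.

(** Follows by homogeneity, rescaling [g] to unit mass. A vanishing mass cannot be rescaled, but the
    bound for mass at most 1 applies to it directly. *)
Lemma young_hls : exists2 C : R, (0 < C)%R & forall g : T -> R,
  measurable_fun setT g -> (forall x, (0 <= g x)%R) ->
  \int[m]_y (g y `^ p * w y)%:E < +oo ->
  \int[m]_x (F g x `^ q * (w x)%:E) <=
  C%:E * (\int[m]_y (g y `^ p * w y)%:E) `^ (q / p).
Proof.
have [C C0 HC] := young_hls_unit; exists C => // g mg g0.
set N := \int[m]_y _ => Noo.
have N0 : 0 <= N by apply: integral_ge0 => y _; rewrite lee_fin mulr_ge0 ?powR_ge0.
have [Nz|Nz] := eqVneq N 0.
  have := HC g mg g0; rewrite -/N Nz mule0 lee01 => /(_ isT) /le_trans; apply.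
  by rewrite mule_ge0 ?poweR_ge0 ?lee_fin// ltW.
have Nfin : N \is a fin_num by rewrite ge0_fin_numE.
pose N' := fine N; have NE : N = N'%:E by rewrite fineK.
have N'0 : (0 < N')%R by rewrite fine_gt0// Noo lt0e Nz N0.
pose c := (N' `^ (- p^-1))%R.
have c0 : (0 < c)%R by rewrite powR_gt0.
pose g' y := (c * g y)%R.
have mg' : measurable_fun setT g' by exact: measurable_funM.
have g'0 y : (0 <= g' y)%R by rewrite mulr_ge0// ltW.
have cp : (c `^ p = N'^-1)%R.
  by rewrite /c -powRrM mulNr mulVf ?gt_eqF// powR_inv1// ltW.
have mgp : measurable_fun setT (fun y => (g y `^ p * w y)%R).
  by apply: measurable_funM => //; exact: (measurableT_comp (measurable_powR _)).
have N1 : \int[m]_y (g' y `^ p * w y)%:E = 1.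
  under eq_integral do rewrite powRM ?(ltW c0)// cp -mulrA EFinM.
  rewrite ge0_integralZl//; last 3 first.
  - exact/measurable_EFinP.
  - by move=> y _; rewrite lee_fin mulr_ge0 ?powR_ge0.
  - by rewrite lee_fin invr_ge0 ltW.
  by rewrite -/N NE -EFinM mulVf// gt_eqF.
have := HC g' mg' g'0; rewrite N1 lexx => /(_ isT); rewrite mule1.
have Fg' x : F g' x = c%:E * F g x.
  rewrite /F -ge0_integralZl//; last 3 first.
  - apply/measurable_EFinP; apply: measurable_funM => //; apply: measurable_funM => //.
    exact: (measurableT_comp mk (measurable_pair1 x)).
  - by move=> y _; rewrite lee_fin !mulr_ge0 ?kernel_profile_ge0.
  - by rewrite lee_fin ltW.
  by apply: eq_integral => y _; rewrite -EFinM /g'; congr (_%:E); ring.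
have Fg0 x : 0 <= F g x by apply: integral_ge0 => y _; rewrite lee_fin !mulr_ge0 ?kernel_profile_ge0.
have mF : measurable_fun setT (F g).
  apply: (measurable_fun_fubini_tonelli_F (fun u : T * T => (k u * g u.2 * w u.2)%:E)).
    apply/measurable_EFinP; apply: measurable_funM; last exact: (measurableT_comp mw).
    by apply: measurable_funM => //; exact: (measurableT_comp mg).
  by move=> u; rewrite lee_fin !mulr_ge0.
have mFq : measurable_fun setT (fun x => F g x `^ q * (w x)%:E).
  apply: emeasurable_funM; last exact/measurable_EFinP.
  exact: (measurableT_comp (measurable_poweR _)).
under eq_integral do rewrite Fg' poweRM ?lee_fin ?(ltW c0)// -muleA poweR_EFin.
rewrite ge0_integralZl//; last 2 first.
- by move=> x _; rewrite mule_ge0 ?poweR_ge0 ?lee_fin.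
- by rewrite lee_fin powR_ge0.
have cq0 : (0 < c `^ q)%R by rewrite powR_gt0.
rewrite -lee_pdivlMl// => /le_trans; apply.
rewrite NE poweR_EFin muleC lee_wpmul2l ?lee_fin ?(ltW C0)//.
by rewrite /c -powRrM -powRN mulNr opprK mulrC.
Qed.
End young_hls.

(** * Domination of the fractional integral of a radial function *)

Section kernel_bound.
Variables (R : realType) (n : nat).
Hypothesis n0 : (0 < n)%N.
Notation mu := (@lebesgue_measure R).
Notation mun := (lebesgueRn R n).
Local Open Scope ereal_scope.

(** The difference of the logarithmic radii is invariant under common dilations, as is the measure
    [|y|^-n dy]; in these coordinates radial functions live on a line. *)
Definition logdist (u : 'Rn[R]_n * 'Rn[R]_n) : R := `|ln (enorm u.1) - ln (enorm u.2)|%R.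

Lemma measurable_logdist : measurable_fun setT logdist.
Proof.
apply: measurableT_comp => //; apply: measurable_funB; apply: (measurableT_comp (@measurable_ln R)).
  by apply: (measurableT_comp (@measurable_enorm R n)).
by apply: (measurableT_comp (@measurable_enorm R n)).
Qed.

Lemma logdist_ge0 u : (0 <= logdist u)%R.
Proof. exact: normr_ge0. Qed.

Let nR0 : (0 < n%:R :> R)%R. Proof. by rewrite ltr0n. Qed.

(* The origin carries no weight: [0 `^ (- n%:R)] is 0. *)
Lemma logdist_growth (x : 'Rn[R]_n) (s : R) : (0 < s)%R ->
  \int[mun]_y (if (logdist (x, y) < s)%R then enorm y `^ (- n%:R) else 0)%R%:E <=
  (2 * n%:R * unit_ball_volume R n * s)%:E.
Proof.
move=> s0; pose L := ln (enorm x).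
(* The condition on [y] places [|y|^n] in an interval of logarithmic length [2 n s], and the weight
   becomes [dt / t]. *)
pose a := expR (n%:R * (L - s)); pose b := expR (n%:R * (L + s)).
have a0 : (0 < a)%R by exact: expR_gt0.
have ab : (a < b)%R by rewrite ltr_expR ltr_pM2l//; lra.
pose h (t : R) : R := if (a < t < b)%R then (t `^ (- 1))%R else 0%R.
have h0 t : 0 <= (h t)%:E by rewrite lee_fin /h; case: ifP => // _; exact: powR_ge0.
have mh : measurable_fun setT (fun t => (h t)%:E).
  apply/measurable_EFinP; apply: measurable_fun_ifT => //.
    by apply: measurable_and; apply: measurable_fun_ltr.
apply: (@le_trans _ _ (\int[mun]_y (if (0 < enorm y)%R then (h (enorm y ^+ n)%R)%:E else 0))).
  apply: le_nonneg_integral => y; first by rewrite lee_fin; case: ifP => // _; exact: powR_ge0.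
  case: ifPn => Dy; last by case: ifP.
  have := enorm_ge0 y; rewrite le_eqVlt => /predU1P[<-|y0].
    by rewrite ltxx powR0// oppr_eq0 gt_eqF.
  rewrite y0 /h; move: Dy; rewrite /logdist/= -/L ltr_norml => /andP[h1 h2].
  have lnN : expR (n%:R * ln (enorm y)) = (enorm y ^+ n)%R.
    by rewrite -powR_mulrn ?ltW// /powR gt_eqF.
  rewrite -lnN /a /b !ltr_expR !ltr_pM2l// ifT; last by apply/andP; split; lra.
  rewrite lee_fin lnN -powR_mulrn ?(ltW y0)// -powRrM mulrN1.
  exact: lexx.
rewrite (integral_radial n0 mh h0).
apply: (@le_trans _ _ ((unit_ball_volume R n)%:E * (ln b - ln a)%:E)).
  apply: lee_wpmul2l; first by rewrite lee_fin unit_ball_volume_ge0.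
  rewrite -(integral_inv a0 ab); apply: le_nonneg_integral => t; first by case: ifP.
  by case: ifP => // _; rewrite lee_fin; case: ifP => // _; exact: powR_ge0.
rewrite /a /b !expRK -EFinM lee_fin le_eqVlt; apply/orP; left; apply/eqP; ring.
Qed.

(** Below distance 1 the exponential is at most 1, hence at most [D^-delta]; above it,
    [exp u >= u^2 / 2] produces [2 / a^2]. Positivity of [D] avoids the default value
    [0 ^ (-delta) = 0]. *)
Lemma expR_le_kernel_profile (delta a D : R) : (0 < delta)%R -> (0 < a)%R -> (0 < D)%R ->
  (expR (- a * D) <= (1 + 2 / a ^+ 2) * kernel_profile delta D)%R.
Proof.
move=> d0 a0 D0; have a2 : (0 < 2 / a ^+ 2)%R by rewrite divr_gt0// exprn_gt0.
rewrite /kernel_profile; case: ltP => D1.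
  apply: (@le_trans _ _ 1%R).
    by rewrite -expR0 ler_expR mulNr oppr_le0 mulr_ge0// ltW.
  apply: (@le_trans _ _ (D `^ (- delta))%R).
    by rewrite -[leLHS](powRr0 D); apply: ger_powR; [rewrite D0 ltW|rewrite oppr_le0 ltW].
  by rewrite ler_peMl ?powR_ge0// lerDl ltW.
apply: (@le_trans _ _ (2 / a ^+ 2 * D `^ (- 2))%R); last first.
  by rewrite ler_wpM2r ?powR_ge0// lerDr.
have aD : (0 < a * D)%R by rewrite mulr_gt0.
have h : ((a * D) ^+ 2 / 2 <= expR (a * D))%R.
  have := @expR_ge1Dxn R (a * D)%R 1 (ltW aD).
  by rewrite (_ : (2`!%:R = 2 :> R)%R)//; lra.
rewrite powR_invn ?(ltW D0)// mulNr expRN.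
have -> : (2 / a ^+ 2 * D ^- 2 = ((a * D) ^+ 2 / 2)^-1)%R by field; rewrite !gt_eqF.
by rewrite lef_pV2 ?posrE ?expR_gt0// divr_gt0// exprn_gt0.
Qed.

Lemma ler_powRN (u v c : R) : (0 < u)%R -> (u <= v)%R -> (0 <= c)%R ->
  (v `^ (- c) <= u `^ (- c))%R.
Proof.
move=> u0 uv c0; have v0 : (0 < v)%R by exact: lt_le_trans uv.
by rewrite !powRN lef_pV2 ?posrE ?powR_gt0// ge0_ler_powR ?nnegrE ?(ltW u0) ?(ltW v0).
Qed.

Lemma powRN_shift (u v c : R) : (0 < u)%R -> (0 < v)%R -> (v <= u)%R ->
  (u `^ (- c) = v `^ (- c) * expR (- c * `|ln u - ln v|))%R.
Proof.
move=> u0 v0 vu; rewrite ger0_norm; last by rewrite subr_ge0 ler_ln ?posrE.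
by rewrite /powR !gt_eqF// -expRD; congr expR; ring.
Qed.

Lemma powRN_half (u c : R) : (0 < u)%R -> ((u / 2) `^ (- c) = 2 `^ c * u `^ (- c))%R.
Proof.
move=> u0; rewrite powRM ?(ltW u0) ?invr_ge0// mulrC; congr (_ * _)%R.
by rewrite -powR_inv1// -powRrM mulrN mulN1r opprK.
Qed.

(** From [ln (1 + u) <= u] applied to the ratio of the radii. The second bound trades [|r - rho|]
    for the logarithmic distance on the annulus; the first keeps that distance where the profile is
    [s^-delta]. *)
Lemma logdist_le (r rho : R) : (0 < r)%R -> (r / 2 <= rho <= 2 * r)%R ->
  (`|ln r - ln rho| <= 1)%R /\ (`|ln r - ln rho| <= 2 * `|r - rho| / r)%R.
Proof.
move=> r0 /andP[h1 h2].
have rho0 : (0 < rho)%R by lra.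
have lnle (u v : R) : (0 < v)%R -> (v <= u)%R -> (u <= 2 * v)%R ->
    (0 <= ln u - ln v <= 1)%R /\ (ln u - ln v <= (u - v) / v)%R.
  move=> v0 vu u2v; have u0 : (0 < u)%R by exact: lt_le_trans vu.
  have h : (ln u - ln v <= (u - v) / v)%R.
    rewrite -ln_div ?posrE//; have -> : (u / v = 1 + (u - v) / v)%R by field; rewrite gt_eqF.
    apply: le_ln1Dx; have : (0 <= (u - v) / v)%R by rewrite divr_ge0 ?subr_ge0 ?(ltW v0).
    by lra.
  split => //; rewrite subr_ge0 ler_ln ?posrE// vu/=.
  by apply: (le_trans h); rewrite ler_pdivrMr// mul1r; lra.
have [rr|rr] := leP rho r.
  have [/andP[k1 k2] k3] := lnle r rho rho0 rr (ltac:(lra)).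
  rewrite ger0_norm// ger0_norm ?subr_ge0//; split => //.
  apply: (le_trans k3); rewrite ler_pdivrMr// mulrAC ler_pdivlMr//; nra.
have [/andP[k1 k2] k3] := lnle rho r r0 (ltW rr) h2.
rewrite distrC ger0_norm// distrC gtr0_norm ?subr_gt0//; split => //.
apply: (le_trans k3); rewrite ler_pM2r ?invr_gt0//; lra.
Qed.

(* With [a = n/p' - alpha] and [b = n/q - beta] the scaling relation reads
   [gamma = a + b]. *)
Lemma kernel_bound (a b delta : R) : (0 < a)%R -> (0 < b)%R ->
  (0 < delta)%R -> (a + b <= delta + n.-1%:R)%R ->
  exists2 C : R, (0 < C)%R & forall (x : 'Rn[R]_n) (h : R -> R),
  (0 < enorm x)%R -> measurable_fun setT h -> (forall t, (0 <= h t)%R) -> h 0%R = 0%R ->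
  (enorm x `^ b)%:E *
    \int[mun]_y (h (enorm y ^+ n) * enorm (subRn x y) `^ (- (a + b)))%R%:E <=
  C%:E * \int[mun]_y (kernel_profile delta (logdist (x, y)) * (h (enorm y ^+ n) * enorm y `^ (- a)))%R%:E.
Proof.
move=> a0 b0 d0 dab.
pose gam := (a + b)%R; have gam0 : (0 < gam)%R by rewrite addr_gt0.
have [CB CB0 HB] := radial_kernel_le n0 d0.
(* The surplus exponent: on the annulus [|x - y|^ex <= (3 r)^ex], which raises the singularity from
   [gamma] to [delta + n - 1]. *)
pose ex := (delta + n.-1%:R - gam)%R.
have ex0 : (0 <= ex)%R by rewrite subr_ge0.
pose C1 := (2 `^ gam * (1 + 2 / a ^+ 2))%R.
pose C2 := (3 `^ ex * CB * 2 `^ delta * 2 `^ a)%R.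
pose C3 := (2 `^ gam * (1 + 2 / b ^+ 2))%R.
have C10 : (0 < C1)%R by rewrite mulr_gt0 ?powR_gt0// addr_gt0// divr_gt0// exprn_gt0.
have C20 : (0 < C2)%R by rewrite !mulr_gt0 ?powR_gt0.
have C30 : (0 < C3)%R by rewrite mulr_gt0 ?powR_gt0// addr_gt0// divr_gt0// exprn_gt0.
exists (C1 + C2 + C3)%R; first by rewrite !addr_gt0.
move=> x h; set r := enorm x => r0 mh h0 h00.
pose Kf y := (kernel_profile delta (logdist (x, y)) * (h (enorm y ^+ n) * enorm y `^ (- a)))%R.
have Kf0 y : (0 <= Kf y)%R by rewrite !mulr_ge0 ?kernel_profile_ge0 ?powR_ge0.
have mN := @measurable_enormX R n n.
have mhN : measurable_fun setT (fun y : 'Rn[R]_n => h (enorm y ^+ n)%R) by exact: (measurableT_comp mh mN).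
have mdist : measurable_fun setT (fun y : 'Rn[R]_n => enorm (subRn x y)).
  by apply: (measurableT_comp (@measurable_enorm R n)); exact: measurable_subRn.
have mkl : measurable_fun setT (fun y : 'Rn[R]_n => kernel_profile delta (logdist (x, y))).
  apply: (measurableT_comp (measurable_kernel_profile delta)).
  exact: (measurableT_comp measurable_logdist (measurable_pair1 x)).
have mKf : measurable_fun setT Kf.
  apply: measurable_funM => //; apply: measurable_funM => //.
  exact: (measurableT_comp (measurable_powR _) (@measurable_enorm R n)).
(* The profile is cut rather than the kernel, so that [radial_kernel_le] applies to the middle
   piece, which is again radial. *)
pose lo := ((r / 2) ^+ n)%R; pose hi := ((2 * r) ^+ n)%R.
pose h1 t := if (t < lo)%R then h t else 0%R.
pose h2 t := if (lo <= t <= hi)%R then h t else 0%R.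
pose h3 t := if (hi < t)%R then h t else 0%R.
have mh1 : measurable_fun setT h1 by apply: measurable_fun_ifT => //; exact: measurable_fun_ltr.
have mh2 : measurable_fun setT h2.
  by apply: measurable_fun_ifT => //; apply: measurable_and; exact: measurable_fun_ler.
have mh3 : measurable_fun setT h3 by apply: measurable_fun_ifT => //; exact: measurable_fun_ltr.
have h10 t : (0 <= h1 t)%R by rewrite /h1; case: ifP.
have h20 t : (0 <= h2 t)%R by rewrite /h2; case: ifP.
have h30 t : (0 <= h3 t)%R by rewrite /h3; case: ifP.
pose J (f : R -> R) y := (f (enorm y ^+ n) * enorm (subRn x y) `^ (- gam))%R.
have mJ (f : R -> R) : measurable_fun setT f -> measurable_fun setT (fun y => (J f y)%:E).
  move=> mf; apply/measurable_EFinP; apply: measurable_funM.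
    exact: (measurableT_comp mf mN).
  exact: (measurableT_comp (measurable_powR _) mdist).
have J0 (f : R -> R) y : (forall t, 0 <= f t)%R -> 0 <= (J f y)%:E.
  by move=> f0; rewrite lee_fin mulr_ge0 ?powR_ge0.
have rb0 : 0 <= (r `^ b)%:E by rewrite lee_fin powR_ge0.
have loE y : (enorm y ^+ n < lo)%R = (enorm y < r / 2)%R.
  by rewrite ltr_pXn2r ?nnegrE ?enorm_ge0 ?divr_ge0 ?(ltW r0).
have loE' y : (lo <= enorm y ^+ n)%R = (r / 2 <= enorm y)%R.
  by rewrite ler_pXn2r ?nnegrE ?enorm_ge0 ?divr_ge0 ?(ltW r0).
have hiE y : (hi < enorm y ^+ n)%R = (2 * r < enorm y)%R.
  by rewrite ltr_pXn2r ?nnegrE ?enorm_ge0 ?mulr_ge0 ?(ltW r0).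
have hiE' y : (enorm y ^+ n <= hi)%R = (enorm y <= 2 * r)%R.
  by rewrite ler_pXn2r ?nnegrE ?enorm_ge0 ?mulr_ge0 ?(ltW r0).
have subI (f : R -> R) (C : R) : (0 <= C)%R -> measurable_fun setT f -> (forall t, 0 <= f t)%R ->
    (forall y, r `^ b * J f y <= C * Kf y)%R ->
    (r `^ b)%:E * \int[mun]_y (J f y)%:E <= C%:E * \int[mun]_y (Kf y)%:E.
  move=> C0 mf f0 fC; rewrite -!ge0_integralZl//.
  + by apply: le_nonneg_integral => y; rewrite -EFinM ?lee_fin// mulr_ge0 ?powR_ge0// -lee_fin; exact: J0.
  + exact/measurable_EFinP.
  + by move=> y _; rewrite lee_fin.
  + exact: mJ.
  + by move=> y _; exact: J0.
(* Inside, [|x - y| >= r / 2], and [r^(b - gamma) = r^-a] is [|y|^-a] times an exponential in the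
   logarithmic distance. *)
have I1 : (r `^ b)%:E * \int[mun]_y (J h1 y)%:E <= C1%:E * \int[mun]_y (Kf y)%:E.
  apply: subI => //; first exact: ltW.
  move=> y; rewrite /J /h1 loE; case: ifPn => yr; last by rewrite mul0r mulr0 mulr_ge0// ltW.
  (* At [y = 0] the right-hand side vanishes because [0 ^ (- a)] is 0; the condition [h 0 = 0] makes
     the left-hand side vanish too. *)
  have := enorm_ge0 y; rewrite le_eqVlt => /predU1P[y0|y0].
    by rewrite -y0 expr0n gtn_eqF// h00 mul0r mulr0 mulr_ge0// ltW.
  have yler : (enorm y <= r)%R by lra.
  have xy : (r / 2 <= enorm (subRn x y))%R.
    by have := ler_norm (r - enorm y); have := enorm_sub_ge x y; rewrite -/r; lra.
  have ylt : (enorm y < r)%R by lra.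
  have D0 : (0 < logdist (x, y))%R.
    by rewrite /logdist/= -/r gtr0_norm ?subr_gt0 ?ltr_ln ?posrE.
  have k1 := ler_powRN (divr_gt0 r0 (ltr0Sn R 1)) xy (ltW gam0).
  have k2 := expR_le_kernel_profile d0 a0 D0.
  have ra : (r `^ b * r `^ (- gam) = enorm y `^ (- a) * expR (- a * logdist (x, y)))%R.
    rewrite -powRD; last by rewrite (gt_eqF r0) implybT.
    by rewrite -powRN_shift//; congr (_ `^ _)%R; rewrite /gam; ring.
  rewrite powRN_half// in k1.
  apply: (@le_trans _ _ (r `^ b * (h (enorm y ^+ n) * (2 `^ gam * r `^ (- gam))))%R).
    by rewrite ler_wpM2l ?powR_ge0// ler_wpM2l.
  rewrite [leLHS](_ : (_ = 2 `^ gam * (h (enorm y ^+ n) * (r `^ b * r `^ (- gam))))%R); last by ring.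
  rewrite ra /C1 /Kf.
  rewrite [leRHS](_ : (_ = 2 `^ gam * (h (enorm y ^+ n) * (enorm y `^ (- a) *
     ((1 + 2 / a ^+ 2) * kernel_profile delta (logdist (x, y))))))%R); last by ring.
  by rewrite ler_wpM2l ?powR_ge0// ler_wpM2l// ler_wpM2l ?powR_ge0.
(* Outside, [|x - y| >= |y| / 2]; the decay now comes from [r^b |y|^-b], that is, from [b > 0]. *)
have I3 : (r `^ b)%:E * \int[mun]_y (J h3 y)%:E <= C3%:E * \int[mun]_y (Kf y)%:E.
  apply: subI => //; first exact: ltW.
  move=> y; rewrite /J /h3 hiE; case: ifPn => yr; last by rewrite mul0r mulr0 mulr_ge0// ltW.
  have y0 : (0 < enorm y)%R by lra.
  have rlt : (r < enorm y)%R by lra.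
  have xy : (enorm y / 2 <= enorm (subRn x y))%R.
    by have := ler_norm (- (r - enorm y)); have := enorm_sub_ge x y; rewrite -/r normrN; lra.
  have DE : (logdist (x, y) = `|ln (enorm y) - ln r|)%R by rewrite /logdist/= distrC.
  have D0 : (0 < logdist (x, y))%R.
    by rewrite DE gtr0_norm ?subr_gt0 ?ltr_ln ?posrE.
  have k1 := ler_powRN (divr_gt0 y0 (ltr0Sn R 1)) xy (ltW gam0).
  have k2 := expR_le_kernel_profile d0 b0 D0.
  have ra : (r `^ b * enorm y `^ (- gam) = enorm y `^ (- a) * expR (- b * logdist (x, y)))%R.
    have -> : (- gam = - a + - b)%R by rewrite /gam; ring.
    rewrite powRD; last by rewrite (gt_eqF y0) implybT.
    rewrite mulrCA; congr (_ * _)%R; rewrite DE (powRN_shift _ y0 r0 (ltW rlt)) mulrA powRN.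
    by rewrite mulfV ?mul1r// gt_eqF ?powR_gt0.
  rewrite powRN_half// in k1.
  apply: (@le_trans _ _ (r `^ b * (h (enorm y ^+ n) * (2 `^ gam * enorm y `^ (- gam))))%R).
    by rewrite ler_wpM2l ?powR_ge0// ler_wpM2l.
  rewrite [leLHS](_ : (_ = 2 `^ gam * (h (enorm y ^+ n) * (r `^ b * enorm y `^ (- gam))))%R); last by ring.
  rewrite ra /C3 /Kf.
  rewrite [leRHS](_ : (_ = 2 `^ gam * (h (enorm y ^+ n) * (enorm y `^ (- a) *
     ((1 + 2 / b ^+ 2) * kernel_profile delta (logdist (x, y))))))%R); last by ring.
  by rewrite ler_wpM2l ?powR_ge0// ler_wpM2l// ler_wpM2l ?powR_ge0.
have CBr0 : (0 <= CB / r ^+ n.-1)%R by rewrite divr_ge0 ?exprn_ge0 ?ltW.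
have I2 : (r `^ b)%:E * \int[mun]_y (J h2 y)%:E <= C2%:E * \int[mun]_y (Kf y)%:E.
  have mrad : measurable_fun setT (fun y : 'Rn[R]_n => (`|r - enorm y| `^ (- delta))%R).
    apply: (measurableT_comp (measurable_powR _)); apply: measurableT_comp => //.
    by apply: measurable_funB => //; exact: measurable_enorm.
  have mh2N : measurable_fun setT (fun y : 'Rn[R]_n => h2 (enorm y ^+ n)%R).
    exact: (measurableT_comp mh2 mN).
  apply: (@le_trans _ _ ((r `^ b)%:E * ((3 * r) `^ ex)%:E * \int[mun]_y
     ((enorm (subRn x y) `^ (- (delta + n.-1%:R)))%:E * (h2 (enorm y ^+ n)%R)%:E))).
    rewrite -muleA; apply: lee_wpmul2l => //.
    rewrite -ge0_integralZl//; last 3 first.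
    - apply: emeasurable_funM; last exact/measurable_EFinP.
      by apply/measurable_EFinP; exact: (measurableT_comp (measurable_powR _) mdist).
    - by move=> y _; apply: mule_ge0; rewrite lee_fin ?powR_ge0.
    - by rewrite lee_fin powR_ge0.
    apply: le_nonneg_integral => y; first exact: J0.
    rewrite -!EFinM lee_fin /J mulrA mulrC.
    rewrite /h2 loE' hiE'; case: ifPn => [/andP[y1 y2]|_]; last by rewrite !mulr0.
    rewrite ler_wpM2r//.
    have := enorm_ge0 (subRn x y); rewrite le_eqVlt => /predU1P[<-|xy0].
      by rewrite powR0 ?oppr_eq0 ?gt_eqF// mulr_ge0 ?powR_ge0.
    have xy3 : (enorm (subRn x y) <= 3 * r)%R by have := enorm_sub_le x y; rewrite -/r; lra.
    have -> : (- gam = ex + - (delta + n.-1%:R))%R by rewrite /ex; ring.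
    rewrite powRD; last by rewrite (gt_eqF xy0) implybT.
    by rewrite ler_wpM2r ?powR_ge0// ge0_ler_powR ?nnegrE ?(ltW xy0)// mulr_ge0// ltW.
  have HB' := HB x (fun t => (h2 t)%:E) r0 ((measurable_EFinP _ _).2 mh2) (fun t => h20 t).
  have X0 : 0 <= (r `^ b)%:E * ((3 * r) `^ ex)%:E by apply: mule_ge0; rewrite lee_fin ?powR_ge0.
  apply: (le_trans (lee_wpmul2l X0 HB')).
  rewrite muleA -/r -!EFinM -!ge0_integralZl//; last 6 first.
  - exact/measurable_EFinP.
  - by move=> y _; rewrite lee_fin.
  - by rewrite lee_fin ltW.
  - by apply: emeasurable_funM; exact/measurable_EFinP.
  - by move=> y _; apply: mule_ge0; rewrite lee_fin ?powR_ge0.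
  - by rewrite lee_fin mulr_ge0// mulr_ge0 ?powR_ge0.
  apply: le_nonneg_integral => y.
    rewrite -!EFinM lee_fin; apply: mulr_ge0; last by rewrite mulr_ge0 ?powR_ge0.
    by rewrite mulr_ge0// mulr_ge0 ?powR_ge0.
  rewrite -!EFinM lee_fin /h2 loE' hiE'; case: ifPn => [/andP[y1 y2]|_]; last first.
    by rewrite !mulr0 mulr_ge0// ltW.
  have y0 : (0 < enorm y)%R by lra.
  have [D1 D2] : (logdist (x, y) <= 1 /\ logdist (x, y) <= 2 * `|r - enorm y| / r)%R.
    by apply: logdist_le => //; rewrite y1 y2.
  (* At distance exactly 1 the profile takes its other branch; both branches equal 1 there. *)
  have kD : (kernel_profile delta (logdist (x, y)) = logdist (x, y) `^ (- delta))%R.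
    rewrite /kernel_profile; case: ltP => // D1'; have -> : logdist (x, y) = 1%R by apply/eqP; rewrite eq_le D1.
    by rewrite powR1.
  have rd : (`|r - enorm y| `^ (- delta) <= 2 `^ delta * r `^ (- delta) * kernel_profile delta (logdist (x, y)))%R.
    have := logdist_ge0 (x, y); rewrite le_eqVlt => /predU1P[D0|D0].
      (* On the sphere [|y| = |x|] the left-hand side is 0 by the convention on [0 ^ (- delta)]. *)
      have -> : enorm y = r.
        move: D0 => /esym/eqP; rewrite /logdist/= normr_eq0 subr_eq0 => /eqP/ln_inj.
        by rewrite !posrE /r => /(_ r0 y0) ->.
      by rewrite subrr normr0 powR0 ?oppr_eq0 ?gt_eqF// !mulr_ge0 ?powR_ge0 ?kernel_profile_ge0.
    rewrite kD -powRN_half// -powRM ?(ltW D0) ?divr_ge0 ?(ltW r0)//.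
    apply: ler_powRN; rewrite ?mulr_gt0 ?divr_gt0 ?(ltW d0)//.
    by move: D2; rewrite ler_pdivlMr//; lra.
  have ry : (r `^ (- a) <= 2 `^ a * enorm y `^ (- a))%R.
    rewrite -powRN_half//; apply: ler_powRN; [exact: divr_gt0| |exact: ltW].
    by rewrite ler_pdivrMr// mulrC.
  have hy := h0 (enorm y ^+ n)%R.
  rewrite /C2 /Kf powRM ?(ltW r0)//.
  (* The powers of [r] collected from scaling, surplus, shells and logarithm add up to
     [b + ex - (n - 1) - delta = -a]. *)
  have rr : (r `^ b * r `^ ex * r ^- n.-1 * r `^ (- delta) = r `^ (- a))%R.
    rewrite -powR_invn ?(ltW r0)// -!powRD ?(gt_eqF r0) ?implybT//.
    by congr (_ `^ _)%R; rewrite /ex /gam; ring.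
  set Ka := kernel_profile _ _ in rd *; set ha := h _ in hy *.
  have Ka0 : (0 <= Ka)%R by exact: kernel_profile_ge0.
  apply: (@le_trans _ _ ((3 `^ ex * CB * 2 `^ delta) * (r `^ (- a) * (Ka * ha)))%R).
    rewrite -rr.
    rewrite [leRHS](_ : (_ = r `^ b * (3 `^ ex * r `^ ex) * (CB / r ^+ n.-1) *
       (2 `^ delta * r `^ (- delta) * Ka * ha))%R); last by ring.
    have K0 : (0 <= r `^ b * (3 `^ ex * r `^ ex) * (CB / r ^+ n.-1))%R.
      by apply: mulr_ge0 => //; apply: mulr_ge0; rewrite ?mulr_ge0 ?powR_ge0.
    exact: (ler_wpM2l K0 (ler_wpM2r hy rd)).
  rewrite [leRHS](_ : (_ = (3 `^ ex * CB * 2 `^ delta) * ((2 `^ a * enorm y `^ (- a)) * (Ka * ha)))%R); last by ring.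
  rewrite ler_wpM2l ?mulr_ge0 ?powR_ge0 ?(ltW CB0)//.
  by rewrite ler_wpM2r// mulr_ge0.
have -> : \int[mun]_y (J h y)%:E =
    \int[mun]_y (J h1 y)%:E + \int[mun]_y (J h2 y)%:E + \int[mun]_y (J h3 y)%:E.
  rewrite -ge0_integralD//; [|by move=> y _; exact: J0|exact: mJ|by move=> y _; exact: J0|exact: mJ].
  rewrite -ge0_integralD//; last 4 first.
  - by move=> y _; rewrite adde_ge0//; exact: J0.
  - by apply: emeasurable_funD; exact: mJ.
  - by move=> y _; exact: J0.
  - exact: mJ.
  apply: eq_integral => y _; rewrite -!EFinD /J -!mulrDl; congr ((_ * _)%:E)%R.
  have lohi : (lo <= hi)%R.
    by rewrite ler_pXn2r ?nnegrE ?mulr_ge0 ?divr_ge0 ?(ltW r0)//; lra.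
  rewrite /h1 /h2 /h3; set s := (_ ^+ _)%R.
  have [slo|los] /= := ltP s lo.
    by rewrite ltNge (le_trans (ltW slo) lohi) !addr0.
  by have [shi|his] := leP s hi; rewrite ?add0r ?addr0.
have In0 (f : R -> R) : (forall t, 0 <= f t)%R -> 0 <= \int[mun]_y (J f y)%:E.
  by move=> f0; apply: integral_ge0 => y _; exact: J0.
have IK0 : 0 <= \int[mun]_y (Kf y)%:E by apply: integral_ge0 => y _; rewrite lee_fin.
have [IJ1 IJ2 IJ3] := And3 (In0 h1 h10) (In0 h2 h20) (In0 h3 h30).
rewrite (ge0_muleDr _ (adde_ge0 IJ1 IJ2) IJ3) (ge0_muleDr _ IJ1 IJ2).
have [E1 E2 E3] : [/\ 0 <= C1%:E, 0 <= C2%:E & 0 <= C3%:E].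
  by split; rewrite lee_fin ltW.
rewrite [(C1 + C2 + C3)%:E]EFinD [(C1 + C2)%:E]EFinD.
rewrite (ge0_muleDl _ (adde_ge0 E1 E2) E3) (ge0_muleDl _ E1 E2).
by apply: leeD => //; exact: leeD.
Qed.
End kernel_bound.

(** * Comparison of integrals outside a null set *)

Section null_set_integral.
Context d (T : measurableType d) (R : realType) (m : {measure set T -> \bar R}).
Local Open Scope ereal_scope.
Import HBNNSimple.

(** Only the simple functions below [f] are integrated off [Z], so [f] and [g] may be arbitrary
    nonnegative functions. *)
Lemma ae_le_nonneg_integral (Z : set T) (f g : T -> \bar R) : measurable Z -> m Z = 0 ->
  (forall x, 0 <= f x) -> (forall x, 0 <= g x) ->
  (forall x, ~ Z x -> f x <= g x) -> \int[m]_x f x <= \int[m]_x g x.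
Proof.
move=> mZ Z0 f0 g0 fg; rewrite [leLHS]ge0_integralE//.
apply: ge_ereal_sup => _ [h hf <-].
have mh : measurable_fun setT (fun x => (h x)%:E) by exact/measurable_EFinP.
rewrite -integralT_nnsfun (ge0_negligible_integral mZ measurableT mh _ Z0); last first.
  by move=> x _; rewrite lee_fin.
rewrite setTD integral_mkcond; apply: le_nonneg_integral => x; rewrite patchE; case: ifPn => //.
  by rewrite lee_fin.
rewrite inE => /= Zx; apply: le_trans (fg x Zx).
by have := hf x; rewrite patch_setT.
Qed.

(** The positive and the negative part are each dominated by [g] off [Z], and the difference of two
    numbers in [[0, G]] is at most [G] in absolute value. It is applied to [v] against the kernel,
    where [v] need not be Borel. *)
Lemma ae_abse_integral_le (Z : set T) (f g : T -> \bar R) : measurable Z -> m Z = 0 ->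
  (forall x, 0 <= g x) -> (forall x, ~ Z x -> `|f x| <= g x) ->
  `|\int[m]_x f x| <= \int[m]_x g x.
Proof.
move=> mZ Z0 g0 fg; rewrite integralE.
have P : \int[m]_x f^\+ x <= \int[m]_x g x.
  apply: (ae_le_nonneg_integral mZ Z0) => // x Zx; apply: le_trans (fg x Zx).
  by rewrite -/((abse \o f) x) fune_abse leeDl.
have N : \int[m]_x f^\- x <= \int[m]_x g x.
  apply: (ae_le_nonneg_integral mZ Z0) => // x Zx; apply: le_trans (fg x Zx).
  by rewrite -/((abse \o f) x) fune_abse leeDr.
have P0 : 0 <= \int[m]_x f^\+ x by exact: integral_ge0.
have N0 : 0 <= \int[m]_x f^\- x by exact: integral_ge0.
move: P N P0 N0; move: (\int[m]_x f^\+ x) (\int[m]_x f^\- x) (\int[m]_x g x).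
move=> [r| |] [s| |] [t| |]//; rewrite ?leey//= !lee_fin => rt st r0 s0.
by rewrite ler_norml; apply/andP; split; lra.
Qed.
End null_set_integral.

(** * The inequality for Borel profiles, and for radial functions *)

Section main.
Variables (R : realType) (n : nat).
Notation mun := (lebesgueRn R n).
Local Open Scope ereal_scope.

Lemma weighted_radial_hls (gamma p p' q alpha beta : R)
    (n_ge1 : (1 <= n)%N)
    (gamma_gt0 : (0 < gamma)%R) (gamma_lt : (gamma < n%:R)%R)
    (p_gt1 : (1 < p)%R) (conj_p : (p^-1 + p'^-1 = 1)%R) (le_pq : (p <= q)%R)
    (alpha_lt : (alpha < n%:R / p')%R)
    (beta_lt : (beta < n%:R / q)%R)
    (alpha_beta_ge : ((n%:R - 1) * (q^-1 - p^-1) <= alpha + beta)%R)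
    (scaling : (q^-1 = p^-1 + (gamma + alpha + beta) / n%:R - 1)%R) :
  exists2 C : R, (0 < C)%R & forall h : R -> R, measurable_fun setT h ->
    (forall t, (0 <= h t)%R) -> h 0%R = 0%R ->
    \int[mun]_y ((enorm y `^ alpha * h (enorm y ^+ n)) `^ p)%R%:E < +oo ->
    \int[mun]_x (((enorm x `^ (- beta))%:E *
      \int[mun]_y (h (enorm y ^+ n) * enorm (subRn x y) `^ (- gamma))%R%:E) `^ q) <=
    C%:E * (\int[mun]_y ((enorm y `^ alpha * h (enorm y ^+ n)) `^ p)%R%:E) `^ (q / p).
Proof.
have p0 : (0 < p)%R by lra.
have q0 : (0 < q)%R by lra.
have nR : (0 < n%:R :> R)%R by rewrite ltr0n.
have nRm : (n.-1%:R = n%:R - 1 :> R)%R by rewrite -[in RHS](prednK n_ge1) -natr1 addrK.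
have nR1 : (1 <= n%:R :> R)%R by rewrite ler1n.
have ip1 : (p^-1 < 1)%R by rewrite invf_lt1.
have iq0 : (0 < q^-1)%R by rewrite invr_gt0.
have iqp : (q^-1 <= p^-1)%R by rewrite lef_pV2 ?posrE.
pose a := (n%:R / p' - alpha)%R; pose b := (n%:R / q - beta)%R.
have a0 : (0 < a)%R by rewrite subr_gt0.
have b0 : (0 < b)%R by rewrite subr_gt0.
have gE : (gamma = n%:R * (q^-1 - p^-1 + 1) - (alpha + beta))%R.
  rewrite scaling; field; rewrite ?gt_eqF//.
have gab : (gamma = a + b)%R.
  rewrite gE /a /b; have -> : (p'^-1 = 1 - p^-1)%R by lra. ring.
(* For [p < q] the exponent is forced by the Hardy-Littlewood-Sobolev scaling. For [p = q] it must
   be positive, below 1 and at least [gamma - (n - 1)], which is below 1 because [gamma < n]. *)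
pose delta : R := if p == q then Num.max (gamma - n.-1%:R)%R (1 / 2)%R else (1 + q^-1 - p^-1)%R.
have d0 : (0 < delta)%R.
  rewrite /delta; case: ifP => _; last by lra.
  by rewrite lt_max; apply/orP; right; lra.
have d1 : (delta < 1)%R.
  rewrite /delta; case: eqP => [_|/eqP pq].
    by rewrite gt_max nRm; apply/andP; split; lra.
  have : (q^-1 < p^-1)%R by rewrite ltf_pV2 ?posrE// lt_neqAle pq.
  lra.
(* For [p < q], [gamma = n (1/q - 1/p + 1) - (alpha + beta)], and the lower bound on [alpha + beta]
   is precisely [gamma <= delta + n - 1]. *)
have dab : (a + b <= delta + n.-1%:R)%R.
  rewrite -gab /delta; case: eqP => [pq|_].
    by rewrite -lerBlDr le_max lexx.
  rewrite nRm gE; nra.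
have dE : (p < q)%R -> delta = (1 + q^-1 - p^-1)%R.
  by move=> pq; rewrite /delta lt_eqF.
pose w (y : 'Rn[R]_n) : R := (enorm y `^ (- n%:R))%R.
have mw : measurable_fun setT w.
  exact: (measurableT_comp (measurable_powR _) (@measurable_enorm R n)).
have w0 y : (0 <= w y)%R by exact: powR_ge0.
have M0 : (0 < 2 * n%:R * unit_ball_volume R n)%R by rewrite !mulr_gt0 ?unit_ball_volume_gt0.
have growthl (x : 'Rn[R]_n) (s : R) := @logdist_growth R n n_ge1 x s.
have growthr (y : 'Rn[R]_n) (s : R) : (0 < s)%R ->
    \int[mun]_x (if (logdist (x, y) < s)%R then w x else 0%R)%:E <=
    (2 * n%:R * unit_ball_volume R n * s)%:E.
  move=> s0; apply: le_trans (growthl y s s0); apply: le_nonneg_integral => x.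
    by rewrite lee_fin; case: ifP.
  by rewrite /logdist/= distrC.
have [C1 C10 H1] := kernel_bound n_ge1 a0 b0 d0 dab.
have [C2 C20 H2] := young_hls mw w0 (@measurable_logdist R n) (@logdist_ge0 R n) M0
  growthl growthr p_gt1 conj_p le_pq d0 d1 dE.
exists (C1 `^ q * C2)%R; first by rewrite mulr_gt0 ?powR_gt0.
move=> h mh h0 h00 Noo.
(* The exponent makes [g^p w] the integrand of the weighted norm; at the same time [g w] is [h]
   times [|y|^-a], since [alpha + n/p - n = -a]. *)
pose g (y : 'Rn[R]_n) := (enorm y `^ (alpha + n%:R / p) * h (enorm y ^+ n))%R.
have mhN : measurable_fun setT (fun y : 'Rn[R]_n => h (enorm y ^+ n)%R).
  exact: (measurableT_comp mh (@measurable_enormX R n n)).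
have mg : measurable_fun setT g.
  apply: measurable_funM => //.
  exact: (measurableT_comp (measurable_powR _) (@measurable_enorm R n)).
have g0 y : (0 <= g y)%R by rewrite mulr_ge0 ?powR_ge0.
have NE y : (g y `^ p * w y = (enorm y `^ alpha * h (enorm y ^+ n)) `^ p)%R.
  have := enorm_ge0 y; rewrite le_eqVlt => /predU1P[y0|y0].
    by rewrite /g -y0 expr0n gtn_eqF// h00 !mulr0 powR0 ?mul0r// gt_eqF.
  have e0 := powR_ge0 (enorm y); have hN := h0 (enorm y ^+ n)%R.
  rewrite /g (powRM _ (e0 _) hN) (powRM _ (e0 _) hN) /w mulrAC.
  congr (_ * _)%R; rewrite -!powRrM -powRD; last by rewrite (gt_eqF y0) implybT.
  by congr (_ `^ _)%R; rewrite mulrDl divfK ?gt_eqF// addrK.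
have H2g := H2 g mg g0.
rewrite (eq_integral (fun y => ((enorm y `^ alpha * h (enorm y ^+ n)) `^ p)%R%:E)) in H2g; last first.
  by move=> y _; rewrite NE.
have {}H2g := H2g Noo.
set F := fun x => \int[mun]_y (kernel_profile delta (logdist (x, y)) * g y * w y)%:E in H2g.
have F0 x : 0 <= F x.
  apply: integral_ge0 => y _; rewrite lee_fin.
  exact: mulr_ge0 (mulr_ge0 (kernel_profile_ge0 _ _) (g0 _)) (w0 _).
have mF : measurable_fun setT F.
  apply: (measurable_fun_fubini_tonelli_F (fun u : 'Rn[R]_n * 'Rn[R]_n => (kernel_profile delta (logdist u) * g u.2 * w u.2)%:E)).
    apply/measurable_EFinP; apply: measurable_funM; last exact: (measurableT_comp mw).
    apply: measurable_funM; last exact: (measurableT_comp mg).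
    exact: (measurableT_comp (measurable_kernel_profile delta) (@measurable_logdist R n)).
  move=> u; rewrite lee_fin.
  exact: mulr_ge0 (mulr_ge0 (kernel_profile_ge0 _ _) (g0 _)) (w0 _).
have mFq : measurable_fun setT (fun x => F x `^ q * (w x)%:E).
  apply: emeasurable_funM; last exact/measurable_EFinP.
  exact: (measurableT_comp (measurable_poweR _)).
apply: (@le_trans _ _ ((C1 `^ q)%:E * \int[mun]_x (F x `^ q * (w x)%:E))); last first.
  rewrite [(C1 `^ q * C2)%:E]EFinM -muleA; apply: lee_wpmul2l => //.
  by rewrite lee_fin powR_ge0.
rewrite -ge0_integralZl//; last 2 first.
- by move=> x _; rewrite mule_ge0 ?poweR_ge0 ?lee_fin.
- by rewrite lee_fin powR_ge0.
have mE0 := @measurable_enorm_eq0 R n.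
apply: (ae_le_nonneg_integral mE0 (lebesgueRn_enorm_eq0 R n_ge1)).
- by move=> x; exact: poweR_ge0.
- by move=> x; rewrite !mule_ge0 ?poweR_ge0 ?lee_fin ?powR_ge0.
move=> x /= /eqP x0.
have xp : (0 < enorm x)%R by rewrite lt_def x0 enorm_ge0.
have := H1 x h xp mh h0 h00; rewrite -gab.
set I := \int[mun]_y _ => HI.
have I0 : 0 <= I by apply: integral_ge0 => y _; rewrite lee_fin mulr_ge0 ?powR_ge0.
have FE : \int[mun]_y (kernel_profile delta (logdist (x, y)) * (h (enorm y ^+ n) * enorm y `^ (- a)))%:E = F x.
  apply: eq_integral => y _; rewrite -mulrA; congr (_ * _)%:E%R.
  have := enorm_ge0 y; rewrite le_eqVlt => /predU1P[y0|y0].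
    by rewrite /g -y0 expr0n gtn_eqF// h00 !(mulr0, mul0r).
  rewrite /g mulrAC mulrC; congr (_ * _)%R.
  rewrite /w -powRD; last by rewrite (gt_eqF y0) implybT.
  rewrite /a; have -> : (p'^-1 = 1 - p^-1)%R by rewrite -[1%R]conj_p addrAC subrr add0r.
  by congr (_ `^ _)%R; ring.
rewrite FE in HI.
move: (F x) (F0 x) HI => Fx Fx0; clearbody I => HI.
have A0 : 0 <= (enorm x `^ (- (n%:R / q)))%:E by rewrite lee_fin powR_ge0.
have B0 : 0 <= (enorm x `^ b)%:E by rewrite lee_fin powR_ge0.
have C1E : 0 <= C1%:E by rewrite lee_fin ltW.
(* After taking [q]-th powers the factor with exponent [-n/q] becomes the weight [w], and [|x|^b] is
   what [kernel_bound] expects. *)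
have -> : (enorm x `^ (- beta) = enorm x `^ (- (n%:R / q)) * enorm x `^ b)%R.
  rewrite -powRD; last by rewrite (gt_eqF xp) implybT.
  by congr (_ `^ _)%R; rewrite /b; ring.
have wE : (enorm x `^ (- (n%:R / q)))%:E `^ q = (w x)%:E.
  by rewrite poweR_EFin -powRrM mulNr divfK ?gt_eqF.
rewrite [(_ * enorm x `^ b)%:E]EFinM -muleA (poweRM _ A0 (mule_ge0 B0 I0)) wE.
rewrite muleC muleA; apply: lee_wpmul2r; first by rewrite lee_fin.
rewrite -poweR_EFin -(poweRM _ C1E Fx0).
apply: gt0_ler_poweR => //; first exact: ltW.
- by rewrite in_itv/= leey andbT (mule_ge0 B0 I0).
- by rewrite in_itv/= leey andbT (mule_ge0 C1E Fx0).
Qed.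
End main.

Theorem theorem1p2 (R : realType) (n : nat) (gamma p p' q alpha beta : R)
    (n_ge1 : (1 <= n)%N)
    (gamma_gt0 : 0 < gamma) (gamma_lt : gamma < n%:R)
    (p_gt1 : 1 < p) (conj_p : p^-1 + p'^-1 = 1) (le_pq : p <= q)
    (alpha_lt : alpha < n%:R / p')
    (beta_lt : beta < n%:R / q)
    (alpha_beta_ge : (n%:R - 1) * (q^-1 - p^-1) <= alpha + beta)
    (scaling : q^-1 = p^-1 + (gamma + alpha + beta) / n%:R - 1) :
  exists C : R, forall v : 'Rn[R]_n -> R,
    weighted_Lp p alpha v -> radially_symmetric v ->
    ('N[lebesgueRn R n]_(q%:E)
        [(fun x => (enorm x `^ (- beta))%:E * fractional_integral gamma v x)]
     <= C%:E *
        'N[lebesgueRn R n]_(p%:E) [(fun x => (enorm x `^ alpha * v x)%:E)])%E.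
Proof.
have p0 : 0 < p by lra.
have q0 : 0 < q by lra.
have [C C0 HC] := weighted_radial_hls n_ge1 gamma_gt0 gamma_lt p_gt1 conj_p
  le_pq alpha_lt beta_lt alpha_beta_ge scaling.
exists (C `^ q^-1) => v [mv vfin] vrad.
have [h' [Z [mh' h'0 mZ Z0 hv]]] := radial_borel n_ge1 mv vrad.
(* Resetting the profile at 0 affects only the origin, which is null. *)
pose h (t : R) : R := if t == 0 then 0 else h' t.
have mh : measurable_fun setT h.
  by apply: measurable_fun_ifT => //; exact: measurable_fun_eqr.
have h0 t : 0 <= h t by rewrite /h; case: ifP.
have h00 : h 0 = 0 by rewrite /h eqxx.
pose E0 := [set y : 'Rn[R]_n | enorm y = 0].
have mE0 : measurable E0 by exact: measurable_enorm_eq0.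
have mZ' : measurable (Z `|` E0) by exact: measurableU.
have Z'0 : lebesgueRn R n (Z `|` E0) = 0%E.
  exact: etrans (measureU0 mZ mE0 (lebesgueRn_enorm_eq0 R n_ge1)) Z0.
have hvE y : ~ (Z `|` E0) y -> h (enorm y ^+ n) = `|v y|.
  move=> /not_orP[Zy /= /eqP y0].
  by rewrite /h expf_eq0 (negbTE y0) andbF hv.
set Np := (\int[lebesgueRn R n]_y `|(enorm y `^ alpha * v y)%:E| `^ p)%E.
have Np0 : (0 <= Np)%E by apply: integral_ge0 => y _; exact: poweR_ge0.
have NormE : ('N[lebesgueRn R n]_p%:E[(fun x => (enorm x `^ alpha * v x)%:E)] = Np `^ p^-1)%E.
  by rewrite unlock.
have Npfin : (Np < +oo)%E.
  by move: vfin; rewrite /finite_norm NormE => /lty_poweRy; apply; rewrite invr_neq0// gt_eqF.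
have hNp : (\int[lebesgueRn R n]_y ((enorm y `^ alpha * h (enorm y ^+ n)) `^ p)%R%:E <= Np)%E.
  apply: (ae_le_nonneg_integral mZ' Z'0) => [y|y|y Zy]; rewrite ?lee_fin ?powR_ge0 ?poweR_ge0//.
  by rewrite hvE// normrM (ger0_norm (powR_ge0 _ _)).
have {}HC := HC h mh h0 h00 (le_lt_trans hNp Npfin).
rewrite NormE unlock.
set I := (\int[_]_x _)%E.
have I0 : (0 <= I)%E by apply: integral_ge0 => x _; exact: poweR_ge0.
have IC : (I <= C%:E * Np `^ (q / p))%E.
  apply: (@le_trans _ _ _ _ _ _ (le_trans HC _)); last first.
    apply: lee_wpmul2l; first by rewrite lee_fin ltW.
    apply: gt0_ler_poweR => //; first by rewrite divr_ge0// ltW.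
    - by rewrite in_itv/= leey andbT; apply: integral_ge0 => y _; rewrite lee_fin powR_ge0.
    - by rewrite in_itv/= leey andbT.
  (* Pointwise in [x], the absolute value of the fractional integral is at most the integral of
     [|v|] against the kernel, and [|v|] may be replaced by [h] off a null set. *)
  apply: le_nonneg_integral => x; first exact: poweR_ge0.
  apply: gt0_ler_poweR; [exact: ltW|by rewrite in_itv/= leey andbT| |].
    rewrite in_itv/= leey andbT mule_ge0// ?lee_fin ?powR_ge0//.
    by apply: integral_ge0 => y _; rewrite lee_fin mulr_ge0 ?powR_ge0.
  rewrite abseM abse_EFin ger0_norm ?powR_ge0//; apply: lee_wpmul2l.
    by rewrite lee_fin powR_ge0.
  apply: (ae_abse_integral_le mZ' Z'0) => [y|y Zy].
    by rewrite lee_fin mulr_ge0 ?powR_ge0.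
  by rewrite abse_EFin lee_fin normrM hvE// -powRN (ger0_norm (powR_ge0 _ _)).
apply: (@le_trans _ _ ((C%:E * Np `^ (q / p)) `^ q^-1)%E).
  apply: gt0_ler_poweR => //; first by rewrite invr_ge0 ltW.
  - by rewrite in_itv/= leey andbT.
  - by rewrite in_itv/= leey andbT mule_ge0 ?poweR_ge0// lee_fin ltW.
rewrite poweRM ?poweR_ge0 ?lee_fin ?(ltW C0)// poweR_EFin -poweRrM.
by rewrite mulrAC mulfV ?mul1r// gt_eqF.
Qed.
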